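(* Consider the scaled Model II with scaling exponent $\alpha>0$, and let $\gamma:=\max\{1-\alpha/2,\,1/2\}$. As $N\to\infty$, the random variables $$\frac{M^{(N)}-N\varrho}{N^\gamma}\qquad\text{and}\qquad \frac{M^{(N)}(t)-N\varrho(t)}{N^\gamma}\quad(t\ge 0)$$ converge in distribution to Normal distributions with zero mean and variances $$\sum_{j=1}^d\sum_{k=1}^d [V]_{jk}1_{\{\alpha\le 1\}}+\varrho\,1_{\{\alpha\ge 1\}}\qquad\text{and}\qquad \sum_{j=1}^d\sum_{k=1}^d [V(t)]_{jk}1_{\{\alpha\le 1\}}+\varrho(t)\,1_{\{\alpha\ge 1\}},$$ respectively.
   Context: Background process: $J=(J(t))$ is an irreducible continuous-time Markov process on $\{1,\dots,d\}$ with transition rate matrix $Q=(q_{ij})$, unique stationary distribution $\boldsymbol\pi=(\pi_1,\dots,\pi_d)^{\rm T}$, and transition probabilities $p_{ij}(t)=\mathbb P(J(t)=j\mid J(0)=i)$. The deviation matrix $D$ of $J$ is $[D]_{ij}:=\int_0^\infty (p_{ij}(t)-\pi_j)\,{\rm d}t$. Model II (Markov-modulated infinite-server queue): while $J(t)=i$, jobs arrive according to a Poisson process with rate $\lambda_i\ge 0$. All jobs are served in parallel, starting immediately on arrival. A job arriving while the background process is in state $i$ has a service time that is exponentially distributed with mean $\mu_i^{-1}$, where $\mu_i>0$, independent of everything else; it leaves when its service is completed. $J$ evolves independently of the queue. $M(t)$ is the total number of jobs present at time $t$. Scaling: for $N\in\mathbb N$ and fixed $\alpha>0$, replace $\lambda_i$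 by $N\lambda_i$ and $q_{ij}$ by $N^\alpha q_{ij}$ (service rates unchanged). The resulting total number of jobs is $M^{(N)}(t)$, with the system empty at time $0$; $M^{(N)}$ denotes its stationary counterpart (a random variable with the steady-state distribution). Notation (all in terms of the unscaled parameters): $$\varrho(t):=\sum_{k=1}^d\pi_k\frac{\lambda_k}{\mu_k}(1-e^{-\mu_k t}),\qquad \varrho:=\sum_{k=1}^d\pi_k\frac{\lambda_k}{\mu_k},$$ $[\bar D]_{jk}:=\pi_j[D]_{jk}+\pi_k[D]_{kj}$, $$[V(t)]_{jk}:=\frac{\lambda_j\lambda_k[\bar D]_{jk}}{\mu_j+\mu_k}\bigl(1-e^{-(\mu_j+\mu_k)t}\bigr),\qquad [V]_{jk}:=\frac{\lambda_j\lambda_k[\bar D]_{jk}}{\mu_j+\mu_k}.$$ Normal distributions may be degenerate. *)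

(* Defs.v *)
From HB Require Import structures.
From mathcomp Require Import all_boot all_order all_algebra finmap.
From mathcomp Require Import all_classical all_reals all_analysis measurable_realfun.
Set Implicit Arguments.
Unset Strict Implicit.
Unset Printing Implicit Defensive.
Import Order.TTheory GRing.Theory Num.Theory.
Import numFieldNormedType.Exports.
Local Open Scope classical_set_scope.
Local Open Scope ring_scope.

Definition is_rate_matrix (R : realType) (d : nat) (Q : 'M[R]_d) : Prop :=
  (forall i j, i != j -> 0 <= Q i j) /\ (forall i, \sum_j Q i j = 0).

Definition irreducible_rates (R : realType) (d : nat) (Q : 'M[R]_d) : Prop :=
  forall i j, connect (fun k l : 'I_d => (k != l) && (0 < Q k l)) i j.

Definition is_stationary_distribution (R : realType) (d : nat)
    (Q : 'M[R]_d) (p : 'I_d -> R) : Prop :=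
  [/\ forall i, 0 <= p i, \sum_i p i = 1 &
      forall j, \sum_i p i * Q i j = 0].

(* The transition matrix exp(tQ), given by its (entrywise convergent)
   exponential series. *)
Definition transition (R : realType) (d : nat) (Q : 'M[R]_d) (t : R) :
    'M[R]_d :=
  \matrix_(i, j)
    limn (series (fun k : nat => t ^+ k / k`!%:R * (Q ^+ k) i j)).

Definition deviation_matrix (R : realType) (d : nat) (Q : 'M[R]_d)
    (p : 'I_d -> R) : 'M[R]_d :=
  \matrix_(i, j)
    (\int[lebesgue_measure]_(t in `[0, +oo[) (transition Q t i j - p j))%R.

(* [J t] is the state at time [t]; only times [t >= 0] are relevant. The law
   of [J 0] is unconstrained. *)
Definition is_markov_process (R : realType) (d : nat)
    (dO : measure_display) (Om : measurableType dO) (P : probability Om R)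
    (Q : 'M[R]_d) (J : R -> Om -> 'I_d) : Prop :=
  [/\ forall t i, 0 <= t -> measurable [set w | J t w = i],
      forall w t, 0 <= t -> \forall s \near t^'+, J s w = J t w &
      forall (n : nat) (t : nat -> R) (s : nat -> 'I_d),
        t 0%N = 0 -> (forall k, t k <= t k.+1) ->
        P [set w | forall k, (k <= n)%N -> J (t k) w = s k] =
        (P [set w | J 0%R w = s 0%N] *
         (\prod_(k < n)
            transition Q (t k.+1 - t k)%R (s k) (s k.+1))%:E)%E].

Definition arrivals_between (R : realType) (Om : Type)
    (T : nat -> Om -> \bar R) (a b : R) (w : Om) : nat :=
  #|` fset_set [set n | (a%:E < T n w)%E && (T n w <= b%:E)%E]|.

(* [T n] is the epoch of the n-th point, [+oo] if there is none (as happens at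
   rate 0). [poisson_prob]'s second argument is a dummy; unlike
   [poisson_pmf], [poisson_prob] is the Dirac mass at 0 at rate 0. *)
Definition is_poisson_process (R : realType)
    (dO : measure_display) (Om : measurableType dO) (P : probability Om R)
    (rate : R) (T : nat -> Om -> \bar R) : Prop :=
  [/\ forall n, measurable_fun setT (T n),
      forall w n, (0 < T n w)%E,
      forall w n, (T n w <= T n.+1 w)%E,
      forall w (t : R), finite_set [set n | (T n w <= t%:E)%E] &
      forall (n : nat) (t : nat -> R) (m : nat -> nat),
        0 <= t 0%N -> (forall k, t k <= t k.+1) ->
        P [set w | forall k, (k < n)%N ->
                     arrivals_between T (t k) (t k.+1) w = m k] =
        (\prod_(k < n)
           poisson_prob (rate * (t k.+1 - t k))%R 0%N [set m k])%E].

Definition mutually_independent (R : realType)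
    (dO : measure_display) (Om : measurableType dO) (P : probability Om R)
    (I : choiceType) (F : I -> set (set Om)) : Prop :=
  forall (s : {fset I}) (B : I -> set Om),
    (forall i, i \in s -> F i (B i)) ->
    P [set w | forall i, i \in s -> B i w] = (\prod_(i <- s) P (B i))%E.

(* The sigma-algebras generated by the background process, by each of the d
   arrival streams, and by each individual service time. *)
Definition input_sigma (R : realType) (d : nat)
    (dO : measure_display) (Om : measurableType dO)
    (J : R -> Om -> 'I_d) (T : 'I_d -> nat -> Om -> \bar R)
    (S : 'I_d -> nat -> Om -> R) (x : unit + ('I_d + 'I_d * nat)) :
    set (set Om) :=
  match x with
  | inl _ => <<s [set A | exists t i, 0 <= t /\ A = [set w | J t w = i]] >>
  | inr (inl i) => <<s [set A | exists n (B : set (\bar R)),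
                          measurable B /\ A = T i n @^-1` B] >>
  | inr (inr (i, n)) => [set A | exists B : set R,
                          measurable B /\ A = S i n @^-1` B]
  end.

(* Each state i carries its own Poisson stream of rate [lam i] with epochs
   [T i n], whose points are turned into actual arrivals only when the
   background process is in state i at that epoch: jobs thus arrive at rate
   [lam i] while [J = i]. The job generated by point n of stream i has service
   time [S i n]. *)
Definition is_modelII (R : realType) (d : nat)
    (dO : measure_display) (Om : measurableType dO) (P : probability Om R)
    (Q : 'M[R]_d) (lam mu : 'I_d -> R)
    (J : R -> Om -> 'I_d) (T : 'I_d -> nat -> Om -> \bar R)
    (S : 'I_d -> nat -> Om -> R) : Prop :=
  [/\ is_markov_process P Q J,
      forall i, is_poisson_process P (lam i) (T i),
      forall i n, measurable_fun setT (S i n),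
      forall i n (B : set R), measurable B ->
        P (S i n @^-1` B) = exponential_prob (mu i) B &
      mutually_independent P (input_sigma J T S)].

(* The jobs (i, n) present at time t, when the system starts empty at time 0
   (recall that all epochs are positive). *)
Definition jobs_present (R : realType) (d : nat) (Om : Type)
    (J : R -> Om -> 'I_d) (T : 'I_d -> nat -> Om -> \bar R)
    (S : 'I_d -> nat -> Om -> R) (t : R) (w : Om) : set ('I_d * nat) :=
  [set x | [/\ (T x.1 x.2 w <= t%:E)%E,
               J (fine (T x.1 x.2 w)) w = x.1 &
               (t%:E < T x.1 x.2 w + (S x.1 x.2 w)%:E)%E]].

Definition number_in_system (R : realType) (d : nat) (Om : Type)
    (J : R -> Om -> 'I_d) (T : 'I_d -> nat -> Om -> \bar R)
    (S : 'I_d -> nat -> Om -> R) (t : R) (w : Om) : nat :=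
  #|` fset_set (jobs_present J T S t w)|.

(* [Y] is distributed as the limit in law, as t -> oo, of the integer-valued
   process [M]. *)
Definition has_steady_state_law (R : realType)
    (dO : measure_display) (Om : measurableType dO) (P : probability Om R)
    (M : R -> Om -> nat)
    (dO' : measure_display) (Om' : measurableType dO')
    (P' : probability Om' R) (Y : Om' -> nat) : Prop :=
  measurable_fun setT Y /\
  forall n : nat,
    P [set w | M t w = n] @[t --> +oo] --> P' [set w | Y w = n].

(* [normal_prob m 0] is not the degenerate normal law, hence the case split;
   [normal_prob] takes the standard deviation. *)
Definition normal_law (R : realType) (m v : R) : set R -> \bar R :=
  if v == 0 then \d_m else normal_prob m (Num.sqrt v).

Definition cvg_in_distribution (R : realType)
    (dO : nat -> measure_display) (Om : forall N, measurableType (dO N))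
    (P : forall N, probability (Om N) R) (X : forall N, Om N -> R)
    (nu : set R -> \bar R) : Prop :=
  forall x : R, {for x, continuous (fun y : R => nu [set z : R | z <= y])} ->
    P N [set w | X N w <= x] @[N --> \oo] --> nu [set z : R | z <= x].

Definition cvg_to_centered_normal (R : realType)
    (dO : nat -> measure_display) (Om : forall N, measurableType (dO N))
    (P : forall N, probability (Om N) R) (X : forall N, Om N -> R)
    (v : R) : Prop :=
  0 <= v /\ cvg_in_distribution P X (normal_law 0 v).

Definition rho_at (R : realType) (d : nat) (p lam mu : 'I_d -> R) (t : R) : R :=
  \sum_k p k * (lam k / mu k) * (1 - expR (- (mu k * t))).

Definition rho (R : realType) (d : nat) (p lam mu : 'I_d -> R) : R :=
  \sum_k p k * (lam k / mu k).

Definition Dbar (R : realType) (d : nat) (Q : 'M[R]_d) (p : 'I_d -> R) :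
    'M[R]_d :=
  \matrix_(j, k) (p j * deviation_matrix Q p j k +
                  p k * deviation_matrix Q p k j).

Definition V_at (R : realType) (d : nat) (Q : 'M[R]_d)
    (p lam mu : 'I_d -> R) (t : R) : 'M[R]_d :=
  \matrix_(j, k) (lam j * lam k * Dbar Q p j k / (mu j + mu k) *
                  (1 - expR (- ((mu j + mu k) * t)))).

Definition V (R : realType) (d : nat) (Q : 'M[R]_d) (p lam mu : 'I_d -> R) :
    'M[R]_d :=
  \matrix_(j, k) (lam j * lam k * Dbar Q p j k / (mu j + mu k)).

(* Main.v *)
Require Import Defs.
From mathcomp Require Import all_boot all_order all_algebra finmap.
From mathcomp Require Import all_classical all_reals all_analysis measurable_realfun.
From mathcomp Require Import ring lra.
Set Implicit Arguments.
Unset Strict Implicit.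
Unset Printing Implicit Defensive.
Import Order.TTheory GRing.Theory Num.Theory.
Import numFieldNormedType.Exports.
Local Open Scope classical_set_scope.
Local Open Scope ring_scope.

(** Both statements come from one estimate on Fourier transforms that is uniform in
time, [charfun_estimate], followed by Levy's continuity theorem.

Write [n = N], [r = N ^ alpha], [de = N ^ (- gamma)]. Fix [t] and, for [s <= t], count
the jobs that have arrived up to time [s] and will still be present at time [t].
Together with the background state this count is a Markov chain in [s]: the
background jumps at the rates [r Q] and, in state [j], the count grows by one at
rate [n lam_j exp (- mu_j (t - s))], since a job arriving at [s] survives until [t]
with probability [exp (- mu_j (t - s))]. The count vanishes at [s = 0] and is the
number in the system at [s = t]. Hence, if the generator of this chain sends a
function [F] of the time, the state and the count to something small, the
expectations of [F] at [s = 0] and [s = t] are close ([dynkin_inequality]).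

A suitable [F] is found by averaging. The first guess is [E (t - s) cos w], where [w]
is [th de] times the count minus its mean, plus a constant, and
[E u = exp (- th ^ 2 / 2 (n ^ 2 de ^ 2 / r V(u) + n de ^ 2 rho(u)))], [V(u)] being the
sum of the entries of the matrix [V_at u]. It is wrong by terms that
oscillate with the background, and these are removed by correctors of sizes
[n de / r] and [1 / r], built with the deviation matrix [D], which solves the Poisson
equation [Q D = Pi - I] ([deviation_poisson]). The product of the first corrector
with the fluctuation of the arrival rate has stationary mean [V'(u) / 2]
([sum_Dbar_rate]): this is how [D] enters the variance, whereas the second-order
Taylor term of the jumps gives [rho]. The cancellation is [generator_identity], and
it leaves
[E cos (th de (M(t) - n rho(t)) + c) = cos c E(t) + O (n de / r + de + 1 / r)].

For the chosen [gamma] the three errors vanish, and [n ^ 2 de ^ 2 / r] and [n de ^ 2]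
tend to the indicators of [alpha <= 1] and [1 <= alpha]. The limiting variance is
nonnegative because a Fourier transform is bounded by one. At fixed [N] the
estimate passes to the steady state as [t] goes to infinity
([steady_state_expectation]).

The other ingredients are the law of the chain (independence of the streams, of
the service times and of the background gives thinned Poisson increments,
[joint_law_marked_arrivals] and [one_step_law]), exponential ergodicity from a
Poincare inequality ([transition_ergodic]), the Fourier transform of the normal
law ([gaussian_fourier]) and Levy's theorem by Gaussian smoothing
([levy_continuity]). *)

(** * Transition semigroup and exponential ergodicity *)

Lemma cvg_sumr (R : realType) (I T : Type) (F : set_system T) (r : seq I)
    (P : pred I) (u : I -> T -> R) (l : I -> R) : Filter F ->
  (forall i, P i -> u i x @[x --> F] --> l i) ->
  \sum_(i <- r | P i) u i x @[x --> F] --> \sum_(i <- r | P i) l i.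
Proof. by move=> FF; apply: cvg_big; exact: add_continuous. Qed.

Lemma is_derive_expRZ (R : realType) (c x : R) :
  is_derive x (1 : R) (fun u => expR (c * u)) (c * expR (c * x)).
Proof.
have H : is_derive x (1 : R) ( *%R c) c.
  by apply: is_derive_eq; rewrite /GRing.scale/= mulr1.
by rewrite mulrC; exact: (@is_derive1_comp _ expR ( *%R c) x _ _ (is_derive_expR _) H).
Qed.

Section transition_semigroup.
Variables (R : realType) (d : nat) (Q : 'M[R]_d).

Let coef (m : nat) (i j : 'I_d) (k : nat) : R := (Q ^+ (m + k)) i j / k`!%:R.

Lemma mx_norm_pow_le :
  {c : R | 0 <= c & forall k i j, `|(Q ^+ k) i j| <= c ^+ k}.
Proof.
pose c : R := 1 + \sum_i \sum_j `|Q i j|.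
have c0 : 0 <= c by apply: addr_ge0 => //; do 2! apply: sumr_ge0 => ? _.
exists c => //; elim=> [|k IH] i j.
  by rewrite !expr0 mxE; case: eqP => _; rewrite ?mulr1n ?mulr0n ?normr1 ?normr0.
rewrite !exprS -mulmxE mxE (le_trans (ler_norm_sum _ _ _))//.
apply: (@le_trans _ _ (\sum_l `|Q i l| * c ^+ k)).
  by apply: ler_sum => l _; rewrite normrM ler_wpM2l.
rewrite -mulr_suml ler_wpM2r ?exprn_ge0//.
rewrite /c [leRHS](_ : _ = \sum_l `|Q i l| + (1 + \sum_(k | k != i) \sum_l `|Q k l|)).
  by rewrite lerDl addr_ge0//; apply: sumr_ge0 => ? _; exact: sumr_ge0.
by rewrite (bigD1 i)//= addrCA.
Qed.

Let coef_cvg m i j x : cvgn (pseries (coef m i j) x).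
Proof.
have [c c0 Hc] := mx_norm_pow_le.
apply: normed_cvg; apply: (@series_le_cvg _ _ (fun k => c ^+ m * exp_coeff (c * `|x|) k)).
- by move=> n /=.
- move=> n; rewrite mulr_ge0 ?exprn_ge0//.
  by rewrite /exp_coeff /= divr_ge0// exprn_ge0// mulr_ge0.
- move=> n /=; rewrite /coef normrM normrX [X in X * _]normrM (@ger0_norm _ (n`!%:R^-1)) ?invr_ge0//.
  rewrite /exp_coeff /= exprMn.
  have -> : c ^+ m * (c ^+ n * `|x| ^+ n / n`!%:R) = c ^+ (m + n) / n`!%:R * `|x| ^+ n.
    by rewrite exprD; ring.
  by rewrite ler_wpM2r ?exprn_ge0// ler_wpM2r ?invr_ge0.
- rewrite [X in cvgn X](_ : _ = (fun n => c ^+ m * series (exp_coeff (c * `|x|)) n)).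
    by apply: is_cvgMr; exact: is_cvg_series_exp_coeff.
  by apply/funext => n; rewrite /series/= mulr_sumr.
Qed.

Let coef_diffs m i j : pseries_diffs (coef m i j) = coef m.+1 i j.
Proof.
apply/funext => k; rewrite /pseries_diffs /coef factS natrM addSnnS.
by rewrite invfM mulrCA mulVKf.
Qed.

Let transitionE t i j : transition Q t i j = limn (pseries (coef 0 i j) t).
Proof.
rewrite mxE; congr (limn (series _)); apply/funext => k /=.
by rewrite /coef add0n; ring.
Qed.

Let derive_coef (i j : 'I_d) (t : R) : is_derive t 1 (fun t : R => transition Q t i j)
  (limn (pseries (coef 1 i j) t)).
Proof.
rewrite [X in is_derive _ _ X _](_ : _ = (fun x => limn (pseries (coef 0 i j) x))).
  by rewrite -coef_diffs; apply: (@pseries_snd_diffs _ _ (`|t| + 1));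
    rewrite ?coef_diffs//; rewrite [ltRHS]ger0_norm ?ltrDl// addr_ge0.
by apply/funext => s; exact: transitionE.
Qed.

Lemma transition0 : transition Q 0 = 1%:M.
Proof.
apply/matrixP => i j; rewrite mxE; apply: lim_near_cst => //.
exists 1%N => // -[//|n] _; rewrite /series/= big_nat_recl// expr0 fact0 divr1 mul1r.
by rewrite big1 ?addr0// => k _; rewrite expr0n/= mul0r mul0r.
Qed.

(** Term by term differentiation of the exponential series. *)
Lemma derive_transition_backward (i j : 'I_d) (t : R) :
  is_derive t 1 (fun t : R => transition Q t i j) (\sum_k Q i k * transition Q t k j).
Proof.
have -> : \sum_k Q i k * transition Q t k j = limn (pseries (coef 1 i j) t).
  apply/esym/cvg_lim => //.
  rewrite (_ : pseries _ _ = (fun n => \sum_k (Q i k * pseries (coef 0 k j) t n))).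
    apply: cvg_sumr => k _; apply: cvgMr; rewrite transitionE; exact: coef_cvg.
  apply/funext => n; rewrite /pseries /series/=.
  under [RHS]eq_bigr do rewrite mulr_sumr.
  rewrite exchange_big/=; apply: eq_bigr => l _.
  rewrite /coef add1n exprS -mulmxE mxE 2!mulr_suml; apply: eq_bigr => k _.
  by rewrite add0n !mulrA.
exact: derive_coef.
Qed.

End transition_semigroup.

Lemma is_derive_sumr (R : realType) (n : nat) (f : 'I_n -> R -> R) (df : 'I_n -> R) (x : R) :
  (forall i, is_derive x 1 (f i) (df i)) ->
  is_derive x 1 (fun y => \sum_i f i y) (\sum_i df i).
Proof.
move=> H; rewrite (_ : (fun y => _) = \sum_i f i); first exact: is_derive_sum.
by apply/funext => y; rewrite fct_sumE.
Qed.

Lemma le_at0_of_derive_le0 (R : realType) (f df : R -> R) :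
  (forall x, is_derive x (1 : R) f (df x)) -> (forall x, 0 <= x -> df x <= 0) ->
  forall x, 0 <= x -> f x <= f 0.
Proof.
move=> f1 f0 x x0.
have [|c] := @MVT_segment R f df 0 x x0 (fun y _ => f1 y).
  apply: continuous_subspaceT => y.
  by apply: differentiable_continuous; apply/derivable1_diffP; case: (f1 y).
rewrite in_itv/= => /andP[c0 _]; rewrite subr0 => E.
by rewrite -subr_le0 E mulr_le0_ge0// f0.
Qed.

Section ergodicity.
Variables (R : realType) (d : nat) (Q : 'M[R]_d) (p : 'I_d -> R).
Hypotheses (Qrate : is_rate_matrix Q) (Qirr : irreducible_rates Q)
  (pstat : is_stationary_distribution Q p).

Let p_ge0 i : 0 <= p i. Proof. by case: pstat. Qed.
Let p_sum : \sum_i p i = 1. Proof. by case: pstat. Qed.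
Let pQ j : \sum_i p i * Q i j = 0. Proof. by case: pstat. Qed.
Let Q_row i : \sum_j Q i j = 0. Proof. by case: Qrate. Qed.

(** A state of weight zero forces weight zero on the states that lead to it, hence on all
of them. *)
Lemma stationary_gt0 i : 0 < p i.
Proof.
have step k l : p l = 0 -> 0 < Q k l -> k != l -> p k = 0.
  move=> pl Qkl kl; have := pQ l; rewrite (bigD1 l)//= pl mul0r add0r => /eqP.
  rewrite psumr_eq0; last first.
    by move=> m ml; rewrite mulr_ge0//; case: Qrate => + _; exact.
  move=> /allP /(_ k (mem_index_enum _)); rewrite kl/= mulf_eq0 => /orP[/eqP//|].
  by rewrite gt_eqF.
have all0 : p i = 0 -> forall k, p k = 0.
  move=> pi0 k; have /connectP[s] := Qirr k i.
  elim: s k => [k _ /= <-//|l s IH k /= /andP[/andP[kl Qkl] pth] last_s].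
  exact: (step _ _ (IH _ pth last_s) Qkl kl).
rewrite lt_neqAle p_ge0 andbT eq_sym; apply/eqP => /all0 p0.
move: p_sum; rewrite big1 => [/eqP|k _]; last exact: p0.
by rewrite eq_sym oner_eq0.
Qed.

Definition dirichlet_form (u : 'I_d -> R) : R :=
  \sum_i \sum_j p i * Q i j * (u i - u j) ^+ 2.

Let dirichlet_term_ge0 (u : 'I_d -> R) i j : 0 <= p i * Q i j * (u i - u j) ^+ 2.
Proof.
have [->|ij] := eqVneq i j; first by rewrite subrr expr0n mulr0.
by rewrite mulr_ge0 ?sqr_ge0// mulr_ge0//; case: Qrate => + _; exact.
Qed.

Lemma dirichlet_form_ge0 u : 0 <= dirichlet_form u.
Proof. by do 2 apply: sumr_ge0 => ? _. Qed.

(** In the expansion of the square the diagonal terms vanish: rows of [Q] sum to zero and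
[p] is stationary. *)
Lemma dirichlet_formE u :
  \sum_i p i * u i * (\sum_j Q i j * u j) = - (dirichlet_form u / 2).
Proof.
have -> : dirichlet_form u = \sum_i p i * u i ^+ 2 * (\sum_j Q i j)
   - 2 * (\sum_i p i * u i * (\sum_j Q i j * u j))
   + \sum_j u j ^+ 2 * (\sum_i p i * Q i j).
  under [X in _ = _ + X]eq_bigr do rewrite mulr_sumr.
  rewrite [X in _ = _ + X]exchange_big/= mulr_sumr -sumrB -big_split/=.
  apply: eq_bigr => i _; rewrite !mulr_sumr -sumrB -big_split/=.
  by apply: eq_bigr => j _; ring.
have -> : \sum_i p i * u i ^+ 2 * (\sum_j Q i j) = 0.
  by rewrite big1// => i _; rewrite Q_row mulr0.
have -> : \sum_j u j ^+ 2 * (\sum_i p i * Q i j) = 0.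
  by rewrite big1// => i _; rewrite pQ mulr0.
lra.
Qed.

(** Along an edge the oscillation of [u] is one term of the Dirichlet form, and
irreducibility joins any two states by finitely many edges. *)
Lemma oscillation_le_dirichlet i j :
  {K : R | 0 <= K & forall u, (u i - u j) ^+ 2 <= K * dirichlet_form u}.
Proof.
apply: cid2; have /connectP[s] := Qirr i j.
elim: s i => [i _ /= ->|l s IH i /= /andP[/andP[il Qil] pth] last_s].
  by exists 0 => // u; rewrite subrr expr0n mul0r.
have [K K0 HK] := IH _ pth last_s.
have pQ_gt0 : 0 < p i * Q i l by rewrite mulr_gt0// stationary_gt0.
exists (2 * (p i * Q i l)^-1 + 2 * K) => [|u].
  by rewrite addr_ge0// mulr_ge0// invr_ge0 ltW.
have edge : (u i - u l) ^+ 2 <= (p i * Q i l)^-1 * dirichlet_form u.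
  rewrite ler_pdivlMl// /dirichlet_form (bigD1 i)//= (bigD1 l)//=.
  rewrite -addrA lerDl addr_ge0//; first by apply: sumr_ge0.
  by apply: sumr_ge0 => ? _; apply: sumr_ge0.
have := HK u; have := sqr_ge0 (u i - 2 * u l + u j).
move: (dirichlet_form u) edge => E; set X := (p i * Q i l)^-1; lra.
Qed.

(** The variance is half the mean of [(u i - u j) ^+ 2] over independent states [i] and
[j], and each such square is controlled by the Dirichlet form. *)
Lemma poincare_inequality : {c : R | 0 < c & forall u, \sum_i p i * u i = 0 ->
  c * (\sum_i p i * u i ^+ 2) <= dirichlet_form u}.
Proof.
pose K : R := 1 + \sum_i \sum_j s2val (oscillation_le_dirichlet i j).
have Kij i j : s2val (oscillation_le_dirichlet i j) <= K.
  have K0 k l : 0 <= s2val (oscillation_le_dirichlet k l) by case: oscillation_le_dirichlet.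
  rewrite /K (bigD1 i)//= (bigD1 j)//=.
  set a := s2val _; set b := \sum_(_ | _) _; set c := \sum_(_ | _) _.
  have : 0 <= b by apply: sumr_ge0.
  have : 0 <= c by apply: sumr_ge0 => ? _; apply: sumr_ge0.
  lra.
have K1 : 1 <= K.
  by rewrite /K lerDl; do 2 apply: sumr_ge0 => ? _; case: oscillation_le_dirichlet.
have K0 : 0 < K by rewrite (lt_le_trans _ K1).
exists (2 / K) => [|u u0]; first by rewrite divr_gt0.
rewrite mulrAC ler_pdivrMr//.
have -> : 2 * (\sum_i p i * u i ^+ 2) = \sum_i \sum_j p i * p j * (u i - u j) ^+ 2.
  transitivity (\sum_i p i * u i ^+ 2 * (\sum_j p j)
     - 2 * (\sum_i p i * u i * (\sum_j p j * u j))
     + \sum_j p j * u j ^+ 2 * (\sum_i p i)).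
    rewrite u0 p_sum -!mulr_suml; ring.
  under [X in _ + X = _]eq_bigr do rewrite mulr_sumr.
  rewrite [X in _ + X = _]exchange_big/= mulr_sumr -sumrB -big_split/=.
  apply: eq_bigr => i _; rewrite !mulr_sumr -sumrB -big_split/=.
  by apply: eq_bigr => j _; ring.
have -> : dirichlet_form u * K = \sum_i \sum_j p i * p j * (K * dirichlet_form u).
  under eq_bigr do (rewrite -mulr_suml -mulr_sumr p_sum mulr1).
  by rewrite -mulr_suml p_sum mul1r mulrC.
apply: ler_sum => i _; apply: ler_sum => j _.
apply: ler_wpM2l; first by rewrite mulr_ge0.
have := Kij i j; case: oscillation_le_dirichlet => L /= L0 HL LK.
by rewrite (le_trans (HL u))// ler_wpM2r// dirichlet_form_ge0.
Qed.

End ergodicity.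

(** * The deviation matrix *)

Section decaying_integrals.
Variable R : realType.
Local Notation leb := (@lebesgue_measure R).

Lemma Rintegral_sum (dT : measure_display) (T : measurableType dT)
    (m : {measure set T -> \bar R}) (D : set T) (I : Type) (s : seq I) (f : I -> T -> R) :
  measurable D -> (forall i, m.-integrable D (EFin \o f i)) ->
  \int[m]_(x in D) (\sum_(i <- s) f i x) = \sum_(i <- s) \int[m]_(x in D) f i x.
Proof.
move=> mD If; elim: s => [|i s IH].
  under eq_Rintegral do rewrite big_nil.
  by rewrite big_nil Rintegral_cst// mul0r.
under eq_Rintegral do rewrite big_cons.
rewrite big_cons RintegralD// ?IH//.
rewrite (_ : _ \o _ = (fun x => \sum_(j <- s) (EFin \o f j) x)%E); last first.
  by apply/funext => x /=; rewrite sumEFin.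
exact: integrable_sum.
Qed.

Lemma integrable_mulr (dT : measure_display) (T : measurableType dT)
    (m : {measure set T -> \bar R}) (D : set T) (r : R) (f : T -> R) :
  measurable D -> m.-integrable D (EFin \o f) ->
  m.-integrable D (EFin \o (fun x => r * f x)).
Proof.
move=> mD If; rewrite (_ : _ \o _ = (fun x => r%:E * (EFin \o f) x)%E)//.
exact: integrableZl.
Qed.

Lemma cvg_expR_decay (c : R) : 0 < c -> expR (- c * t) @[t --> +oo] --> (0 : R).
Proof.
move=> c0; under eq_cvg do rewrite mulNr.
apply: (@cvg_comp _ _ _ (fun t : R => c * t) (fun x => expR (- x)) _ +oo);
  last exact: cvgr_expR.
apply/cvgryPge => A; near=> t.
by rewrite mulrC -ler_pdivrMr//; near: t; apply: nbhs_pinfty_ge; exact: num_real.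
Unshelve. all: by end_near. Qed.

Lemma integrable_expR_decay (K c : R) : 0 < c ->
  leb.-integrable `[0, +oo[ (fun t : R => (K * expR (- c * t))%:E).
Proof.
move=> c0.
have H := @integrableS _ _ _ leb _ `[(0:R), +oo[ _ measurableT (measurable_itv _)
  (@subsetT _ _) (integrable_exponential_pdf c0).
have {}H : leb.-integrable `[0, +oo[ (fun t => (K / c)%:E * (EFin \o exponential_pdf c) t)%E.
  exact: integrableZl.
apply: eq_integrable H => // t.
rewrite inE/= in_itv/= andbT => t0.
rewrite /= exponential_pdfE// -EFinM; congr EFin.
by field; rewrite gt_eqF.
Qed.

(** Adding a dominating exponential makes the integrand nonnegative, which
reduces the improper integral of a derivative to the nonnegative case. *)
Lemma Rintegral_derive_decay (f F : R -> R) (C c l : R) : 0 < c ->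
  (forall t, 0 <= t -> `|f t| <= C * expR (- c * t)) -> continuous f ->
  (forall t, is_derive t (1 : R) F (f t)) -> F t @[t --> +oo] --> l ->
  leb.-integrable `[0, +oo[ (EFin \o f) /\ \int[leb]_(t in `[0, +oo[) f t = l - F 0.
Proof.
move=> c0 fC cf dF Fl.
have Ie := integrable_expR_decay C c0.
have If : leb.-integrable `[0, +oo[ (EFin \o f).
  apply: le_integrable Ie => //.
    by apply/measurable_EFinP; apply: measurable_funTS; exact: continuous_measurable_fun.
  move=> t /=; rewrite in_itv/= andbT => t0.
  by rewrite lee_fin (le_trans (fC t t0))// ler_norm.
split=> //.
have de (t : R) := is_derive_expRZ (- c) t.
have ce : continuous (fun t : R => expR (- c * t)).
  move=> t; apply: differentiable_continuous; apply/derivable1_diffP.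
  by case: (de t).
have el := cvg_expR_decay c0.
pose G (t : R) := F t - C / c * expR (- c * t).
have dG (t : R) : is_derive t (1 : R) G (f t + C * expR (- c * t)).
  have -> : f t + C * expR (- c * t) = f t - (C / c) *: (- c * expR (- c * t)).
    by rewrite /GRing.scale/=; field; rewrite gt_eqF.
  by apply: is_deriveB; exact: is_deriveZ.
have cG : continuous G.
  move=> t; apply: differentiable_continuous; apply/derivable1_diffP.
  by case: (dG t).
have : \int[leb]_(t in `[0, +oo[) (f t + C * expR (- c * t)) = l - G 0.
  apply: Rintegral_ge0_continuous_FTC2y.
  - by move=> t /fC; rewrite ler_norml => /andP[+ _]; lra.
  - apply: continuous_subspaceT => t; apply: cvgD; first exact: cf.
    by apply: cvgMr; exact: ce.
  - by rewrite -[l]subr0 -(mulr0 (C / c)); apply: cvgB => //; exact: cvgMr.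
  - by move=> t _; case: (dG t).
  - by apply: cvg_at_right_filter; exact: cG.
  - by move=> t _; rewrite derive1E; case: (dG t).
rewrite RintegralD//.
have -> : \int[leb]_(t in `[0, +oo[) (C * expR (- c * t)) = C / c.
  have -> : C / c = 0 - (- (C / c) * expR (- c * 0)).
    by rewrite mulr0 expR0; ring.
  have [C0|/ltW C0] := leP 0 C; last first.
    have E0 : C = 0.
      apply/le_anti; rewrite C0/=.
      by have := fC 0 (lexx _); rewrite mulr0 expR0 mulr1; apply: le_trans.
    by rewrite E0 !mul0r oppr0 mul0r subr0; under eq_Rintegral do rewrite mul0r;
      rewrite Rintegral_cst// mul0r.
  apply: (@Rintegral_ge0_continuous_FTC2y R _ (fun t => - (C / c) * expR (- c * t)) 0 0).
  - by move=> t _; rewrite mulr_ge0 ?expR_ge0.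
  - by apply: continuous_subspaceT => t; apply: cvgMr; exact: ce.
  - by rewrite -(mulr0 (- (C / c))); exact: cvgMr.
  - move=> t _; have := is_deriveZ (- (C/c)) (de t); by case.
  - by apply: cvg_at_right_filter; apply: cvgMr; exact: ce.
  - move=> t _; rewrite derive1E; have := is_deriveZ (- (C/c)) (de t); case=> _ ->.
    by rewrite /GRing.scale/=; field; rewrite gt_eqF.
rewrite /G mulr0 expR0; lra.
Qed.

End decaying_integrals.

Section deviation.
Local Notation mu := lebesgue_measure.
Variables (R : realType) (d : nat) (Q : 'M[R]_d) (p : 'I_d -> R).
Hypotheses (Qrate : is_rate_matrix Q) (Qirr : irreducible_rates Q)
  (pstat : is_stationary_distribution Q p).

Let pQ j : \sum_i p i * Q i j = 0. Proof. by case: pstat. Qed.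
Let p_sum : \sum_i p i = 1. Proof. by case: pstat. Qed.
Let Q_row i : \sum_j Q i j = 0. Proof. by case: Qrate. Qed.

Lemma stationary_transition t j : \sum_i p i * transition Q t i j = p j.
Proof.
have D (s : R) : is_derive s (1 : R) (fun s => \sum_i p i * transition Q s i j) 0.
  rewrite [X in is_derive _ _ _ X](_ : _ =
      \sum_i p i * (\sum_k Q i k * transition Q s k j)).
    apply: is_derive_sumr => i; apply: is_deriveZ; exact: derive_transition_backward.
  under eq_bigr do rewrite mulr_sumr; rewrite exchange_big/= big1// => k _.
  by under eq_bigr do rewrite mulrA; rewrite -mulr_suml pQ mul0r.
have -> : \sum_i p i * transition Q t i j = \sum_i p i * transition Q 0 i j.
  exact: (@is_derive_0_is_cst R (fun s => \sum_i p i * transition Q s i j) t 0 D).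
rewrite transition0 (bigD1 j)//= mxE eqxx mulr1 big1 ?addr0// => i ij.
by rewrite mxE (negbTE ij) mulr0.
Qed.

(** Exponential ergodicity by the energy method: the Poincare inequality makes
the stationary variance of [i |-> P_ij(t)] decay exponentially, and no weight
of the stationary distribution vanishes. *)
Lemma transition_ergodic : exists C c : R, [/\ 0 < C, 0 < c &
  forall i j t, 0 <= t -> `|transition Q t i j - p j| <= C * expR (- c * t)].
Proof.
have [k k0 Hk] := poincare_inequality Qrate Qirr pstat.
pose u j (t : R) i := transition Q t i j - p j.
pose v j (t : R) := \sum_i p i * u j t i ^+ 2.
have u_mean j t : \sum_i p i * u j t i = 0.
  by rewrite (eq_bigr _ (fun i _ => mulrBr _ _ _)) sumrB stationary_transition
    -mulr_suml p_sum mul1r subrr.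
have v0 j t : 0 <= v j t.
  by apply: sumr_ge0 => i _; rewrite mulr_ge0 ?sqr_ge0//; case: pstat.
have vle j t : 0 <= t -> v j t <= v j 0 * expR (- k * t).
  move=> t0.
  pose df (s : R) := (- dirichlet_form Q p (u j s) + k * v j s) * expR (k * s).
  have : v j t * expR (k * t) <= v j 0 * expR (k * 0).
    apply: (@le_at0_of_derive_le0 R (fun t => v j t * expR (k * t)) df) => // x.
      have Dv : is_derive x (1 : R) (v j) (- dirichlet_form Q p (u j x)).
        rewrite [X in is_derive _ _ _ X](_ : _ =
           \sum_i p i * (2 * u j x i * \sum_l Q i l * transition Q x l j)).
          apply: is_derive_sumr => i; apply: is_deriveZ.
          have := derive_transition_backward Q i j x => Dt.
          have Du : is_derive x (1 : R) (fun t => u j t i)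
              (\sum_l Q i l * transition Q x l j).
            rewrite -[X in is_derive _ _ _ X]subr0; exact: is_deriveB.
          rewrite (_ : (fun y => _) = (fun t => u j t i) * (fun t => u j t i)).
            apply: is_derive_eq; rewrite /GRing.scale/=; ring.
          by apply/funext => y; rewrite expr2.
        have := dirichlet_formE Qrate pstat (u j x) => E.
        transitivity (2 * (\sum_i p i * u j x i * (\sum_l Q i l * u j x l))); last first.
          rewrite mulr_sumr; apply: eq_bigr => i _.
          have -> : \sum_l Q i l * u j x l = \sum_l Q i l * transition Q x l j.
            rewrite /u; under eq_bigr do rewrite mulrBr.
            by rewrite sumrB -mulr_suml Q_row mul0r subr0.
          ring.
        by rewrite E; field.
      have De := is_derive_expRZ k x.
      rewrite /df; apply: is_derive_eq; rewrite /GRing.scale/=; ring.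
    move=> _; rewrite /df mulr_le0_ge0 ?expR_ge0//.
    by have := Hk _ (u_mean j x); rewrite -/(v j x); lra.
  rewrite mulr0 expR0 mulr1 mulNr expRN => H.
  by rewrite ler_pdivlMr ?expR_gt0.
pose C := 1 + \sum_i \sum_j v j 0 / p i.
have p0 i : 0 < p i := stationary_gt0 Qrate Qirr pstat i.
have S0 i j : 0 <= v j 0 / p i by rewrite divr_ge0// ltW.
have C1 : 1 <= C by rewrite lerDl; do 2 apply: sumr_ge0 => ? _.
exists C, (k / 2); split; [exact: lt_le_trans C1|exact: divr_gt0|move=> i j t t0].
have e0 : 0 <= C * expR (- (k / 2) * t) by rewrite mulr_ge0 ?expR_ge0// (le_trans _ C1).
rewrite -(@ler_pXn2r _ 2)// ?nnegrE// real_normK ?num_real// exprMn.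
have -> : expR (- (k / 2) * t) ^+ 2 = expR (- k * t).
  by rewrite expr2 -expRD; congr expR; field.
rewrite -/(u j t i).
have : p i * u j t i ^+ 2 <= v j 0 * expR (- k * t).
  apply: le_trans (vle j t t0); rewrite /v [leRHS](bigD1 i)//= lerDl.
  by apply: sumr_ge0 => l _; rewrite mulr_ge0 ?sqr_ge0// ltW.
rewrite -ler_pdivlMl// mulrA => /le_trans; apply.
rewrite ler_wpM2r ?expR_ge0// mulrC.
have : v j 0 / p i <= C.
  rewrite /C (bigD1 i)//= (bigD1 j)//=.
  set b := \sum_(_ | _) _; set b' := \sum_(_ | _) _.
  have : 0 <= b by apply: sumr_ge0.
  have : 0 <= b' by apply: sumr_ge0 => ? _; apply: sumr_ge0.
  by lra.
move: C1; nra.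
Qed.

Lemma integrable_transition_sub i j :
  mu.-integrable `[0, +oo[ (EFin \o (fun t : R => transition Q t i j - p j)).
Proof.
have [C [c [C0 c0 H]]] := transition_ergodic.
apply: le_integrable (integrable_expR_decay C c0) => //.
  apply/measurable_EFinP; apply: measurable_funTS; apply: continuous_measurable_fun.
  move=> t; apply: differentiable_continuous; apply/derivable1_diffP.
  by apply: derivableB => //; case: (derive_transition_backward Q i j t).
move=> t /=; rewrite in_itv/= andbT => t0.
by rewrite lee_fin (le_trans (H i j t t0))// ler_norm.
Qed.

Lemma transition_cvg i j : transition Q t i j @[t --> +oo] --> p j.
Proof.
have [C [c [C0 c0 H]]] := transition_ergodic.
have el : C * expR (- c * t) @[t --> +oo] --> (0 : R).
  rewrite -(mulr0 C); apply: cvgMr; exact: cvg_expR_decay.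
apply/cvgrPdist_le => e e0.
move/cvgrPdist_le : el => /(_ e e0) el.
near=> t; rewrite distrC (le_trans (H i j t _))//.
have : `|0 - C * expR (- c * t)| <= e by near: t.
by rewrite sub0r normrN; apply: le_trans; exact: ler_norm.
Unshelve. all: by end_near. Qed.

(** The deviation matrix solves the Poisson equation [Q D = Pi - I]: integrate the
backward equation [P' = Q P = Q (P - Pi)] over the half-line. *)
Lemma deviation_poisson i j :
  \sum_k Q i k * deviation_matrix Q p k j = p j - (i == j)%:R.
Proof.
have [C [c [C0 c0 H]]] := transition_ergodic.
have E t : \sum_k Q i k * (transition Q t k j - p j) = \sum_k Q i k * transition Q t k j.
  by under eq_bigr do rewrite mulrBr; rewrite sumrB -mulr_suml Q_row mul0r subr0.
have cP k l : continuous (fun t : R => transition Q t k l).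
  move=> t; apply: differentiable_continuous; apply/derivable1_diffP.
  by case: (derive_transition_backward Q k l t).
have [] := @Rintegral_derive_decay R (fun t => \sum_k Q i k * transition Q t k j)
  (fun t => transition Q t i j) (\sum_k `|Q i k| * C) c (p j) c0.
- move=> t t0; rewrite -E (le_trans (ler_norm_sum _ _ _))// mulr_suml.
  by apply: ler_sum => k _; rewrite normrM -mulrA ler_wpM2l// H.
- by move=> t; apply: cvg_sumr => k _; apply: cvgMr; exact: cP.
- by move=> t; exact: derive_transition_backward.
- exact: transition_cvg.
move=> _; rewrite transition0 mxE => <-.
under [RHS]eq_Rintegral do rewrite -E.
rewrite Rintegral_sum//=; last first.
  by move=> k; apply: integrable_mulr => //; exact: integrable_transition_sub.
apply: eq_bigr => k _; rewrite mxE RintegralZl//.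
exact: integrable_transition_sub.
Qed.

(** [p P(t) = p] for all [t], so the integrand has mean zero under [p]. *)
Lemma stationary_deviation j : \sum_i p i * deviation_matrix Q p i j = 0.
Proof.
transitivity (\int[mu]_(t in `[0%R, +oo[) (\sum_i p i * (transition Q t i j - p j))).
  rewrite Rintegral_sum//=; last first.
    by move=> k; apply: integrable_mulr => //; exact: integrable_transition_sub.
  apply: eq_bigr => k _; rewrite mxE RintegralZl//.
  exact: integrable_transition_sub.
under eq_Rintegral do (under eq_bigr do rewrite mulrBr;
  rewrite sumrB stationary_transition -mulr_suml p_sum mul1r subrr).
by rewrite Rintegral_cst// mul0r.
Qed.

End deviation.

(** * Counting the points of a stream *)

Lemma card_downclosed (A : set nat) : finite_set A ->
  (forall m n, (m <= n)%N -> A n -> A m) -> A = `I_(#|` fset_set A|).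
Proof.
move=> fA dA.
have [m nAm] : exists m, ~ A m.
  apply: contrapT => /forallNP H.
  have : A = setT by apply/seteqP; split => // n _; apply: contrapT; exact: H.
  by move=> AT; apply: infinite_nat; rewrite -AT.
have ex : exists m, `[< ~ A m >] by exists m; exact/asboolP.
case: (ex_minnP ex) => k /asboolP nAk kmin.
have Ak : A = `I_k.
  apply/seteqP; split => n /= H.
    by rewrite ltnNge; apply/negP => kn; exact: nAk (dA _ _ kn H).
  apply: contrapT => nAn; have := kmin n; rewrite leqNgt H => /(_ _)/negP.
  by apply=> //; exact/asboolP.
have -> : #|` fset_set A| = k by apply: card_fset_set; rewrite Ak.
exact: Ak.
Qed.

Section point_process.
Variables (R : realType) (Om : Type) (T : nat -> Om -> \bar R).
Hypotheses (T_gt0 : forall w n, (0 < T n w)%E) (T_le : forall w n, (T n w <= T n.+1 w)%E)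
  (T_fin : forall w (t : R), finite_set [set n | (T n w <= t%:E)%E]).

Definition points_upto (s : R) (w : Om) : nat := #|` fset_set [set n | (T n w <= s%:E)%E]|.

(** Epochs are nondecreasing, so the points up to time [s] are those with an index below
their number; counting becomes comparing. *)
Lemma ltn_points_upto s w n : (n < points_upto s w)%N = (T n w <= s%:E)%E.
Proof.
have mono m k : (m <= k)%N -> (T m w <= T k w)%E.
  elim: k => [|k IH]; first by rewrite leqn0 => /eqP ->.
  by rewrite leq_eqVlt => /predU1P[->//|]; rewrite ltnS => /IH /le_trans; apply.
have := @card_downclosed [set n | (T n w <= s%:E)%E] (T_fin w s) (fun m k mk => le_trans (mono m k mk)).
rewrite -/(points_upto s w) => E; apply/idP/idP => H.
  by have : `I_(points_upto s w) n by []; rewrite -E.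
by have : [set n | (T n w <= s%:E)%E] n by []; rewrite E.
Qed.

Lemma points_upto_le s s' w : s <= s' -> (points_upto s w <= points_upto s' w)%N.
Proof.
move=> ss'; rewrite leqNgt; apply/negP; rewrite ltn_points_upto => H.
have : (points_upto s' w < points_upto s' w)%N.
  by rewrite ltn_points_upto (le_trans H)// lee_fin.
by rewrite ltnn.
Qed.

Lemma points_upto0 w : points_upto 0 w = 0%N.
Proof.
apply/eqP; rewrite eqn0Ngt ltn_points_upto -ltNge; exact: T_gt0.
Qed.

Lemma arrivals_betweenE a b w : a <= b ->
  arrivals_between T a b w = (points_upto b w - points_upto a w)%N.
Proof.
move=> ab; rewrite /arrivals_between.
have -> : [set n | (a%:E < T n w)%E && (T n w <= b%:E)%E] =
    `I_(points_upto b w) `\` `I_(points_upto a w).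
  apply/seteqP; split => n /=; rewrite !ltn_points_upto.
    by move=> /andP[H ->]; split => //; rewrite leNgt H.
  by move=> [-> /negP]; rewrite -ltNge => ->.
have le_ab := points_upto_le w ab.
by apply: card_fset_set; exact: card_IID.
Qed.

End point_process.

(** * Thinning and independent marks *)

Section thinning.
Variable R : realType.

(** The binomial law with [c] trials of success probability [q], by recursion on the first
trial: the marks are revealed one at a time. *)
Fixpoint thin (q : R) (c : nat) (B : set nat) : R :=
  if c is c'.+1 then q * thin q c' [set y | B y.+1] + (1 - q) * thin q c' B
  else \1_B 0%N.

Lemma thin_ge0_le1 q c B : 0 <= q <= 1 -> 0 <= thin q c B <= 1.
Proof.
move=> /andP[q0 q1]; elim: c B => [|c IH] B /=.
  by rewrite indicE; case: (_ \in _); rewrite ?lexx ?ler01.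
have /andP[a0 a1] := IH B; have /andP[b0 b1] := IH [set y | B y.+1].
by apply/andP; split; nra.
Qed.

Lemma thin_setT q c : thin q c setT = 1.
Proof.
elim: c => [|c IH] /=; first by rewrite indicT.
by rewrite (_ : [set _ | _] = setT)// IH; ring.
Qed.

Definition thinned_poisson (a q : R) (B : set nat) : \bar R :=
  (\sum_(0 <= c <oo) (poisson_prob a 0%N [set c] * (thin q c B)%:E))%E.

Lemma poisson_prob_series (a : R) : (\sum_(0 <= c <oo) poisson_prob a 0%N [set c] = 1)%E.
Proof.
rewrite -(@probability_setT _ _ _ (poisson_prob a 0%N)).
have -> : [set: nat] = \bigcup_k [set k] by apply/seteqP; split=> // n _; exists n.
rewrite measure_bigcup//; last by move=> i j _ _ [x [-> ->]].
by apply: eq_eseriesl => i; rewrite in_setT.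
Qed.

Lemma thinned_poisson_setT a q : thinned_poisson a q setT = 1%E.
Proof.
rewrite /thinned_poisson; under eq_eseriesr do rewrite thin_setT mule1.
exact: poisson_prob_series.
Qed.

Lemma thinned_poisson_ge0 a q B : 0 <= q <= 1 -> (0 <= thinned_poisson a q B)%E.
Proof.
move=> q01; apply: nneseries_ge0 => c _ _; rewrite mule_ge0// lee_fin.
by have /andP[] := thin_ge0_le1 c B q01.
Qed.

Lemma thinned_poisson_fin_num a q B : 0 <= q <= 1 -> thinned_poisson a q B \is a fin_num.
Proof.
move=> q01; rewrite ge0_fin_numE ?thinned_poisson_ge0//.
apply: (@le_lt_trans _ _ 1%E); last exact: ltry.
rewrite -(poisson_prob_series a); apply: lee_nneseries => c _.
  rewrite mule_ge0// lee_fin; by have /andP[] := thin_ge0_le1 c B q01.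
by rewrite -[leRHS]mule1 lee_wpmul2l// lee_fin; have /andP[] := thin_ge0_le1 c B q01.
Qed.

End thinning.

Section marks.
Variables (R : realType) (dO : measure_display) (Om : measurableType dO)
  (P : probability Om R) (I : eqType) (S : I * nat -> Om -> R) (q : I -> R -> R).
Hypothesis mS : forall x, measurable_fun setT (S x).
Hypothesis PS : forall i m (tau : R), 0 <= tau ->
  P [set w | tau < S (i, m) w] = (q i tau)%:E.

Definition mark_event (s : seq (I * nat)) (C : I * nat -> set R) : set Om :=
  [set w | forall x, x \in s -> C x (S x w)].

(** [A] may depend on the marks indexed by [U] only: it is independent of every finite
family of other marks. Stated on rectangles of marks, this is what mutual
independence provides and what revealing one more mark preserves. *)
Definition indep_of_marks (A : set Om) (U : set (I * nat)) : Prop :=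
  measurable A /\ forall s C, uniq s -> (forall x, measurable (C x)) ->
    (forall x, x \in s -> ~ U x) ->
    P (A `&` mark_event s C) = (P A * \prod_(x <- s) P (S x @^-1` C x))%E.

Let mSC x (C : set R) : measurable C -> measurable (S x @^-1` C).
Proof. by move=> mC; rewrite -[X in measurable X]setTI; exact: mS. Qed.

Lemma mark_event_nil C : mark_event [::] C = setT.
Proof. by apply/seteqP; split. Qed.

Lemma mark_event_cons x s C : mark_event (x :: s) C = S x @^-1` C x `&` mark_event s C.
Proof.
apply/seteqP; split => w /=.
  by move=> H; split; [apply: H; rewrite mem_head|move=> y ys; apply: H; rewrite inE ys orbT].
by move=> [H1 H2] y; rewrite inE => /predU1P[->//|/H2].
Qed.

Lemma measurable_mark_event s C : (forall x, measurable (C x)) -> measurable (mark_event s C).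
Proof.
move=> mC; elim: s => [|x s IH]; first by rewrite mark_event_nil.
by rewrite mark_event_cons; apply: measurableI => //; exact: mSC.
Qed.

Lemma sub_indep_of_marks A U U' : U `<=` U' -> indep_of_marks A U -> indep_of_marks A U'.
Proof.
move=> UU' [mA H]; split=> // s C us mC sU; apply: H => // x /sU nU' /UU'; exact: nU'.
Qed.

Lemma indep_of_marks_step A U x C : indep_of_marks A U -> ~ U x -> measurable C ->
  indep_of_marks (A `&` S x @^-1` C) (U `|` [set x]) /\
  P (A `&` S x @^-1` C) = (P A * P (S x @^-1` C))%E.
Proof.
move=> [mA H] nUx mC.
have H1 : P (A `&` S x @^-1` C) = (P A * P (S x @^-1` C))%E.
  have := H [:: x] (fun=> C) isT (fun=> mC).
  rewrite mark_event_cons mark_event_nil setIT big_seq1; apply.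
  by move=> y; rewrite inE => /eqP ->.
split=> //; split; first by apply: measurableI => //; exact: mSC.
move=> s D us mD sU; rewrite H1 -muleA.
pose D' y := if y == x then C else D y.
have xs : x \notin s by apply/negP => /sU; apply; right.
have ED : mark_event s D = mark_event s D'.
  apply/seteqP; split => w /= Hw y ys; have := Hw y ys; rewrite /D';
    by case: eqVneq => // yx; rewrite -yx ys in xs.
have -> : (\prod_(y <- s) P (S y @^-1` D y) = \prod_(y <- s) P (S y @^-1` D' y))%E.
  apply: eq_big_seq => y ys; rewrite /D'; case: eqVneq => // yx.
  by rewrite -yx ys in xs.
have := H (x :: s) D'; rewrite mark_event_cons big_cons /D' eqxx -/D' => <-.
- by rewrite ED setIA.
- by rewrite /= xs us.
- by move=> y; case: ifP.
- by move=> y; rewrite inE => /predU1P[->//|/sU nU Uy]; apply: nU; left.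
Qed.

Lemma indep_of_marks_setU A A' U : indep_of_marks A U -> indep_of_marks A' U ->
  A `&` A' = set0 -> indep_of_marks (A `|` A') U.
Proof.
move=> [mA H] [mA' H'] AA'; split; first exact: measurableU.
move=> s C us mC sU; have mM := measurable_mark_event s mC.
have -> : P ((A `|` A') `&` mark_event s C) =
    (P (A `&` mark_event s C) + P (A' `&` mark_event s C))%E.
  rewrite setIUl measureU//; [exact: measurableI|exact: measurableI|].
  by rewrite setIACA AA' set0I.
by rewrite H// H'// measureU// ge0_muleDl.
Qed.

(** Peeling off one mark at a time: the marks with index in [[a, a + c)] are fresh,
so the number of them exceeding [tau] is a thinning of [c], and what is used up is
recorded in the second argument of [indep_of_marks]. *)
Lemma indep_of_marks_block c A U i a (tau : R) (B : set nat) : 0 <= tau -> indep_of_marks A U ->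
  (forall m, (a <= m < a + c)%N -> ~ U (i, m)) ->
  let E := A `&` [set w | B (\sum_(a <= m < a + c) (tau < S (i, m) w)%R)%N] in
  indep_of_marks E (U `|` [set x | x.1 = i /\ (a <= x.2 < a + c)%N]) /\
  P E = (P A * (thin (q i tau) c B)%:E)%E.
Proof.
move=> tau0; elim: c A U a B => [|c IH] A U a B HA nU /=.
  have -> : U `|` [set x | x.1 = i /\ (a <= x.2 < a + 0)%N] = U.
    apply/seteqP; split => x /=; last by left.
    by move=> [//|[_ /andP[h1]]]; rewrite addn0 ltnNge h1.
  have -> : A `&` [set w | B (\sum_(a <= m < a + 0) (tau < S (i, m) w)%R)%N] =
            A `&` [set w | B 0%N].
    by apply/seteqP; split => w /=; rewrite addn0 big_geq.
  rewrite indicE; have [|] := boolP (0%N \in B); rewrite ?inE ?notin_setE => B0.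
    by have -> : [set w : Om | B 0%N] = setT; [apply/seteqP; split|rewrite setIT mule1].
  have -> : [set w : Om | B 0%N] = set0 by apply/seteqP; split.
  rewrite setI0 mule0 measure0; split => //; split=> // s C _ _ _.
  by rewrite set0I measure0 mul0e.
pose Ca := `]tau, +oo[%classic : set R.
have mCa : measurable Ca by exact: measurable_itv.
have nUa : ~ U (i, a) by apply: nU; rewrite leqnn addnS ltnS leq_addr.
have SaE : S (i, a) @^-1` Ca = [set w | tau < S (i, a) w].
  by apply/seteqP; split => w; rewrite /Ca /= in_itv/= andbT.
have ScE : S (i, a) @^-1` (~` Ca) = ~` [set w | tau < S (i, a) w] by rewrite -SaE preimage_setC.
have PSc : P (S (i, a) @^-1` (~` Ca)) = (1 - q i tau)%:E.
  by rewrite ScE probability_setC ?PS// -SaE; exact: mSC.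
have [I1 P1] := indep_of_marks_step HA nUa mCa.
have [I2 P2] := indep_of_marks_step HA nUa (measurableC mCa).
have fresh m : (a.+1 <= m < a.+1 + c)%N -> ~ (U `|` [set (i, a)]) (i, m).
  move=> /andP[am mc] [|[am']]; last by rewrite am' ltnn in am.
  by apply: nU; rewrite (ltnW am) addnS -addSn.
have [I1' P1'] := IH _ _ a.+1 [set y | B y.+1] I1 fresh.
have [I2' P2'] := IH _ _ a.+1 B I2 fresh.
set E1 := _ `&` _ in I1' P1'; set E2 := _ `&` _ in I2' P2'.
have sumE w : (\sum_(a <= m < a + c.+1) (tau < S (i, m) w)%R)%N =
    ((tau < S (i, a) w)%R + \sum_(a.+1 <= m < a.+1 + c) (tau < S (i, m) w)%R)%N.
  by rewrite addnS -addSn big_ltn// addSn ltnS leq_addr.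
have -> : A `&` [set w | B (\sum_(a <= m < a + c.+1) (tau < S (i, m) w)%R)%N] = E1 `|` E2.
  rewrite /E1 /E2 SaE ScE; apply/seteqP; split => w /=; rewrite sumE.
    move=> [Aw]; case: (boolP (tau < S (i, a) w)) => h Bw; [left|right]; split => //;
      by split => //; apply/negP.
  by move=> [[[Aw h] Bw]|[[Aw /negP/negbTE h] Bw]]; split=> //; rewrite h.
have E12 : E1 `&` E2 = set0.
  by rewrite /E1 /E2 setIACA [X in X `&` _]setIACA SaE ScE setICr setI0 set0I.
have UE : U `|` [set (i, a)] `|` [set x | x.1 = i /\ (a.+1 <= x.2 < a.+1 + c)%N] =
   U `|` [set x | x.1 = i /\ (a <= x.2 < a + c.+1)%N].
  rewrite addnS -addSn -setUA; congr (_ `|` _); apply/seteqP; split => -[j m] /=.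
    move=> [[-> ->]|[-> /andP[am ->]]]; last by rewrite ltnW.
    by rewrite leqnn ltnS leq_addr.
  move=> [-> /andP[]]; rewrite leq_eqVlt => /predU1P[->|am mc]; first by left.
  by right; rewrite am.
rewrite -UE; split; first exact: indep_of_marks_setU.
have [mE1 _] := I1'; have [mE2 _] := I2'.
have q01 : 0 <= q i tau <= 1.
  by rewrite -!lee_fin -(PS i a tau0) measure_ge0/= -SaE probability_le1//; exact: mSC.
have := thin_ge0_le1 c B q01; have := thin_ge0_le1 c [set y | B y.+1] q01.
case/andP: q01 => q0 q1 /andP[t0 _] /andP[t0' _].
have -> : P (E1 `|` E2) = (P E1 + P E2)%E by exact: measureU.
rewrite P1' P2' P1 P2 PSc SaE PS// -!muleA -ge0_muleDr//.
by rewrite -EFinM lee_fin mulr_ge0.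
by rewrite -EFinM lee_fin mulr_ge0// subr_ge0.
Qed.

End marks.

Lemma exponential_prob_tail (R : realType) (r tau : R) : 0 < r -> 0 <= tau ->
  exponential_prob r `]tau, +oo[ = (expR (- (r * tau)))%:E.
Proof.
move=> r0 tau0; rewrite /exponential_prob.
rewrite integral_itv_obnd_cbnd; last first.
  by apply/measurable_EFinP; apply: measurable_funTS; exact: measurable_exponential_pdf.
transitivity (\int[lebesgue_measure]_(x in `[tau, +oo[) (r * expR (- r * x))%:E)%E.
  apply: eq_integral => /= x; rewrite inE/= in_itv/= andbT => tx.
  by rewrite exponential_pdfE// (le_trans tau0).
have de (t : R) : is_derive t (1 : R) (fun t => - expR (- r * t)) (r * expR (- r * t)).
  by have := is_deriveN (is_derive_expRZ (- r) t); rewrite mulNr opprK.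
have ce : continuous (fun t : R => expR (- r * t)).
  move=> t; apply: (@continuous_comp _ _ _ (fun t => - r * t) expR).
    exact: mulrl_continuous.
  exact: continuous_expR.
rewrite (@ge0_continuous_FTC2y R _ (fun t => - expR (- r * t)) tau 0).
- by rewrite sub0e -EFinN opprK mulNr.
- by move=> x _; rewrite mulr_ge0 ?expR_ge0// ltW.
- by apply: continuous_subspaceT => t; apply: cvgMr; exact: ce.
- by rewrite -oppr0; apply: cvgN; exact: cvg_expR_decay.
- by move=> t _; case: (de t).
- by apply: cvg_at_right_filter; apply: cvgN; exact: ce.
- by move=> t _; rewrite derive1E; case: (de t).
Qed.

Section marks_list.
Variables (R : realType) (dO : measure_display) (Om : measurableType dO)
  (P : probability Om R) (I : eqType) (S : I * nat -> Om -> R) (q : I -> R -> R).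
Hypothesis mS : forall x, measurable_fun setT (S x).
Hypothesis PS : forall i m (tau : R), 0 <= tau ->
  P [set w | tau < S (i, m) w] = (q i tau)%:E.

(** For [x = (i, l)] and prescribed counts [n], the points of stream [i] in cell [l] are
those numbered from the total count of the previous cells on. *)
Definition block_event (tau : I * nat -> R) (n : I * nat -> nat)
    (B : I * nat -> set nat) (x : I * nat) : set Om :=
  let a := (\sum_(m < x.2) n (x.1, m : nat))%N in
  [set w | B x (\sum_(a <= m < a + n x) (tau x < S (x.1, m) w)%R)%N].

(** Blocks of distinct cells of one stream do not overlap, so the marks used by the cells
already treated are fresh for the next one. *)
Lemma indep_of_marks_blocks (A : set Om) (tau : I * nat -> R) (n : I * nat -> nat)
    (B : I * nat -> set nat) (r : seq (I * nat)) :
  (forall x, x \in r -> 0 <= tau x) -> indep_of_marks P S A set0 -> uniq r ->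
  let E := A `&` [set w | forall x, x \in r -> block_event tau n B x w] in
  indep_of_marks P S E [set z | exists2 x, x \in r & x.1 = z.1 /\
     (\sum_(m < x.2) n (x.1, m : nat) <= z.2 < \sum_(m < x.2) n (x.1, m : nat) + n x)%N] /\
  P E = (P A * (\prod_(x <- r) thin (q x.1 (tau x)) (n x) (B x))%:E)%E.
Proof.
move=> tau0 HA; elim: r tau0 => [|x r IH] tau0 /=.
  move=> _; rewrite big_nil mule1.
  rewrite (_ : [set w | _] = setT) ?setIT; last by apply/seteqP; split.
  split=> //; exact: sub_indep_of_marks HA.
move=> /andP[xr ur].
have tau0r y : y \in r -> 0 <= tau y by move=> yr; apply: tau0; rewrite inE yr orbT.
have [IE PE] := IH tau0r ur.
set E := _ `&` _ in IE PE.
have cum (i : I) (l l' : nat) : (l < l')%N ->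
    (\sum_(m < l) n (i, m : nat) + n (i, l) <= \sum_(m < l') n (i, m : nat))%N.
  move=> ll'; have -> : (\sum_(m < l) n (i, m : nat) + n (i, l) =
      \sum_(m < l.+1) n (i, m : nat))%N by rewrite big_ord_recr.
  rewrite -(subnK ll') addnC big_split_ord/=.
  by rewrite leq_addr.
have [] := @indep_of_marks_block _ _ _ P _ S q mS PS (n x) E _ x.1
  (\sum_(m < x.2) n (x.1, m : nat))%N (tau x) (B x) (tau0 x (mem_head _ _)) IE.
  move=> m /andP[m1 m2] [y yr /= [yx /andP[m3 m4]]].
  case: x xr m1 m2 yx {tau0 IH} => i l xr /= m1 m2.
  case: y yr m3 m4 => j l' yr /= m3 m4 ji; rewrite {j}ji in yr m3 m4.
  have [ll'|l'l|ll'] := ltngtP l l'; last by rewrite -ll' (negbTE xr) in yr.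
    by have := cum i _ _ ll'; rewrite leqNgt (leq_ltn_trans m3 m2).
  by have := cum i _ _ l'l; rewrite leqNgt (leq_ltn_trans m1 m4).
move=> I1 P1.
have -> : A `&` [set w | forall y, y \in x :: r -> block_event tau n B y w] =
   E `&` [set w | B x (\sum_(\sum_(m < x.2) n (x.1, m : nat) <= m <
     \sum_(m < x.2) n (x.1, m : nat) + n x) (tau x < S (x.1, m) w)%R)%N].
  apply/seteqP; split => w /=.
    move=> [Aw H]; split; last by apply: H; rewrite mem_head.
    by split => // y yr; apply: H; rewrite inE yr orbT.
  by move=> [[Aw H] Hx]; split=> // y; rewrite inE => /predU1P[->//|/H].
split.
  apply: sub_indep_of_marks I1 => z [[y yr H]|[H1 H2]].
    by exists y => //; rewrite inE yr orbT.
  by exists x; rewrite ?mem_head.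
by rewrite P1 PE big_cons -muleA -EFinM mulrC.
Qed.

End marks_list.

(** * Joint law of the background process and of the surviving arrivals *)

Section inputs.
Variables (R : realType) (d : nat) (dO : measure_display) (Om : measurableType dO)
  (P : probability Om R) (Q : 'M[R]_d) (lam mu : 'I_d -> R)
  (J : R -> Om -> 'I_d) (T : 'I_d -> nat -> Om -> \bar R) (S : 'I_d -> nat -> Om -> R).
Hypothesis model : is_modelII P Q lam mu J T S.
Hypothesis mu_gt0 : forall i, 0 < mu i.

Local Notation Sm := (fun x : 'I_d * nat => S x.1 x.2).

Let mS (x : 'I_d * nat) : measurable_fun setT (Sm x).
Proof. by case: model => _ _ + _ _; exact. Qed.

Let T_gt0 i w n : (0 < T i n w)%E.
Proof. by case: model => _ /(_ i)[]. Qed.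
Let T_le i w n : (T i n w <= T i n.+1 w)%E.
Proof. by case: model => _ /(_ i)[]. Qed.
Let T_fin i w (t : R) : finite_set [set n | (T i n w <= t%:E)%E].
Proof. by case: model => _ /(_ i)[]. Qed.

Lemma measurable_input_sigma x A : input_sigma J T S x A -> measurable A.
Proof.
case: x => [[]|[i|[i n]]] /=.
- apply: smallest_sub; first exact: sigma_algebra_measurable.
  move=> _ [t [i [t0 ->]]]; case: model => -[mJ _ _] _ _ _ _; exact: mJ.
- apply: smallest_sub; first exact: sigma_algebra_measurable.
  move=> _ [n [B [mB ->]]]; rewrite -[X in measurable X]setTI.
  by case: model => _ /(_ i)[mT _ _ _ _] _ _ _; exact: mT.
- by move=> [B [mB ->]]; rewrite -[X in measurable X]setTI; exact: (mS (i, n)).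
Qed.

Let sigmaT i (A : set Om) := input_sigma J T S (inr (inl i)) A.

Let sigmaT_setI i A B : sigmaT i A -> sigmaT i B -> sigmaT i (A `&` B).
Proof.
exact: (@measurableI _ (g_sigma_algebraType
  [set A | exists n (B : set (\bar R)), measurable B /\ A = T i n @^-1` B])).
Qed.

Let sigmaT_bigcup i (F : nat -> set Om) : (forall k, sigmaT i (F k)) ->
  sigmaT i (\bigcup_k F k).
Proof.
move=> H; apply: (@bigcupT_measurable _ (g_sigma_algebraType
  [set A | exists n (B : set (\bar R)), measurable B /\ A = T i n @^-1` B])).
exact: H.
Qed.

Let sigmaT_setT i : sigmaT i setT.
Proof.
exact: (@measurableT _ (g_sigma_algebraType
  [set A | exists n (B : set (\bar R)), measurable B /\ A = T i n @^-1` B])).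
Qed.

Let sigmaT_pre i n (B : set (\bar R)) : measurable B -> sigmaT i (T i n @^-1` B).
Proof. by move=> mB; apply: sub_gen_smallest; exists n, B. Qed.

Lemma sigma_points_upto i (s : R) c : sigmaT i [set w | points_upto (T i) s w = c].
Proof.
rewrite (_ : [set w | _] = T i c @^-1` `]s%:E, +oo[%classic `&`
    (if c is c'.+1 then T i c' @^-1` `]-oo, s%:E]%classic else setT)).
  by apply: sigmaT_setI; [|case: c => [|c]//]; apply: sigmaT_pre => //; exact: emeasurable_itv.
apply/seteqP; split => w /=.
  move=> Hc; split; first by rewrite in_itv/= andbT ltNge -ltn_points_upto// Hc ltnn.
  by case: c Hc => // c Hc /=; rewrite in_itv/= -ltn_points_upto// Hc.
move=> []; rewrite in_itv/= andbT ltNge -ltn_points_upto// -leqNgt => cle H.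
apply/eqP; rewrite eqn_leq cle/=; case: c H {cle} => // c /=.
by rewrite in_itv/= -ltn_points_upto.
Qed.

Lemma sigma_arrivals_between i (a b : R) n : a <= b ->
  sigmaT i [set w | arrivals_between (T i) a b w = n].
Proof.
move=> ab; rewrite (_ : [set w | _] = \bigcup_c ([set w | points_upto (T i) a w = c] `&`
    [set w | points_upto (T i) b w = (c + n)%N])).
  by apply: sigmaT_bigcup => c; apply: sigmaT_setI; exact: sigma_points_upto.
apply/seteqP; split => w /=.
  rewrite arrivals_betweenE// => H; exists (points_upto (T i) a w) => //; split => //=.
  by rewrite -H subnKC// points_upto_le.
by move=> [c _ [/= Ha Hb]]; rewrite arrivals_betweenE// Hb Ha addKn.
Qed.

Lemma indep_background_arrivals_marks (E : set Om) (A : 'I_d -> set Om)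
    (s : seq ('I_d * nat)) (C : 'I_d * nat -> set R) :
  input_sigma J T S (inl tt) E -> (forall i, sigmaT i (A i)) -> uniq s ->
  (forall x, measurable (C x)) ->
  P (E `&` [set w | forall i, A i w] `&` mark_event Sm s C) =
  (P E * \prod_i P (A i) * \prod_(x <- s) P (Sm x @^-1` C x))%E.
Proof.
move=> sE sA us mC.
pose idx : seq (unit + ('I_d + 'I_d * nat)) :=
  inl tt :: [seq inr (inl i) | i <- enum 'I_d] ++ [seq inr (inr x) | x <- s].
pose B (z : unit + ('I_d + 'I_d * nat)) : set Om :=
  match z with inl _ => E | inr (inl i) => A i | inr (inr x) => Sm x @^-1` C x end.
have u_idx : uniq idx.
  rewrite /= cat_uniq !map_inj_uniq ?enum_uniq//=; last 2 first.
  - by move=> x y [].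
  - by move=> x y [].
  rewrite us andbT; apply/andP; split.
    by rewrite mem_cat; apply/negP => /orP[] /mapP[].
  rewrite -enumT enum_uniq; apply/hasPn => _ /mapP[x _ ->]; by apply/mapP => -[].
have [_ _ _ _ indep] := model.
have := indep [fset z in idx]%fset B.
have -> : (\prod_(i <- [fset z in idx]%fset) P (B i) = \prod_(i <- idx) P (B i))%E.
  by apply: perm_big; apply: uniq_perm => // z; rewrite in_fset.
have -> : (\prod_i P (A i) = \prod_(i <- enum 'I_d) P (A i))%E by rewrite big_enum.
rewrite /idx big_cons big_cat !big_map/= muleA => <-.
  congr (P _); apply/seteqP; split => w /=.
    move=> [[Ew Aw] Sw] z; rewrite in_fset inE mem_cat => /or3P[/eqP ->//|/mapP[i _ ->]|/mapP[x xs ->]] //=.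
    - exact: Sw.
  move=> H; split; first split.
  - by apply: (H (inl tt)); rewrite in_fset mem_head.
  - by move=> i; apply: (H (inr (inl i))); rewrite in_fset inE mem_cat map_f ?mem_enum// orbT.
  - by move=> x xs; apply: (H (inr (inr x))); rewrite in_fset inE mem_cat (map_f (fun x => inr (inr x))) ?orbT.
move=> [[]|[i|[i n]]] //= _; first exact: sA.
by exists (C (i, n)).
Qed.

End inputs.

Section marked_counts.
Variables (R : realType) (d : nat) (dO : measure_display) (Om : measurableType dO)
  (P : probability Om R) (Q : 'M[R]_d) (lam mu : 'I_d -> R)
  (J : R -> Om -> 'I_d) (T : 'I_d -> nat -> Om -> \bar R) (S : 'I_d -> nat -> Om -> R).
Hypothesis model : is_modelII P Q lam mu J T S.
Hypothesis mu_gt0 : forall i, 0 < mu i.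

Local Notation Sm := (fun x : 'I_d * nat => S x.1 x.2).

Let mS (x : 'I_d * nat) : measurable_fun setT (Sm x).
Proof. by case: model => _ _ + _ _; exact. Qed.

Let PS i m (tau : R) : 0 <= tau ->
  P [set w | tau < Sm (i, m) w] = (expR (- (mu i * tau)))%:E.
Proof.
move=> tau0; rewrite -exponential_prob_tail//.
have [_ _ _ PSe _] := model; rewrite -(PSe i m); last exact: measurable_itv.
by congr (P _); apply/seteqP; split => w /=; rewrite in_itv/= andbT.
Qed.

Let T_gt0 i w n : (0 < T i n w)%E.
Proof. by case: model => _ /(_ i)[]. Qed.
Let T_le i w n : (T i n w <= T i n.+1 w)%E.
Proof. by case: model => _ /(_ i)[]. Qed.
Let T_fin i w (t : R) : finite_set [set n | (T i n w <= t%:E)%E].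
Proof. by case: model => _ /(_ i)[]. Qed.

Let sigmaT i (A : set Om) := input_sigma J T S (inr (inl i)) A.

Variables (t : R) (s : nat -> R) (K : nat).
Hypotheses (s0 : s 0%N = 0) (s_le : forall k, s k <= s k.+1)
  (s_t : forall k, (k < K)%N -> s k <= t).

(** Points of stream [i] in the cell [`]s l, s l.+1]] whose service time exceeds the time
left until [t]. That time is measured from the beginning of the cell, so that all
points of a cell have the same threshold. *)
Definition marked_arrivals i (l : nat) (w : Om) : nat :=
  (\sum_(points_upto (T i) (s l) w <= m < points_upto (T i) (s l.+1) w)
     (t - s l < S i m w)%R)%N.

Let a (x : 'I_d * nat) : R := lam x.1 * (s x.2.+1 - s x.2).
Let q (x : 'I_d * nat) : R := expR (- (mu x.1 * (t - s x.2))).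
Let X : finType := ('I_d * 'I_K)%type.
Let pr (x : X) : 'I_d * nat := (x.1, x.2 : nat).
Let N (x : X) w := arrivals_between (T x.1) (s x.2) (s x.2.+1) w.
Let Y (x : X) w := marked_arrivals x.1 x.2 w.

Let points_cum i (n : nat -> nat) w l : (l <= K)%N ->
  (forall k, (k < K)%N -> arrivals_between (T i) (s k) (s k.+1) w = n k) ->
  points_upto (T i) (s l) w = (\sum_(m < l) n m)%N.
Proof.
move=> lK H; elim: l lK => [|l IH] lK; first by rewrite s0 points_upto0// big_ord0.
rewrite big_ord_recr/= -IH ?(ltnW lK)// -(H l lK) arrivals_betweenE//.
by rewrite subnKC// points_upto_le.
Qed.

(** Prescribing all the arrival counts turns the marks of each cell into a fixed block. *)
Let exact_counts (E : set Om) (n : 'I_d * nat -> nat) (B : 'I_d * nat -> set nat) :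
  input_sigma J T S (inl tt) E ->
  let G := E `&` [set w | forall x : X, N x w = n (pr x) /\ B (pr x) (Y x w)] in
  measurable G /\ P G = (P E * \prod_(x : X) (poisson_prob (a (pr x)) 0%N [set n (pr x)] *
       (thin (q (pr x)) (n (pr x)) (B (pr x)))%:E))%E.
Proof.
move=> sE.
pose A i := [set w | forall k, (k < K)%N -> arrivals_between (T i) (s k) (s k.+1) w = n (i, k)].
have sA i : sigmaT i (A i).
  rewrite (_ : A i = \bigcap_k (if (k < K)%N
      then [set w | arrivals_between (T i) (s k) (s k.+1) w = n (i, k)] else setT)).
    apply: (@bigcapT_measurable _ (g_sigma_algebraType
      [set A | exists n (B : set (\bar R)), measurable B /\ A = T i n @^-1` B])) => k.
    case: ifP => _; first exact: (sigma_arrivals_between model).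
    exact: measurableT.
  apply/seteqP; split => w H k /=.
    by case: ifPn => // kK _; exact: H.
  by move=> kK; have := H k I; rewrite /= kK.
have PA i : P (A i) = (\prod_(k < K) poisson_prob (a (i, k : nat)) 0%N [set n (i, k : nat)])%E.
  have [_ /(_ i)[_ _ _ _ H] _ _ _] := model.
  by rewrite /A (H K s (fun k => n (i, k)))// s0.
pose F := E `&` [set w | forall i, A i w].
have PF : P F = (P E * \prod_i P (A i))%E.
  have := @indep_background_arrivals_marks _ _ _ _ P Q lam mu J T S model E A [::]
    (fun=> set0) sE sA isT (fun=> measurable0).
  by rewrite mark_event_nil setIT big_nil mule1.
have IF : indep_of_marks P Sm F set0.
  split=> [|r C ur mC _].
    apply: measurableI; first exact: (measurable_input_sigma model sE).
    rewrite (_ : [set w | _] = \bigcap_(i in [set: 'I_d]) A i).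
      apply: fin_bigcap_measurable => [|i _]; first exact: finite_finset.
      exact: (measurable_input_sigma model (sA i)).
    by apply/seteqP; split => w H i //=; exact: H.
  by rewrite PF; exact: (indep_background_arrivals_marks model).
pose r := [seq pr x | x <- enum X].
have ur : uniq r.
  rewrite map_inj_uniq ?enum_uniq// => -[i l] [j m] [-> lm]; congr pair; exact: val_inj.
pose tau (x : 'I_d * nat) := t - s x.2.
have tau0 x : x \in r -> 0 <= tau x.
  by move=> /mapP[[i l] _ ->]; rewrite subr_ge0 s_t/=.
have [[mE _] PE] := @indep_of_marks_blocks _ _ _ P _ Sm
  (fun i tau => expR (- (mu i * tau))) mS PS F tau n B r tau0 IF ur.
have -> : E `&` [set w | forall x : X, N x w = n (pr x) /\ B (pr x) (Y x w)] =
   F `&` [set w | forall x, x \in r -> block_event Sm tau n B x w].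
  have blockE w : (forall i, A i w) -> forall x : X,
      block_event Sm tau n B (pr x) w = B (pr x) (Y x w).
    move=> Aw [i l]; rewrite /block_event /Y /marked_arrivals /=.
    rewrite (points_cum (ltnW (ltn_ord l)) (Aw i)).
    have lK := ltn_ord l.
    by rewrite (points_cum lK (Aw i)) big_ord_recr.
  apply/seteqP; split => w /=.
    move=> [Ew H]; have Aw i : A i w.
      by move=> k kK; have [+ _] := H (i, Ordinal kK).
    split=> // _ /mapP[x _ ->]; rewrite blockE//; by have [] := H x.
  move=> [[Ew Aw] H]; split=> // x; split.
    by case: x => i l; exact: Aw.
  by rewrite -(blockE _ Aw); apply: H; rewrite map_f// mem_enum.
split=> //; rewrite PE PF -muleA; congr (_ * _)%E.
rewrite (eq_bigr _ (fun i _ => PA i)) pair_bigA/= /r big_map big_enum/= -prodEFin -big_split/=.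
by apply: eq_bigr => -[i l] _.
Qed.

(** Summing out the unobserved arrival counts, one cell at a time, turns them
into thinned Poisson counts. *)
Lemma joint_law_marked_arrivals (E : set Om) (B : X -> set nat) :
  input_sigma J T S (inl tt) E ->
  let G := E `&` [set w | forall x : X, B x (Y x w)] in
  measurable G /\ P G = (P E * \prod_(x : X) thinned_poisson (a (pr x)) (q (pr x)) (B x))%E.
Proof.
move=> sE.
pose v (r : seq X) (n : X -> nat) x := if x \in r then thinned_poisson (a (pr x)) (q (pr x)) (B x)
  else (poisson_prob (a (pr x)) 0%N [set n x] * (thin (q (pr x)) (n x) (B x))%:E)%E.
have q01 (x : 'I_d * nat) : (x.2 < K)%N -> 0 <= q x <= 1.
  move=> xK; rewrite /q expR_ge0/= -expR0 ler_expR oppr_le0 mulr_ge0//.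
    exact: ltW.
  by rewrite subr_ge0 s_t.
have term0 (x : X) c : (0 <= poisson_prob (a (pr x)) 0%N [set c] * (thin (q (pr x)) c (B x))%:E)%E.
  rewrite mule_ge0// lee_fin; have := q01 (pr x) (ltn_ord _).
  by move=> /(thin_ge0_le1 c (B x)) /andP[].
have v0 r n x : (0 <= v r n x)%E.
  rewrite /v; case: ifP => // _; apply: nneseries_ge0 => c _ _; exact: term0.
have claim (r : seq X) : uniq r -> forall n : X -> nat,
  let G := E `&` [set w | forall x : X, B x (Y x w) /\ (x \notin r -> N x w = n x)] in
  measurable G /\ P G = (P E * \prod_(x : X) v r n x)%E.
  (* [r] lists the cells whose count has already been summed out. *)
  elim: r => [|x0 r IH] /=.
    move=> _ n.
    pose n' (x : 'I_d * nat) := if insub x.2 is Some l then n (x.1, l) else 0%N.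
    pose B' (x : 'I_d * nat) := if insub x.2 is Some l then B (x.1, l) else setT.
    have n'E x : n' (pr x) = n x by case: x => i l; rewrite /n' /= valK.
    have B'E x : B' (pr x) = B x by case: x => i l; rewrite /B' /= valK.
    have [] := exact_counts n' B' sE.
    have -> : E `&` [set w | forall x : X, N x w = n' (pr x) /\ B' (pr x) (Y x w)] =
       E `&` [set w | forall x : X, B x (Y x w) /\ (x \notin [::] -> N x w = n x)].
      apply/seteqP; split => w /= [Ew H]; split=> // x.
        by have := H x; rewrite n'E B'E => -[].
      by have [H1 H2] := H x; rewrite n'E B'E; split => //; exact: H2.
    move=> mG PG; split=> //; rewrite PG; congr (_ * _)%E.
    by apply: eq_bigr => x _; rewrite n'E B'E /v.
  move=> /andP[x0r ur] n.
  pose nk k (x : X) := if x == x0 then k else n x.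
  pose G k := E `&` [set w | forall x : X, B x (Y x w) /\ (x \notin r -> N x w = nk k x)].
  have HG k := IH ur (nk k).
  have -> : E `&` [set w | forall x : X, B x (Y x w) /\ (x \notin x0 :: r -> N x w = n x)] =
      \bigcup_k G k.
    apply/seteqP; split => w /=.
      move=> [Ew H]; exists (N x0 w) => //; split=> // x; split; first by have [] := H x.
      rewrite /nk; case: eqVneq => [->//|xx0 xr].
      by have [_] := H x; apply; rewrite inE negb_or xx0.
    move=> [k _ [Ew H]]; split=> // x; have [H1 H2] := H x; split=> //.
    rewrite inE negb_or => /andP[xx0 xr].
    by rewrite H2// /nk (negbTE xx0).
  have mG k : measurable (G k) by have [] := HG k.
  split; first exact: bigcupT_measurable.
  rewrite measure_bigcup//; last first.
    apply/trivIsetP => k k' _ _ kk'; apply/seteqP; split => w //= -[[_ H] [_ H']].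
    have [_ /(_ x0r)] := H x0; have [_ /(_ x0r)] := H' x0.
    by rewrite /nk eqxx => -> /eqP; rewrite eq_sym (negbTE kk').
  pose c0 := (P E * \prod_(x | x != x0) v (x0 :: r) n x)%E.
  have PG k : P (G k) = (c0 * (poisson_prob (a (pr x0)) 0%N [set k] *
       (thin (q (pr x0)) k (B x0))%:E))%E.
    have [_ ->] := HG k; rewrite (bigD1 x0)//= {1}/v (negbTE x0r) /nk eqxx.
    rewrite muleCA muleC; congr (_ * _ * _)%E.
    by apply: eq_bigr => x xx0; rewrite /v inE (negbTE xx0).
  rewrite (@eq_eseriesl _ _ xpredT); last by move=> k; rewrite in_setT.
  rewrite (eq_eseriesr (g := fun k => c0 * (poisson_prob (a (pr x0)) 0%N [set k] *
       (thin (q (pr x0)) k (B x0))%:E))%E); last by move=> k _; exact: PG.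
  have [c1 c1E] : exists c1 : R, c0 = c1%:E.
    exists (fine c0); rewrite fineK// fin_numM//.
      by apply: fin_num_measure; exact: (measurable_input_sigma model sE).
    apply: prode_fin_num => x _; rewrite /v; case: ifP => _.
      by apply/thinned_poisson_fin_num/q01/ltn_ord.
    by rewrite fin_numM// fin_num_measure.
  rewrite c1E nneseriesZl//.
  rewrite -c1E.
  rewrite [in RHS](bigD1 x0)//= /c0 -muleA [X in (_ * X)%E = _]muleC; congr (_ * (_ * _))%E.
  by rewrite /v mem_head.
have [] := claim (enum X) (enum_uniq _) (fun=> 0%N).
have -> : E `&` [set w | forall x : X, B x (Y x w) /\ (x \notin enum X -> N x w = 0%N)] =
    E `&` [set w | forall x : X, B x (Y x w)].
  apply/seteqP; split => w /= [Ew H]; split=> // x; first by have [] := H x.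
  by rewrite mem_enum.
move=> mG PG G; split=> //; rewrite /G PG; congr (_ * _)%E; apply: eq_bigr => x _.
by rewrite /v mem_enum.
Qed.

End marked_counts.

Section markov_chain.
Variables (R : realType) (d : nat) (dO : measure_display) (Om : measurableType dO)
  (P : probability Om R) (Q : 'M[R]_d) (lam mu : 'I_d -> R)
  (J : R -> Om -> 'I_d) (T : 'I_d -> nat -> Om -> \bar R) (S : 'I_d -> nat -> Om -> R).
Hypothesis model : is_modelII P Q lam mu J T S.
Hypothesis mu_gt0 : forall i, 0 < mu i.

Variables (t : R) (s : nat -> R) (K : nat).
Hypotheses (s0 : s 0%N = 0) (s_le : forall k, s k <= s k.+1)
  (s_t : forall k, (k < K)%N -> s k <= t).

Let Y i l w := marked_arrivals T S t s i l w.
Let pi i l B := thinned_poisson (lam i * (s l.+1 - s l)) (expR (- (mu i * (t - s l)))) B.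

Let pi_setT i l : pi i l setT = 1%E. Proof. exact: thinned_poisson_setT. Qed.

Let s_ge0 k : 0 <= s k.
Proof. by elim: k => [|k IH]; rewrite ?s0// (le_trans IH). Qed.

Let path_law (E : set Om) (jj : nat -> 'I_d) (B : nat -> set nat) :
  input_sigma J T S (inl tt) E ->
  let G := E `&` [set w | forall l, (l < K)%N -> B l (Y (jj l) l w)] in
  measurable G /\ P G = (P E * \prod_(l < K) pi (jj l) l (B l))%E.
Proof.
move=> sE.
pose B' (x : 'I_d * 'I_K) := if x.1 == jj x.2 then B x.2 else setT.
have [] := joint_law_marked_arrivals model mu_gt0 s0 s_le s_t B' sE.
have -> : E `&` [set w | forall x : 'I_d * 'I_K, B' x (marked_arrivals T S t s x.1 x.2 w)] =
  E `&` [set w | forall l, (l < K)%N -> B l (Y (jj l) l w)].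
  apply/seteqP; split => w /= [Ew H]; split=> //.
    by move=> l lK; have := H (jj l, Ordinal lK); rewrite /B'/= eqxx.
  move=> [i l]; rewrite /B'/=; case: eqVneq => // ->; exact: H.
move=> mG PG G; split=> //; rewrite /G PG; congr (_ * _)%E.
rewrite -(pair_bigA _ (fun i (l : 'I_K) => thinned_poisson (lam i * (s l.+1 - s l))
  (expR (- (mu i * (t - s l)))) (B' (i, l)))) exchange_big/=.
apply: eq_bigr => l _; rewrite (bigD1 (jj l))//= /B'/= eqxx big1 ?mule1// => i ij.
by rewrite (negbTE ij) thinned_poisson_setT.
Qed.

(** Law of the sum of the first [m] counts along the background path [jj], as an iterated
convolution. *)
Fixpoint path_sum_law (jj : nat -> 'I_d) (m x : nat) : \bar R :=
  if m is m'.+1 then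
    (\sum_(y < x.+1) path_sum_law jj m' (x - y)%N * pi (jj m') m' [set (y : nat)])%E
  else (x == 0%N)%:R%:E.

Let q01 i l : (l < K)%N -> 0 <= expR (- (mu i * (t - s l))) <= 1.
Proof.
move=> lK; rewrite expR_ge0/= -expR0 ler_expR oppr_le0 mulr_ge0//; first exact: ltW.
by rewrite subr_ge0 s_t.
Qed.

Lemma path_sum_law_ge0 jj m x : (m <= K)%N -> (0 <= path_sum_law jj m x)%E.
Proof.
elim: m x => [|m IH] x mK /=; first by rewrite lee_fin.
apply: sume_ge0 => y _.
by apply: mule_ge0; [apply: IH; exact: ltnW|apply/thinned_poisson_ge0/q01].
Qed.

(** The cells of distinct indices are independent and independent of the
background, so along a fixed background path the counts add up by convolution. *)
Lemma law_path_sum (E : set Om) (jj : nat -> 'I_d) m : (m <= K)%N ->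
  input_sigma J T S (inl tt) E -> forall x (B : nat -> set nat),
  let G := E `&` [set w | (\sum_(l < m) Y (jj l) l w)%N = x /\
      forall l, (m <= l < K)%N -> B l (Y (jj l) l w)] in
  measurable G /\
  P G = (P E * path_sum_law jj m x * \prod_(m <= l < K) pi (jj l) l (B l))%E.
Proof.
move=> + sE; elim: m => [|m IH] mK x B /=.
  have [->|x0] := eqVneq x 0%N.
    have [] := path_law jj B sE.
    have -> : E `&` [set w | (forall l, (l < K)%N -> B l (Y (jj l) l w))] =
        E `&` [set w | (\sum_(l < 0) Y (jj l) l w)%N = 0%N /\
          (forall l, (l < K)%N -> B l (Y (jj l) l w))].
      by apply/seteqP; split => w /= [Ew H]; [rewrite big_ord0|split => //; case: H].
    by move=> mG PG; split=> //; rewrite PG mule1 big_mkord.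
  rewrite (_ : [set w | _] = set0) ?setI0; last first.
    by apply/seteqP; split => w //= [+ _]; rewrite big_ord0 => x0'; rewrite -x0' eqxx in x0.
  by split; rewrite ?measure0 ?mule0 ?mul0e.
pose B' y l := if l == m then [set y] else B l.
pose G y := E `&` [set w | (\sum_(l < m) Y (jj l) l w)%N = (x - y)%N /\
      forall l, (m <= l < K)%N -> B' y l (Y (jj l) l w)].
have HG y := IH (ltnW mK) (x - y)%N (B' y).
have -> : E `&` [set w | (\sum_(l < m.+1) Y (jj l) l w)%N = x /\
    forall l, (m < l < K)%N -> B l (Y (jj l) l w)] = \big[setU/set0]_(y < x.+1) G y.
  rewrite -bigcup_mkord; apply/seteqP; split => w /=.
    rewrite big_ord_recr/= => -[Ew [Hx H]]; exists (Y (jj m) m w).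
      by rewrite /= ltnS -Hx leq_addl.
    split=> //; split; first by rewrite -Hx addnK.
    move=> l /andP[ml lK]; rewrite /B'; case: eqVneq => [->//|lm].
    by apply: H; rewrite ltn_neqAle eq_sym lm ml.
  move=> [y /= yx [Ew [Hx H]]]; split=> //.
  have := H m; rewrite leqnn mK /B' eqxx => /(_ isT) Yy; split.
    by rewrite big_ord_recr/= Hx Yy subnK// -ltnS.
  move=> l /andP[ml lK]; have := H l; rewrite /B' (ltnW ml) lK gtn_eqF//.
  exact.
have mG y : measurable (G y) by have [] := HG y.
split; first by apply: bigsetU_measurable => y _; exact: mG.
rewrite measure_bigsetU//; last first.
  apply/trivIsetP => y y' _ _ yy'; apply/seteqP; split => w //= -[[_ [_ H]] [_ [_ H']]].
  have Hy := H m; have Hy' := H' m; move: Hy Hy'.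
  rewrite leqnn mK /B' eqxx => /(_ isT) /= Hy /(_ isT) /= Hy'.
  by rewrite -Hy -Hy' eqxx in yy'.
have c0 : (P E * (\prod_(m.+1 <= l < K) pi (jj l) l (B l)) >= 0)%E.
  rewrite mule_ge0//; rewrite big_nat; elim/big_ind: _ => // [u v|l /andP[_ lK]].
    exact: mule_ge0.
  exact/thinned_poisson_ge0/q01.
rewrite muleAC ge0_sume_distrr; last first.
  move=> y _; apply: mule_ge0; last exact/thinned_poisson_ge0/q01.
  by apply: path_sum_law_ge0; exact: ltnW.
apply: eq_bigr => y _; have [_ PG] := HG (y : nat); apply: (eq_trans PG).
have -> : (\prod_(m <= l < K) pi (jj l) l (B' y l) = pi (jj m) m [set (y : nat)] *
    \prod_(m.+1 <= l < K) pi (jj l) l (B l))%E.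
  rewrite big_ltn// {1}/B' eqxx; congr (_ * _)%E.
  by apply: eq_big_nat => l /andP[ml _]; rewrite /B' gtn_eqF.
by rewrite -!muleA; congr (_ * _)%E; rewrite [RHS]muleC muleA.
Qed.

(** The state is read at the right end of each cell: in one step the background moves
first, and the jobs of the cell come from the stream of the new state. *)
Definition present_jobs (k : nat) (w : Om) : nat :=
  (\sum_(l < k) Y (J (s l.+1) w) l w)%N.

Let sJ u i : 0 <= u -> input_sigma J T S (inl tt) [set w | J u w = i].
Proof. by move=> u0; apply: sub_gen_smallest; exists u, i. Qed.

Let sJI A B : input_sigma J T S (inl tt) A -> input_sigma J T S (inl tt) B ->
  input_sigma J T S (inl tt) (A `&` B).
Proof.
exact: (@measurableI _ (g_sigma_algebraType
  [set A | exists t i, 0 <= t /\ A = [set w | J t w = i]])).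
Qed.

Let background_path (f : nat -> 'I_d) k := [set w | forall l, (l <= k)%N -> J (s l) w = f l].

Let sigma_background_path f k : input_sigma J T S (inl tt) (background_path f k).
Proof.
elim: k => [|k IH].
  rewrite (_ : background_path f 0 = [set w | J (s 0%N) w = f 0%N]); first exact: sJ.
  by apply/seteqP; split => w /= H; [exact: H|move=> l; rewrite leqn0 => /eqP ->].
rewrite (_ : background_path f k.+1 = background_path f k `&` [set w | J (s k.+1) w = f k.+1]).
  by apply: sJI => //; exact: sJ.
apply/seteqP; split => w /=.
  by move=> H; split; [move=> l lk; apply: H; rewrite leqW|exact: H].
by move=> [H1 H2] l; rewrite leq_eqVlt => /predU1P[->//|]; rewrite ltnS; exact: H1.
Qed.

Let P_background_path f k : P (background_path f k.+1) =
  (P (background_path f k) * (transition Q (s k.+1 - s k) (f k) (f k.+1))%:E)%E.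
Proof.
have [[_ _ fdd] _ _ _ _] := model.
by rewrite /background_path !fdd// big_ord_recr/= EFinM muleA.
Qed.

(** Conditionally on the past, the background makes one Markov step and the next
cell of the new state receives a thinned Poisson number of jobs: decompose over
the finitely many background paths, on each of which [present_jobs] is a sum
along that path. *)
Lemma one_step_law k j x j' (B : set nat) : (k < K)%N ->
  let A := [set w | J (s k) w = j /\ present_jobs k w = x] in
  let A' := A `&` [set w | J (s k.+1) w = j' /\ B (Y j' k w)] in
  [/\ measurable A, measurable A' &
  P A' = (P A * ((transition Q (s k.+1 - s k) j j')%:E * pi j' k B))%E].
Proof.
move=> kK /=.
pose F : finType := {ffun 'I_k.+1 -> 'I_d}.
pose ff (f : F) l := f (inord l).
pose jj (f : F) l := if (l < k)%N then ff f l.+1 else j'.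
pose D := [set f : F | ff f k = j].
pose A f := background_path (ff f) k `&` [set w | (\sum_(l < k) Y (jj f l) l w)%N = x].
pose A' f := background_path (ff f) k `&` [set w | J (s k.+1) w = j'] `&`
   [set w | (\sum_(l < k) Y (jj f l) l w)%N = x /\ B (Y j' k w)].
have sumE f w : background_path (ff f) k w ->
    present_jobs k w = (\sum_(l < k) Y (jj f l) l w)%N.
  by move=> H; apply: eq_bigr => l _; rewrite /jj ltn_ord -(H l.+1).
have pathE w : exists f : F, background_path (ff f) k w.
  exists [ffun l : 'I_k.+1 => J (s l) w] => l lk.
  by rewrite /ff ffunE inordK.
have -> : [set w | J (s k) w = j /\ present_jobs k w = x] = \bigcup_(f in D) A f.
  apply/seteqP; split => w /=.
    move=> [Jj Xx]; have [f Hf] := pathE w; exists f.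
      by rewrite /D/= -(Hf k).
    by split=> //=; rewrite -(sumE f).
  by move=> [f fj [Hf /= <-]]; rewrite (sumE f)// -fj; split=> //; exact: Hf.
have -> : \bigcup_(f in D) A f `&` [set w | J (s k.+1) w = j' /\ B (Y j' k w)] =
    \bigcup_(f in D) A' f.
  rewrite setI_bigcupl; apply: eq_bigcupr => f _; apply/seteqP.
  by split=> w /= [[H1 H2] [H3 H4]].
have HA f : measurable (A f) /\ P (A f) = (P (background_path (ff f) k) * path_sum_law (jj f) k x)%E.
  have [] := @law_path_sum _ (jj f) k (ltnW kK) (sigma_background_path (ff f) k) x (fun=> setT).
  rewrite big1 ?mule1; last by move=> l _; exact: pi_setT.
  by rewrite /A (_ : [set w | _ /\ _] = [set w | (\sum_(l < k) Y (jj f l) l w)%N = x]);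
    last by apply/seteqP; split => w //= [].
have HA' f : D f -> measurable (A' f) /\
    P (A' f) = (P (A f) * ((transition Q (s k.+1 - s k) j j')%:E * pi j' k B))%E.
  move=> fj; pose g l := if (l <= k)%N then ff f l else j'.
  have gE : background_path (ff f) k `&` [set w | J (s k.+1) w = j'] = background_path g k.+1.
    apply/seteqP; split=> w /=.
      move=> [H1 H2] l; rewrite leq_eqVlt => /predU1P[->|].
        by rewrite /g ltnn.
      by rewrite ltnS => lk; rewrite /g lk; exact: H1.
    move=> H; split; last by rewrite H// /g ltnn.
    by move=> l lk; rewrite H ?leqW// /g lk.
  have PE : P (background_path g k.+1) =
      (P (background_path (ff f) k) * (transition Q (s k.+1 - s k) j j')%:E)%E.
    rewrite P_background_path /g leqnn ltnn [ff f k]fj; congr (P _ * _)%E.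
    by apply/seteqP; split=> w H l lk; rewrite H// lk.
  pose BB l := if l == k then B else setT.
  have [] := @law_path_sum _ (jj f) k (ltnW kK) (sigma_background_path g k.+1) x BB.
  have -> : (\prod_(k <= l < K) pi (jj f l) l (BB l) = pi j' k B)%E.
    rewrite big_ltn// {1}/BB eqxx {1}/jj ltnn big_nat big1 ?mule1// => l /andP[kl _].
    by rewrite /BB gtn_eqF.
  have -> : background_path g k.+1 `&` [set w | (\sum_(l < k) Y (jj f l) l w)%N = x /\
      (forall l, (k <= l < K)%N -> BB l (Y (jj f l) l w))] = A' f.
    rewrite -gE; apply/seteqP; split=> w /= [H1 [H2 H3]]; split=> //; split=> //.
      by have := H3 k; rewrite leqnn kK /BB eqxx /jj ltnn => /(_ isT).
    by move=> l _; rewrite /BB; case: eqVneq => // ->; rewrite /jj ltnn.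
  move=> mA' ->; split=> //; have [_ ->] := HA f.
  by rewrite PE -!muleA; congr (_ * _)%E; rewrite muleCA.
have fD : finite_set D by exact: finite_finset.
have disj f f' w : background_path (ff f) k w -> background_path (ff f') k w -> f = f'.
  move=> H H'; apply/ffunP => l; rewrite -(inord_val l) -/(ff f l) -/(ff f' l).
  by rewrite -H -?H'// -ltnS.
have mA : measurable (\bigcup_(f in D) A f).
  by apply: fin_bigcup_measurable => // f _; have [] := HA f.
have mA' : measurable (\bigcup_(f in D) A' f).
  by apply: fin_bigcup_measurable => // f /HA'[].
split=> //; rewrite !measure_fin_bigcup//; last 4 first.
- by move=> f f' _ _ [w [[H1 _] [H2 _]]]; exact: disj H1 H2.
- by move=> f _; have [] := HA f.
- by move=> f f' _ _ [w [[[H1 _] _] [[H2 _] _]]]; exact: disj H1 H2.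
- by move=> f /HA'[].
rewrite ge0_mule_fsuml//; apply: eq_fsbigr => f; rewrite inE => fD'.
exact: (proj2 (HA' _ fD')).
Qed.

End markov_chain.

(** * First-order expansions and bounded expectations *)

Section thinned_poisson_expansion.
Variable R : realType.

Let poisson0 (a : R) : 0 <= a -> poisson_prob a 0%N [set 0%N] = (expR (- a))%:E.
Proof.
rewrite /poisson_prob le_eqVlt => /predU1P[<-|a0].
  by rewrite ltxx oppr0 expR0 /dirac indicE mem_set.
rewrite a0 esum_set1 ?lee_fin ?poisson_pmf_ge0//.
by rewrite /poisson_pmf a0 expr0 fact0 invr1 !mul1r.
Qed.

Let poisson1 (a : R) : 0 <= a -> poisson_prob a 0%N [set 1%N] = (a * expR (- a))%:E.
Proof.
rewrite /poisson_prob le_eqVlt => /predU1P[<-|a0].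
  by rewrite ltxx mul0r /dirac indicE memNset.
rewrite a0 esum_set1 ?lee_fin ?poisson_pmf_ge0//.
by rewrite /poisson_pmf a0 expr1 invr1 mulr1.
Qed.

(** Only the first two Poisson weights matter to first order in [a], and two or
more points have weight [O(a ^+ 2)]. *)
Lemma thinned_poisson_expansion (a q : R) (B : set nat) : 0 <= a -> 0 <= q <= 1 ->
  `|fine (thinned_poisson a q B) - (\1_B 0%N * (1 - a * q) + \1_B 1%N * (a * q))|
    <= 3 * a ^+ 2.
Proof.
move=> a0 q01.
pose f c := (poisson_prob a 0%N [set c] * (thin q c B)%:E)%E.
have f0 c : (0 <= f c)%E.
  by rewrite mule_ge0// lee_fin; have /andP[] := thin_ge0_le1 c B q01.
have g0 c : (0 <= poisson_prob a 0%N [set c])%E by [].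
have E1 := poisson_prob_series a.
rewrite (nneseries_split 0 2)//= in E1.
have E2 : thinned_poisson a q B = (\sum_(0 <= c < 2) f c + \sum_(2 <= c <oo) f c)%E.
  rewrite /thinned_poisson (nneseries_split 0 2)//= => c _; exact: f0.
have tail : (\sum_(2 <= c <oo) f c <= \sum_(2 <= c <oo) poisson_prob a 0%N [set c])%E.
  apply: lee_nneseries => c _; first by move=> _; exact: f0.
  rewrite -[leRHS]mule1 lee_wpmul2l// lee_fin; by have /andP[] := thin_ge0_le1 c B q01.
have tail0 : (0 <= \sum_(2 <= c <oo) f c)%E by apply: nneseries_ge0.
have ptail0 : (0 <= \sum_(2 <= c <oo) poisson_prob a 0%N [set c])%E by apply: nneseries_ge0.
move: E1 E2 tail tail0 ptail0.
rewrite !big_nat_recr//= !big_geq//= !add0e /f poisson0// poisson1//=.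
set p2 := (\sum_(2 <= c <oo) _)%E; set f2 := (\sum_(2 <= c <oo) _)%E.
case: p2 => [p2| |] //; case: f2 => [f2| |]//.
rewrite -!EFinM -!EFinD => -[E1] -> /=; rewrite !lee_fin => f2p2 f20 p20.
have e1 : 1 - a <= expR (- a) by exact: expR_ge1Dx.
have e2 : expR (- a) <= 1 by rewrite -expR0 ler_expR oppr_le0.
case/andP: q01 => q0 q1.
have b01 : 0 <= (\1_B 0%N : R) <= 1 by rewrite indicE; case: (_ \in _); rewrite ?lexx ?ler01.
have b11 : 0 <= (\1_B 1%N : R) <= 1 by rewrite indicE; case: (_ \in _); rewrite ?lexx ?ler01.
have -> : [set y | B y.+1] = (fun y => B y.+1) by [].
have -> : \1_(fun y => B y.+1) 0%N = \1_B 1%N :> R.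
  by rewrite !indicE; congr (_%:R); congr nat_of_bool; apply/idP/idP; rewrite !inE.
move: (expR (- a)) (\1_B 0%N) (\1_B 1%N) e1 e2 b01 b11 E1 => e b0 b1.
move=> e1 e2 /andP[b00 b01] /andP[b10 b11] E1.
(* [p2 = 1 - (1 + a) exp (- a)] and [exp (- a) >= 1 - a]. *)
have X1 : p2 <= a ^+ 2.
  have : 0 <= (1 + a) * (e - (1 - a)) by rewrite mulr_ge0 ?subr_ge0 ?addr_ge0.
  by rewrite expr2; lra.
have Y : 0 <= a * (1 - e) * q <= a ^+ 2.
  have Y0 : 0 <= a * (1 - e) by rewrite mulr_ge0// subr_ge0.
  have Y1 : a * (1 - e) <= a ^+ 2 by rewrite expr2 ler_wpM2l//; lra.
  rewrite mulr_ge0//= (le_trans _ Y1)// -[leRHS]mulr1 ler_wpM2l//.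
have -> : e * b0 + a * e * (q * b1 + (1 - q) * b0) + f2 - (b0 * (1 - a * q) + b1 * (a * q))
   = - (b0 * p2) + a * (1 - e) * q * (b0 - b1) + f2.
  have -> : p2 = 1 - e - a * e by lra.
  ring.
case/andP: Y; set y := a * (1 - e) * q => y0 y1.
have Z1 : 0 <= b0 * p2 <= a ^+ 2.
  by rewrite mulr_ge0//= (le_trans _ X1)// ler_piMl.
have Z2 : `|y * (b0 - b1)| <= a ^+ 2.
  rewrite normrM (ger0_norm y0) (le_trans _ y1)// ler_piMr// ler_norml; lra.
case/andP: Z1 => Z10 Z11; move: Z2; rewrite !ler_norml => /andP[Z20 Z21].
by apply/andP; split; lra.
Qed.

End thinned_poisson_expansion.

Lemma bounded_cvg_Rintegral (R : realType) (dT : measure_display) (T : measurableType dT)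
    (m : {measure set T -> \bar R}) (D : set T) (f_ : nat -> T -> R) (f : T -> R) (M : R) :
  measurable D -> (m D < +oo)%E -> (forall n, measurable_fun D (f_ n)) ->
  (forall n x, D x -> `|f_ n x| <= M) -> (forall x, D x -> f_ ^~ x @ \oo --> f x) ->
  \int[m]_(x in D) f_ n x @[n --> \oo] --> \int[m]_(x in D) f x.
Proof.
move=> mD Dfin mf fM f_f.
have mf' : measurable_fun D f by exact: measurable_fun_cvg f_f.
have [|||||If _ cvg] := @dominated_convergence _ _ _ m D mD (fun n => EFin \o f_ n)
  (EFin \o f) (cst M%:E).
- by move=> n; apply/measurable_EFinP.
- exact/measurable_EFinP.
- apply: aeW => x Dx; apply: cvg_EFin; first by near=> n.
  by rewrite (_ : _ \o _ = f_ ^~ x)//; exact: f_f.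
- apply/integrableP; split; first exact: measurable_cst.
  by rewrite integral_cst//= lte_mul_pinfty// lee_fin.
- by apply: aeW => x n Dx /=; rewrite lee_fin fM.
by apply: fine_cvg; rewrite /Rintegral fineK//; exact: integrable_fin_num If.
Unshelve. all: by end_near. Qed.

Section bounded_expectation.
Variables (R : realType) (dO : measure_display) (Om : measurableType dO) (P : probability Om R).

Lemma integrable_bounded (f : Om -> R) (M : R) : measurable_fun setT f ->
  (forall w, `|f w| <= M) -> P.-integrable setT (EFin \o f).
Proof.
move=> mf fM; apply: measurable_bounded_integrable => //.
  by rewrite (le_lt_trans (probability_le1 _ _))// ltry.
exists M; split; first exact: num_real.
by move=> x Mx w _ /=; rewrite (le_trans (fM w))// ltW.
Qed.

Lemma norm_expectation_le (f : Om -> R) (M : R) : measurable_fun setT f ->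
  (forall w, `|f w| <= M) -> `|\int[P]_w f w| <= M.
Proof.
move=> mf fM; have If := integrable_bounded mf fM.
rewrite (le_trans (le_normr_Rintegral _ _))//.
apply: (@le_trans _ _ (\int[P]_w M)).
  apply: le_Rintegral => //.
    by apply: (@integrable_bounded _ M); [exact: measurableT_comp|move=> w; rewrite normr_id].
  by apply: (@integrable_bounded _ `|M|).
by rewrite Rintegral_cst// [X in fine X]probability_setT mulr1.
Qed.

End bounded_expectation.

(** One step of length [h] of the Markov chain [(J, X)], to first order: [p] is the
row of transition probabilities out of [j], [pi0] and [pi1] the probabilities of
zero and one new job, [F0], [F0s] (resp. [F1], [F1s]) the values of the test
function before and after one more job at the beginning (resp. at the end) of
the step. *)
Lemma one_step_expansion (R : realType) (d : nat) (j : 'I_d)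
    (p q pi0 pi1 g F0 F0s F1 F1s dF dFs : 'I_d -> R) (h eps C M : R) :
  0 <= h <= 1 -> 0 <= eps -> 0 <= C -> 0 <= M ->
  (forall k, `|p k - (j == k)%:R - h * q k| <= eps * h) ->
  (forall k, `|pi0 k - (1 - h * g k)| <= C * h ^+ 2) ->
  (forall k, `|pi1 k - h * g k| <= C * h ^+ 2) ->
  (forall k, `|g k| <= C) ->
  (forall k, `|F0 k| <= M) -> (forall k, `|F0s k| <= M) ->
  (forall k, `|F1 k| <= M) -> (forall k, `|F1s k| <= M) ->
  (forall k, `|dF k| <= M) -> (forall k, `|dFs k| <= M) ->
  (forall k, `|F1 k - F0 k - h * dF k| <= M * h ^+ 2) ->
  (forall k, `|F1s k - F0s k - h * dFs k| <= M * h ^+ 2) ->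
  forall K1 K2, K1 = M + 6 * C * M -> K2 = M + 2 * C * M + K1 ->
  `|\sum_k p k * (pi0 k * F1 k + pi1 k * F1s k) - F0 j
     - h * (dF j + \sum_k q k * F0 k + g j * (F0s j - F0 j))|
  <= (K1 + (\sum_k `|q k|) * K2 + d%:R * (M + K2)) * (h * (h + eps)).
Proof.
move=> /andP[h0 h1] eps0 C0 M0 Hp H0 H1 Hg bF0 bF0s bF1 bF1s bdF bdFs HF HFs K1 K2 K1E K2E.
have CM0 : 0 <= C * M by rewrite mulr_ge0.
have hh0 : 0 <= h ^+ 2 by rewrite sqr_ge0.
have K10 : 0 <= K1 by rewrite K1E; lra.
have K20 : 0 <= K2 by rewrite K2E; lra.
pose U k := pi0 k * F1 k + pi1 k * F1s k.
pose V k := dF k + g k * (F0s k - F0 k).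
have bM (a b A B : R) : `|a| <= A -> `|b| <= B -> `|a * b| <= A * B.
  by move=> ? ?; rewrite normrM ler_pM.
have rU k : `|U k - F0 k - h * V k| <= K1 * h ^+ 2.
  set e2 := pi0 k - (1 - h * g k) in H0 *; set e4 := F1 k - F0 k - h * dF k.
  have -> : U k - F0 k - h * V k =
     (F1 k - F0 k - h * dF k) - h ^+ 2 * (g k * dF k) - h * (g k * (F1 k - F0 k - h * dF k))
     + (pi0 k - (1 - h * g k)) * F1 k + h ^+ 2 * (g k * dFs k)
     + h * (g k * (F1s k - F0s k - h * dFs k)) + (pi1 k - h * g k) * F1s k.
    by rewrite /U /V; ring.
  have b1 : `|h ^+ 2 * (g k * dF k)| <= C * M * h ^+ 2.
    by rewrite normrM ger0_norm// mulrC ler_wpM2r// bM.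
  have b2 : `|h ^+ 2 * (g k * dFs k)| <= C * M * h ^+ 2.
    by rewrite normrM ger0_norm// mulrC ler_wpM2r// bM.
  have b3 x : `|x| <= M * h ^+ 2 -> `|h * (g k * x)| <= C * M * h ^+ 2.
    move=> Hx; have := bM _ _ _ _ (Hg k) Hx; rewrite (normrM h) (ger0_norm h0) => H.
    apply: (@le_trans _ _ (1 * `|g k * x|)); first by rewrite ler_wpM2r.
    by rewrite mul1r -mulrA.
  have b4 : `|(pi0 k - (1 - h * g k)) * F1 k| <= C * M * h ^+ 2.
    by rewrite mulrAC bM.
  have b5 : `|(pi1 k - h * g k) * F1s k| <= C * M * h ^+ 2.
    by rewrite mulrAC bM.
  have -> : K1 * h ^+ 2 = M * h ^+ 2 + C * M * h ^+ 2 + C * M * h ^+ 2 + C * M * h ^+ 2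
    + C * M * h ^+ 2 + C * M * h ^+ 2 + C * M * h ^+ 2 by rewrite K1E; ring.
  have nD (a b A B : R) : `|a| <= A -> `|b| <= B -> `|a + b| <= A + B.
    by move=> ? ?; rewrite (le_trans (ler_normD _ _))// lerD.
  have nB (a b A B : R) : `|a| <= A -> `|b| <= B -> `|a - b| <= A + B.
    by move=> ? ?; rewrite (le_trans (ler_normB _ _))// lerD.
  have b6 := b3 _ (HF k); have b7 := b3 _ (HFs k); have b8 := HF k.
  by apply: (nD) b5; apply: (nD) b7; apply: (nD) b2; apply: (nD) b4; apply: (nB) b6; apply: (nB) b1.
have bV k : `|V k| <= M + 2 * C * M.
  rewrite (le_trans (ler_normD _ _))// lerD//.
  have -> : 2 * C * M = C * (M + M) by ring.
  by rewrite bM// (le_trans (ler_normB _ _))// lerD.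
have UF k : `|U k - F0 k| <= h * K2.
  have -> : U k - F0 k = h * V k + (U k - F0 k - h * V k) by ring.
  rewrite (le_trans (ler_normD _ _))// normrM (ger0_norm h0).
  have : h ^+ 2 <= h by rewrite expr2 ler_piMl.
  have := rU k; have := bV k; rewrite K2E; nra.
have bU k : `|U k| <= M + K2.
  have -> : U k = F0 k + (U k - F0 k) by ring.
  rewrite (le_trans (ler_normD _ _))// lerD// (le_trans (UF k))//.
  by rewrite ler_piMl.
have -> : \sum_k p k * (pi0 k * F1 k + pi1 k * F1s k) - F0 j
     - h * (dF j + \sum_k q k * F0 k + g j * (F0s j - F0 j)) =
   (U j - F0 j - h * V j) + h * (\sum_k q k * (U k - F0 k))
     + \sum_k (p k - (j == k)%:R - h * q k) * U k.
  have -> : U j = \sum_k (j == k)%:R * U k.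
    rewrite (bigD1 j)//= eqxx mul1r big1 ?addr0// => k kj.
    by rewrite eq_sym (negbTE kj) mul0r.
  rewrite /V !mulrDr !mulr_sumr -/U.
  have -> : \sum_k p k * (pi0 k * F1 k + pi1 k * F1s k) = \sum_k ((j == k)%:R * U k
     + h * (q k * (U k - F0 k)) + h * (q k * F0 k) + (p k - (j == k)%:R - h * q k) * U k).
    by apply: eq_bigr => k _; rewrite -/(U k); ring.
  rewrite !big_split/=; ring.
have X1 : `|h * (\sum_k q k * (U k - F0 k))| <= (\sum_k `|q k|) * K2 * h ^+ 2.
  rewrite normrM (ger0_norm h0).
  have : `|\sum_k q k * (U k - F0 k)| <= (\sum_k `|q k|) * (h * K2).
    rewrite (le_trans (ler_norm_sum _ _ _))// mulr_suml; apply: ler_sum => k _.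
    by rewrite normrM ler_wpM2l.
  move=> /(ler_wpM2l h0) /le_trans; apply; rewrite expr2.
  by rewrite le_eqVlt; apply/predU1P; left; ring.
have X2 : `|\sum_k (p k - (j == k)%:R - h * q k) * U k| <= d%:R * (M + K2) * (eps * h).
  rewrite (le_trans (ler_norm_sum _ _ _))//.
  apply: (@le_trans _ _ (\sum_(k < d) (M + K2) * (eps * h))).
    by apply: ler_sum => k _; rewrite mulrC bM.
  by rewrite sumr_const card_ord -[leLHS]mulr_natl mulrA.
have S0 : 0 <= \sum_k `|q k| by apply: sumr_ge0.
have X3 := rU j.
apply: (le_trans (ler_normD _ _)); apply: (le_trans (lerD (ler_normD _ _) (lexx _))).
have Y1 : h ^+ 2 <= h * (h + eps) by rewrite expr2 ler_wpM2l// lerDl.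
have Y2 : eps * h <= h * (h + eps) by rewrite mulrC ler_wpM2l// lerDr.
rewrite !mulrDl lerD//; first rewrite lerD//.
- by rewrite (le_trans X3)// ler_wpM2l.
- by rewrite (le_trans X1)// ler_wpM2l// mulr_ge0.
- by rewrite (le_trans X2)//  ler_wpM2l// mulr_ge0// addr_ge0.
Qed.

Section nat_valued.
Variables (R : realType) (dO : measure_display) (Om : measurableType dO) (P : probability Om R).

Lemma measurable_fun_nat (X : Om -> nat) (A : set Om) (phi : nat -> R) :
  (forall x, measurable (A `&` X @^-1` [set x])) ->
  measurable_fun A (phi \o X).
Proof.
move=> mAX _ B mB.
rewrite (_ : A `&` _ = \bigcup_(x in phi @^-1` B) (A `&` X @^-1` [set x])).
  exact: bigcup_measurable.
apply/seteqP; split => w /=.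
  by move=> [Aw Bw]; exists (X w).
by move=> [x Bx [Aw Xw]]; split=> //=; rewrite Xw.
Qed.

Lemma measurable_nat_valued (X : Om -> nat) (A : set Om) :
  (forall x, measurable (A `&` X @^-1` [set x])) -> measurable A.
Proof.
move=> mAX; rewrite (_ : A = \bigcup_x (A `&` X @^-1` [set x])).
  exact: bigcupT_measurable.
by apply/seteqP; split => [w Aw|w [x _ []]//]; exists (X w).
Qed.

(** A law on events determines expectations: sum over the values of [X]. *)
Lemma Rintegral_law_nat (X : Om -> nat) (A A' : set Om) (c M : R) (phi : nat -> R) :
  (forall x, measurable (A `&` X @^-1` [set x])) ->
  (forall x, measurable (A' `&` X @^-1` [set x])) ->
  (forall x, P (A' `&` X @^-1` [set x]) = P (A `&` X @^-1` [set x]) * c%:E)%E ->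
  (forall x, `|phi x| <= M) ->
  \int[P]_(w in A') phi (X w) = (\int[P]_(w in A) phi (X w)) * c.
Proof.
move=> mAX mAX' PAA' bphi.
have mA := measurable_nat_valued mAX; have mA' := measurable_nat_valued mAX'.
have int_series D (f : nat -> R) : (forall x, measurable (D `&` X @^-1` [set x])) ->
   (forall x, 0 <= f x) ->
   (\int[P]_(w in D) (f (X w))%:E = \sum_(0 <= x <oo) ((f x)%:E * P (D `&` X @^-1` [set x])))%E.
  move=> mD f0; rewrite {1}(_ : D = \bigcup_x (D `&` X @^-1` [set x])); last first.
    by apply/seteqP; split => [w Aw|w [x _ []]//]; exists (X w).
  rewrite ge0_integral_bigcup//=.
  - apply: eq_eseriesr => x _; rewrite -integral_cst//.
    by apply: eq_integral => w; rewrite inE => -[_ /= ->].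
  - apply/measurable_EFinP.
    rewrite (_ : \bigcup_x _ = D); first exact: (measurable_fun_nat f mD).
    by apply/seteqP; split => [w [x _ []]//|w Aw]; exists (X w).
  - by move=> w _; rewrite lee_fin.
  - by move=> x y _ _ [w [[_ <-] [_ <-]]].
have bint D (f : nat -> R) (m : R) : (forall x, measurable (D `&` X @^-1` [set x])) ->
   (forall x, `|f x| <= m) -> P.-integrable D (EFin \o (fun w => f (X w))).
  move=> mD fm; apply: measurable_bounded_integrable.
  - exact: measurable_nat_valued mD.
  - by rewrite (le_lt_trans (probability_le1 _ (measurable_nat_valued mD)))// ltry.
  - exact: (measurable_fun_nat f mD).
  - exists m; split; first exact: num_real.
    by move=> x Mx w _ /=; rewrite (le_trans (fm _))// ltW.
have pos (f : nat -> R) (m : R) : (forall x, 0 <= f x) -> (forall x, `|f x| <= m) ->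
    \int[P]_(w in A') f (X w) = (\int[P]_(w in A) f (X w)) * c.
  move=> f0 fm; rewrite /Rintegral.
  have I1 := integrable_fin_num mA (bint A f m mAX fm).
  rewrite !int_series//.
  have -> : (\sum_(0 <= x <oo) ((f x)%:E * P (A' `&` X @^-1` [set x])) =
      c%:E * \sum_(0 <= x <oo) ((f x)%:E * P (A `&` X @^-1` [set x])))%E.
    rewrite -nneseriesZl; last by move=> x _; rewrite mule_ge0// lee_fin.
    by apply: eq_eseriesr => x _; rewrite PAA' muleA muleC.
  by rewrite -int_series// fineM//= mulrC.
have M0 : 0 <= M by rewrite (le_trans _ (bphi 0%N)).
have p0 x : 0 <= phi x + M by have := bphi x; rewrite ler_norml => /andP[]; lra.
have pM x : `|phi x + M| <= M + M.
  by rewrite (le_trans (ler_normD _ _))// lerD// ger0_norm.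
have E1 D : (forall x, measurable (D `&` X @^-1` [set x])) ->
   \int[P]_(w in D) (phi (X w) + M) = \int[P]_(w in D) phi (X w) + \int[P]_(w in D) M.
  move=> mD; rewrite RintegralD//; first exact: measurable_nat_valued mD.
    exact: bint mD bphi.
  by apply: (bint D (fun=> M) M mD) => _; rewrite ger0_norm.
have := pos (fun x => phi x + M) (M + M) p0 pM; rewrite !E1//.
have := pos (fun=> M) M (fun=> M0) (fun=> _); rewrite ger0_norm// => /(_ (fun=> lexx _)).
lra.
Qed.

Lemma Rintegral_partition (I : finType) (g : Om -> I) (f : Om -> R) (M : R) :
  (forall i, measurable (g @^-1` [set i])) -> measurable_fun setT f ->
  (forall w, `|f w| <= M) ->
  \int[P]_w f w = \sum_i \int[P]_(w in g @^-1` [set i]) f w.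
Proof.
move=> mg mf fM; have If := integrable_bounded P mf fM.
transitivity (\int[P]_w (\sum_i (f \_ (g @^-1` [set i])) w)).
  apply: eq_Rintegral => w _; rewrite (bigD1 (g w))//= patchE mem_set// big1 ?addr0// => i ig.
  by rewrite patchE memNset//= => /esym E; rewrite E eqxx in ig.
rewrite Rintegral_sum//.
  by apply: eq_bigr => i _; rewrite -Rintegral_mkcond.
move=> i; rewrite -restrict_EFin; apply/integrable_restrict => //.
by rewrite setTI; apply: integrableS If.
Qed.

End nat_valued.

(** * Dynkin's inequality *)

Section one_step.
Variables (R : realType) (d : nat) (dO : measure_display) (Om : measurableType dO)
  (P : probability Om R) (Q : 'M[R]_d) (lam mu : 'I_d -> R)
  (J : R -> Om -> 'I_d) (T : 'I_d -> nat -> Om -> \bar R) (S : 'I_d -> nat -> Om -> R).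
Hypothesis model : is_modelII P Q lam mu J T S.
Hypothesis mu_gt0 : forall i, 0 < mu i.
Hypothesis lam_ge0 : forall i, 0 <= lam i.

Section step.
Variables (t : R) (s : nat -> R) (K : nat).
Hypotheses (s0 : s 0%N = 0) (s_le : forall k, s k <= s k.+1)
  (s_t : forall k, (k < K)%N -> s k <= t).

Local Notation X := (present_jobs J T S t s).
Local Notation Y := (marked_arrivals T S t s).

Let pi i l B := fine (thinned_poisson (lam i * (s l.+1 - s l)) (expR (- (mu i * (t - s l)))) B).

Let q01 i l : (l < K)%N -> 0 <= expR (- (mu i * (t - s l))) <= 1.
Proof.
move=> lK; rewrite expR_ge0/= -expR0 ler_expR oppr_le0 mulr_ge0//; first exact: ltW.
by rewrite subr_ge0 s_t.
Qed.

Let state k j := [set w | J (s k) w = j].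
Let cell k j j' B := [set w | J (s k) w = j /\ (J (s k.+1) w = j' /\ B (Y j' k w))].

Let law k j x j' B : (k < K)%N ->
  [/\ measurable (state k j `&` X k @^-1` [set x]),
      measurable (cell k j j' B `&` X k @^-1` [set x]) &
      P (cell k j j' B `&` X k @^-1` [set x]) = (P (state k j `&` X k @^-1` [set x]) *
        (transition Q (s k.+1 - s k) j j' * pi j' k B)%:E)%E].
Proof.
move=> kK; have [mA mA' PA] := one_step_law model mu_gt0 s0 s_le s_t j x j' B kK.
have -> : state k j `&` X k @^-1` [set x] = [set w | J (s k) w = j /\ X k w = x] by [].
have -> : cell k j j' B `&` X k @^-1` [set x] =
   [set w | J (s k) w = j /\ X k w = x] `&` [set w | J (s k.+1) w = j' /\ B (Y j' k w)].
  by apply/seteqP; split => [w [[h1 [h2 h3]] h4]|w [[h1 h4] [h2 h3]]].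
by split=> //; rewrite PA EFinM /pi fineK// thinned_poisson_fin_num// q01.
Qed.

Lemma measurable_state_jobs k (f : 'I_d -> nat -> R) : (k < K)%N ->
  measurable_fun setT (fun w => f (J (s k) w) (X k w)).
Proof.
move=> kK _ B mB; rewrite setTI.
rewrite (_ : _ @^-1` _ = \bigcup_(j in [set: 'I_d])
   \bigcup_(x in f j @^-1` B) (state k j `&` X k @^-1` [set x])).
  apply: fin_bigcup_measurable => [|j _]; first exact: finite_finset.
  by apply: bigcup_measurable => x _; case: (law j x j setT kK).
apply/seteqP; split => w /=.
  by move=> Bw; exists (J (s k) w) => //; exists (X k w).
by move=> [j _ [x Bx [Hj Hx]]]; rewrite /preimage/= Hj Hx.
Qed.

(* The number of new jobs, with all values from two on lumped together. *)
Let few (b : 'I_3) : set nat := [set y | minn y 2 = b].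

Let few_of k w : 'I_d * 'I_d * 'I_3 :=
  (J (s k) w, J (s k.+1) w, inord (minn (Y (J (s k.+1) w) k w) 2)).

Let few_ofE k j j' b : few_of k @^-1` [set (j, j', b)] = cell k j j' (few b).
Proof.
have lt3 n : (minn n 2 < 3)%N by rewrite ltnS geq_minr.
apply/seteqP; split => w; rewrite /few_of /cell /few /=.
  by move=> [-> -> <-]; rewrite inordK.
move=> [-> [-> E]]; congr (_, _, _); apply: val_inj; rewrite /= inordK//.
Qed.

(** The expectation after one step, up to the event of two or more new jobs. *)
Lemma expectation_step k (f : 'I_d -> nat -> R) (M : R) : (k < K)%N -> 0 <= M ->
  measurable_fun setT (fun w => f (J (s k.+1) w) (X k.+1 w)) ->
  (forall j x, `|f j x| <= M) ->
  `|\int[P]_w f (J (s k.+1) w) (X k.+1 w) -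
    \int[P]_w \sum_j' transition Q (s k.+1 - s k) (J (s k) w) j' *
       (pi j' k [set 0%N] * f j' (X k w) + pi j' k [set 1%N] * f j' (X k w).+1)|
  <= \sum_j \sum_j' M * `|transition Q (s k.+1 - s k) j j' * pi j' k [set y | (2 <= y)%N]|.
Proof.
move=> kK M0 mf fM; set p := transition Q _.
pose G j x := \sum_j' p j j' * (pi j' k [set 0%N] * f j' x + pi j' k [set 1%N] * f j' x.+1).
have GM j x : `|G j x| <= \sum_j \sum_j' `|p j j'| * (`|pi j' k [set 0%N]| * M + `|pi j' k [set 1%N]| * M).
  apply: (@le_trans _ _ (\sum_j' `|p j j'| * (`|pi j' k [set 0%N]| * M + `|pi j' k [set 1%N]| * M))).
    rewrite (le_trans (ler_norm_sum _ _ _))//; apply: ler_sum => j' _.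
    rewrite normrM ler_wpM2l// (le_trans (ler_normD _ _))// !normrM.
    by rewrite lerD// ler_wpM2l.
  rewrite [leRHS](bigD1 j)//= lerDl; do 2 apply: sumr_ge0 => ? _.
  by rewrite mulr_ge0// addr_ge0// mulr_ge0.
have mstate j : measurable (state k j).
  by apply: (@measurable_nat_valued _ _ (X k)) => x; case: (law j x j setT kK).
have mcell j j' b : measurable (cell k j j' b).
  by apply: (@measurable_nat_valued _ _ (X k)) => x; case: (law j x j' b kK).
have bint (h : Om -> R) m : measurable_fun setT h -> (forall w, `|h w| <= m) ->
   forall A, measurable A -> P.-integrable A (EFin \o h).
  by move=> mh hm A mA; apply: integrableS (integrable_bounded P mh hm).
have mX (g : nat -> R) : measurable_fun setT (fun w => g (X k w)).
  exact: (measurable_state_jobs (fun _ => g) kK).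
have intG : \int[P]_w G (J (s k) w) (X k w) = \sum_j \sum_j' (p j j' *
   (pi j' k [set 0%N] * (\int[P]_(w in state k j) f j' (X k w)) +
    pi j' k [set 1%N] * (\int[P]_(w in state k j) f j' (X k w).+1))).
  rewrite (@Rintegral_partition _ _ _ P _ (J (s k)) _ _ _ (measurable_state_jobs G kK)
     (fun w => GM (J (s k) w) (X k w))); last exact: mstate.
  apply: eq_bigr => j _.
  transitivity (\int[P]_(w in state k j) G j (X k w)).
    by apply: eq_Rintegral => w; rewrite inE => /= ->.
  have I0 j' : P.-integrable (state k j) (EFin \o (fun w => f j' (X k w))).
    exact: (bint _ M (mX (f j')) (fun w => fM j' (X k w))).
  have I1 j' : P.-integrable (state k j) (EFin \o (fun w => f j' (X k w).+1)).
    exact: (bint _ M (mX (fun x => f j' x.+1)) (fun w => fM j' (X k w).+1)).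
  rewrite /G Rintegral_sum//; last first.
    move=> j'; apply: integrable_mulr => //.
    have := integrableD (mstate j) (integrable_mulr (pi j' k [set 0%N]) (mstate j) (I0 j'))
      (integrable_mulr (pi j' k [set 1%N]) (mstate j) (I1 j')).
    by apply: eq_integrable.
  apply: eq_bigr => j' _; rewrite RintegralZl//; last first.
    have := integrableD (mstate j) (integrable_mulr (pi j' k [set 0%N]) (mstate j) (I0 j'))
      (integrable_mulr (pi j' k [set 1%N]) (mstate j) (I1 j')).
    by apply: eq_integrable.
  congr (_ * _); rewrite RintegralD//; try exact: integrable_mulr.
  by rewrite !RintegralZl.
have intF : \int[P]_w f (J (s k.+1) w) (X k.+1 w) = \sum_j \sum_j' (
    p j j' * (pi j' k [set 0%N] * (\int[P]_(w in state k j) f j' (X k w)) +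
    pi j' k [set 1%N] * (\int[P]_(w in state k j) f j' (X k w).+1)) +
    \int[P]_(w in cell k j j' [set y | (2 <= y)%N]) f j' (X k.+1 w)).
  rewrite (@Rintegral_partition _ _ _ P _ (few_of k) _ M _ mf); last 2 first.
  - by move=> [[j j'] b]; rewrite few_ofE.
  - by move=> w; exact: fM.
  pose H j j' b := \int[P]_(w in cell k j j' (few b)) f (J (s k.+1) w) (X k.+1 w).
  rewrite (eq_bigr (fun x : 'I_d * 'I_d * 'I_3 => H x.1.1 x.1.2 x.2)); last first.
    by move=> [[j j'] b] _; rewrite few_ofE.
  rewrite -(pair_bigA _ (fun (jj : 'I_d * 'I_d) b => H jj.1 jj.2 b))/=.
  rewrite -(pair_bigA _ (fun j j' => \sum_b H j j' b))/=.
  apply: eq_bigr => j _; apply: eq_bigr => j' _; rewrite /H.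
  rewrite !big_ord_recl big_ord0 addr0 addrA.
  have f0 : few ord0 = [set 0%N].
    by apply/seteqP; split => [[|[|y]]|y] //=; rewrite /few/= => ->.
  have f1 : few (lift ord0 ord0) = [set 1%N].
    by apply/seteqP; split => [[|[|y]]|y] //=; rewrite /few/= => ->.
  have f2 : few (lift ord0 (lift ord0 ord0)) = [set y | (2 <= y)%N].
    apply/seteqP; split => [[|[|y]]|y] //=; rewrite /few/= => h.
    by apply/minn_idPr.
  have XS w : X k.+1 w = (X k w + Y (J (s k.+1) w) k w)%N.
    by rewrite /present_jobs big_ord_recr.
  rewrite f0 f1 f2; congr (_ + _).
  - have E0 : \int[P]_(w in cell k j j' [set 0%N]) f (J (s k.+1) w) (X k.+1 w) =
        \int[P]_(w in cell k j j' [set 0%N]) f j' (X k w).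
      apply: eq_Rintegral => w; rewrite inE => -[_ [/= Jj' Y0]].
      by rewrite XS Jj' Y0 addn0.
    have E1 : \int[P]_(w in cell k j j' [set 1%N]) f (J (s k.+1) w) (X k.+1 w) =
        \int[P]_(w in cell k j j' [set 1%N]) f j' (X k w).+1.
      apply: eq_Rintegral => w; rewrite inE => -[_ [/= Jj' Y0]].
      by rewrite XS Jj' Y0 addn1.
    rewrite E0 E1.
    rewrite (@Rintegral_law_nat _ _ _ _ (X k) (state k j) _ (p j j' * pi j' k [set 0%N]) M (f j')).
    + rewrite (@Rintegral_law_nat _ _ _ _ (X k) (state k j) _ (p j j' * pi j' k [set 1%N]) M (fun x => f j' x.+1)).
      * ring.
      * by move=> x; case: (law j x j' [set 1%N] kK).
      * by move=> x; case: (law j x j' [set 1%N] kK).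
      * by move=> x; case: (law j x j' [set 1%N] kK).
      * by move=> x; exact: fM.
    + by move=> x; case: (law j x j' [set 0%N] kK).
    + by move=> x; case: (law j x j' [set 0%N] kK).
    + by move=> x; case: (law j x j' [set 0%N] kK).
    + by move=> x; exact: fM.
  - by apply: eq_Rintegral => w; rewrite inE => -[_ [/= ->]].
rewrite intF intG -sumrB.
rewrite (le_trans (ler_norm_sum _ _ _))//; apply: ler_sum => j _.
rewrite -sumrB (le_trans (ler_norm_sum _ _ _))//; apply: ler_sum => j' _.
rewrite addrAC subrr add0r.
set C2 := cell k j j' _.
have mC2 : measurable C2 by exact: mcell.
have -> : \int[P]_(w in C2) f j' (X k.+1 w) = \int[P]_(w in C2) f (J (s k.+1) w) (X k.+1 w).
  by apply: eq_Rintegral => w; rewrite inE => -[_ [/= ->]].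
have If : P.-integrable C2 (EFin \o (fun w => f (J (s k.+1) w) (X k.+1 w))).
  by apply: (bint _ M mf) => // w; exact: fM.
rewrite (le_trans (le_normr_Rintegral mC2 If))//.
apply: (@le_trans _ _ (\int[P]_(w in C2) M)).
  apply: le_Rintegral => //.
    apply: (bint _ M) => //; first exact: measurableT_comp.
    by move=> w; rewrite normr_id.
  by apply: (bint _ `|M|).
rewrite (@Rintegral_law_nat _ _ _ _ (X k) (state k j) _ (p j j' * pi j' k [set y | (2 <= y)%N]) M (fun=> M)).
- rewrite Rintegral_cst// -mulrA ler_wpM2l//.
  apply: (le_trans (ler_wpM2l _ (ler_norm _))); first by rewrite fine_ge0.
  rewrite ler_piMl// -[1]/(fine (1%:E : \bar R)) fine_le//; first exact: fin_num_measure.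
  exact: probability_le1.
- by move=> x; case: (law j x j' [set y | (2 <= y)%N] kK).
- by move=> x; case: (law j x j' [set y | (2 <= y)%N] kK).
- by move=> x; case: (law j x j' [set y | (2 <= y)%N] kK).
- by move=> x; rewrite ger0_norm.
Qed.

End step.
End one_step.

Lemma transition_small_time (R : realType) (d : nat) (Q : 'M[R]_d) (eps : R) : 0 < eps ->
  exists2 h0 : R, 0 < h0 & forall h, 0 <= h <= h0 -> forall j k,
    `|transition Q h j k - (j == k)%:R - h * Q j k| <= eps * h.
Proof.
move=> e0.
have cP k l : continuous (fun t : R => transition Q t k l).
  move=> t; apply: differentiable_continuous; apply/derivable1_diffP.
  by case: (derive_transition_backward Q k l t).
pose D j k (t : R) := \sum_l Q j l * transition Q t l k.
have D0 j k : D j k 0 = Q j k.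
  rewrite /D transition0 (bigD1 k)//= mxE eqxx mulr1 big1 ?addr0// => l lk.
  by rewrite mxE (negbTE lk) mulr0.
have cD j k : D j k t @[t --> 0] --> Q j k.
  by rewrite -[X in _ --> X]D0; apply: cvg_sumr => l _; apply: cvgMr; exact: cP.
have : \forall t \near (0 : R), forall jk : 'I_d * 'I_d, `|Q jk.1 jk.2 - D jk.1 jk.2 t| <= eps.
  apply: (@filter_forall R _ (fun (jk : 'I_d * 'I_d) (t : R) => `|Q jk.1 jk.2 - D jk.1 jk.2 t| <= eps) (nbhs (0 : R))) => jk; by have /cvgrPdist_le /(_ _ e0) := cD jk.1 jk.2.
move=> [r /= r0 Hr]; exists (r / 2); first by rewrite divr_gt0.
move=> h /andP[h0 hr] j k.
have [|c] := @MVT_segment R (fun t => transition Q t j k) (D j k) 0 h h0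
  (fun x _ => derive_transition_backward Q j k x).
  by apply: continuous_subspaceT; exact: cP.
have -> : transition Q 0 j k = (j == k)%:R by rewrite transition0 mxE.
rewrite in_itv/= subr0 => /andP[c0 ch] ->.
rewrite mulrC -mulrBr normrM (ger0_norm h0) mulrC ler_wpM2r// distrC.
have Hc : ball_ Num.norm 0 r c.
  rewrite /ball_ /= sub0r normrN ger0_norm//.
  by rewrite (le_lt_trans ch)// (le_lt_trans hr)// ltr_pdivrMr// ltr_pMr// ltr1n.
exact: (Hr c Hc (j, k)).
Qed.

Section dynkin_on_grid.
Variables (R : realType) (d : nat) (dO : measure_display) (Om : measurableType dO)
  (P : probability Om R) (Q : 'M[R]_d) (lam mu : 'I_d -> R)
  (J : R -> Om -> 'I_d) (T : 'I_d -> nat -> Om -> \bar R) (S : 'I_d -> nat -> Om -> R).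
Hypothesis model : is_modelII P Q lam mu J T S.
Hypothesis mu_gt0 : forall i, 0 < mu i.
Hypothesis lam_ge0 : forall i, 0 <= lam i.

Variables (t : R) (F dF : R -> 'I_d -> nat -> R) (M A m : R).
Hypotheses (t0 : 0 <= t) (M0 : 0 <= M) (A0 : 0 <= A) (m0 : 0 < m).
Hypothesis F_bounded : forall s j x, 0 <= s <= t -> `|F s j x| <= M.
Hypothesis dF_bounded : forall s j x, 0 <= s <= t -> `|dF s j x| <= M.
Hypothesis F_expansion : forall s h j x, 0 <= s -> 0 <= h -> s + h <= t ->
  `|F (s + h) j x - F s j x - h * dF s j x| <= M * h ^+ 2.
Hypothesis F_generator : forall s j x, 0 <= s <= t ->
  `|dF s j x + \sum_k Q j k * F s k x +
    lam j * expR (- (mu j * (t - s))) * (F s j x.+1 - F s j x)| <= A * expR (- (m * (t - s))).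

Let grid (n : nat) (k : nat) : R := k%:R * (t / n%:R).

(** A step at time [s] contributes at most [h A exp (- m (t - s)) + o(h)], and these
exponentials add up to at most [A / m] whatever [t] is. This uniformity in [t] is what
the steady state needs. *)
Lemma dynkin_grid (e : R) : 0 < e -> exists N0 : nat, forall n, (N0 <= n)%N ->
  `|\int[P]_w F t (J t w) (present_jobs J T S t (grid n) n w) -
    \int[P]_w F 0 (J 0 w) 0%N| <= A / m + e.
Proof.
move=> e0.
have [C [C0 Clam Clam2]] : exists C, [/\ 0 <= C, forall i, lam i <= C &
    forall i, 3 * lam i ^+ 2 <= C].
  have L0 : 0 <= \sum_i lam i by apply: sumr_ge0.
  have L20 : 0 <= \sum_i lam i ^+ 2 by apply: sumr_ge0 => *; exact: sqr_ge0.
  exists (\sum_i lam i + 3 * \sum_i lam i ^+ 2); split=> [|i|i].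
  - by rewrite addr_ge0// mulr_ge0.
  - rewrite (@le_trans _ _ (\sum_i lam i))//; last by rewrite lerDl mulr_ge0.
    by rewrite (bigD1 i)//= lerDl; exact: sumr_ge0.
  - rewrite (@le_trans _ _ (3 * \sum_i lam i ^+ 2))//; last by rewrite lerDr.
    rewrite ler_wpM2l// (bigD1 i)//= lerDl; apply: sumr_ge0 => *; exact: sqr_ge0.
have [K1 K1E] : exists K1, K1 = M + 6 * C * M by eexists.
have [K2 K2E] : exists K2, K2 = M + 2 * C * M + K1 by eexists.
pose sQ := \sum_j \sum_k `|Q j k|.
have sQ0 : 0 <= sQ by do 2 apply: sumr_ge0 => ? _.
have sQj j : \sum_k `|Q j k| <= sQ.
  by rewrite /sQ [leRHS](bigD1 j)//= lerDl; do 2 apply: sumr_ge0 => ? _.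
have sQjk j k : `|Q j k| <= sQ.
  by rewrite (le_trans _ (sQj j))// (bigD1 k)//= lerDl; apply: sumr_ge0.
have CM0 : 0 <= C * M by rewrite mulr_ge0.
have K10 : 0 <= K1 by rewrite K1E -mulrA addr_ge0// mulr_ge0.
have K20 : 0 <= K2 by rewrite K2E -mulrA !addr_ge0// mulr_ge0.
have [K3 K3E] : exists K3, K3 = K1 + sQ * K2 + d%:R * (M + K2) by eexists.
have [K4 K4E] : exists K4, K4 = d%:R * (d%:R * (M * ((2 + sQ) * C))) by eexists.
have K30 : 0 <= K3.
  by rewrite K3E addr_ge0 ?addr_ge0// ?mulr_ge0// ?addr_ge0.
have K40 : 0 <= K4 by rewrite K4E mulr_ge0 ?mulr_ge0// ?mulr_ge0// ?addr_ge0.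
pose eps := Num.min 1 (e / (2 * (1 + (K3 + K4) * t))).
have den : 0 < 2 * (1 + (K3 + K4) * t).
  by rewrite mulr_gt0// ltr_pwDl// mulr_ge0// addr_ge0.
have eps0 : 0 < eps by rewrite lt_min ltr01 divr_gt0.
have eps1 : eps <= 1 by rewrite ge_min lexx.
have [h0 h00 Hh0] := transition_small_time Q eps0.
have [N0 HN0] : exists N0 : nat, t / Num.min h0 eps < N0%:R.
  exists (Num.bound (t / Num.min h0 eps)); apply: archi_boundP.
  by rewrite divr_ge0// le_min (ltW h00) (ltW eps0).
exists N0.+1 => n N0n.
have n0 : 0 < n%:R :> R by rewrite ltr0n (leq_trans _ N0n).
set h := t / n%:R.
have h_ge0 : 0 <= h by rewrite divr_ge0// ltW.
have hmin : h <= Num.min h0 eps.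
  rewrite /h ler_pdivrMr// mulrC -ler_pdivrMr; last by rewrite lt_min h00 eps0.
  by rewrite (le_trans (ltW HN0))// ler_nat ltnW.
have hh0 : h <= h0 by rewrite (le_trans hmin)// ge_min lexx.
have heps : h <= eps by rewrite (le_trans hmin)// ge_min lexx orbT.
have h1 : h <= 1 by exact: le_trans eps1.
pose s := grid n.
have sE k : s k = k%:R * h by [].
have s0 : s 0%N = 0 by rewrite sE mul0r.
have sS k : s k.+1 = s k + h by rewrite !sE -natr1 mulrDl mul1r.
have s_le k : s k <= s k.+1 by rewrite sS lerDl.
have sn : s n = t by rewrite sE /h mulrC divfK// gt_eqF.
have s_t k : (k < n.+1)%N -> s k <= t.
  by rewrite ltnS => kn; rewrite -sn !sE ler_wpM2r// ler_nat.
have s_ge0 k : 0 <= s k by rewrite sE mulr_ge0.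
pose X := present_jobs J T S t s.
pose EF k := \int[P]_w F (s k) (J (s k) w) (X k w).
have step k : (k < n)%N -> `|EF k.+1 - EF k| <=
    h * (A * expR (- (m * (t - s k)))) + (K3 + K4) * (h * (h + eps)).
  move=> kn; have kn1 : (k < n.+1)%N by rewrite leqW.
  have mS := @measurable_state_jobs _ _ _ _ P Q lam mu J T S model mu_gt0 t s n.+1 s0 s_le s_t.
  have skt : 0 <= s k <= t by rewrite s_ge0 s_t.
  have skt1 : 0 <= s k.+1 <= t by rewrite s_ge0 s_t.
  have S1 := @expectation_step _ _ _ _ P Q lam mu J T S model mu_gt0 t s n.+1 s0 s_le s_t
    k (F (s k.+1)) M kn1 M0 (mS k.+1 (F (s k.+1)) kn) (fun j x => F_bounded j x skt1).
  pose pi i B := fine (thinned_poisson (lam i * (s k.+1 - s k)) (expR (- (mu i * (t - s k)))) B).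
  have sSk : s k.+1 - s k = h by rewrite sS addrAC subrr add0r.
  pose g i := lam i * expR (- (mu i * (t - s k))).
  have q01 i : 0 <= expR (- (mu i * (t - s k))) <= 1.
    rewrite expR_ge0/= -expR0 ler_expR oppr_le0 mulr_ge0//; first exact: ltW.
    by rewrite subr_ge0 s_t.
  have lh i : 0 <= lam i * (s k.+1 - s k) by rewrite sSk mulr_ge0.
  have Hg i : `|g i| <= C.
    have /andP[q0 q1] := q01 i.
    by rewrite ger0_norm ?mulr_ge0// (le_trans _ (Clam i))// ler_piMr.
  have lh2 i : 3 * (lam i * (s k.+1 - s k)) ^+ 2 <= C * h ^+ 2.
    by rewrite sSk exprMn mulrA ler_wpM2r ?sqr_ge0.
  have pi0 i : `|pi i [set 0%N] - (1 - h * g i)| <= C * h ^+ 2.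
    have := thinned_poisson_expansion [set 0%N] (lh i) (q01 i).
    have -> : \1_[set 0%N] 0%N = 1 :> R by rewrite indicE mem_set.
    have -> : \1_[set 0%N] 1%N = 0 :> R by rewrite indicE memNset.
    rewrite mul0r addr0 mul1r.
    move=> /le_trans; have -> : h * g i = lam i * (s k.+1 - s k) * expR (- (mu i * (t - s k))).
      by rewrite sSk /g; ring.
    exact.
  have pi1 i : `|pi i [set 1%N] - h * g i| <= C * h ^+ 2.
    have := thinned_poisson_expansion [set 1%N] (lh i) (q01 i).
    have -> : \1_[set 1%N] 0%N = 0 :> R by rewrite indicE memNset.
    have -> : \1_[set 1%N] 1%N = 1 :> R by rewrite indicE mem_set.
    rewrite mul0r add0r mul1r.
    move=> /le_trans; have -> : h * g i = lam i * (s k.+1 - s k) * expR (- (mu i * (t - s k))).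
      by rewrite sSk /g; ring.
    exact.
  have pi2 i : `|pi i [set y | (2 <= y)%N]| <= C * h ^+ 2.
    have := thinned_poisson_expansion [set y | (2 <= y)%N] (lh i) (q01 i).
    have -> : \1_[set y | (2 <= y)%N] 0%N = 0 :> R by rewrite indicE memNset.
    have -> : \1_[set y | (2 <= y)%N] 1%N = 0 :> R by rewrite indicE memNset.
    rewrite !mul0r addr0 subr0.
    by move=> /le_trans; exact.
  have tr := Hh0 h _; rewrite h_ge0 hh0 in tr; have {}tr := tr isT.
  have trb j j' : `|transition Q h j j'| <= 2 + sQ.
    have n3 (a b c : R) : `|a + b + c| <= `|a| + `|b| + `|c|.
      by rewrite (le_trans (ler_normD _ _))// lerD2r ler_normD.
    have -> : transition Q h j j' = (j == j')%:R + h * Q j j' +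
      (transition Q h j j' - (j == j')%:R - h * Q j j') by ring.
    apply: (le_trans (n3 _ _ _)).
    have -> : 2 + sQ = 1 + sQ + 1 by ring.
    apply: lerD; first apply: lerD.
    - by rewrite ger0_norm// lern1; case: eqP.
    - by rewrite normrM (ger0_norm h_ge0) (le_trans _ (sQjk j j'))// ler_piMl.
    - by rewrite (le_trans (tr j j'))// mulr_ile1// ltW.
  pose G j x := \sum_j' transition Q h j j' *
    (pi j' [set 0%N] * F (s k.+1) j' x + pi j' [set 1%N] * F (s k.+1) j' x.+1).
  have S2 : `|EF k.+1 - \int[P]_w G (J (s k) w) (X k w)| <= K4 * (h * (h + eps)).
    have {}S1 : `|EF k.+1 - \int[P]_w G (J (s k) w) (X k w)| <=
      \sum_j \sum_j' M * `|transition Q h j j' * pi j' [set y | (2 <= y)%N]|.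
      by move: S1; rewrite /G /pi sSk.
    apply: (le_trans S1).
    apply: (@le_trans _ _ (\sum_(j < d) \sum_(j' < d) M * ((2 + sQ) * (C * (h * (h + eps)))))).
      apply: ler_sum => j _; apply: ler_sum => j' _; rewrite ler_wpM2l// normrM.
      apply: ler_pM => //; apply: (le_trans (pi2 j')); rewrite ler_wpM2l// expr2.
      by rewrite ler_wpM2l// lerDl ltW.
    under eq_bigr do rewrite sumr_const card_ord -[_ *+ d]mulr_natl.
    rewrite sumr_const card_ord -[_ *+ d]mulr_natl K4E le_eqVlt; apply/orP; left.
    by apply/eqP; ring.
  have S3 j x : `|G j x - F (s k) j x| <=
      h * (A * expR (- (m * (t - s k)))) + K3 * (h * (h + eps)).
    have := @one_step_expansion R d j (transition Q h j) (Q j) (fun i => pi i [set 0%N])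
      (fun i => pi i [set 1%N]) g (fun i => F (s k) i x) (fun i => F (s k) i x.+1)
      (fun i => F (s k.+1) i x) (fun i => F (s k.+1) i x.+1) (fun i => dF (s k) i x)
      (fun i => dF (s k) i x.+1) h eps C M.
    rewrite h_ge0 h1 => /(_ isT (ltW eps0) C0 M0 (tr j) pi0 pi1 Hg)
      /(_ (fun i => F_bounded i x skt) (fun i => F_bounded i x.+1 skt))
      /(_ (fun i => F_bounded i x skt1) (fun i => F_bounded i x.+1 skt1))
      /(_ (fun i => dF_bounded i x skt) (fun i => dF_bounded i x.+1 skt)).
    have ske : s k + h <= t by rewrite -sS; case/andP: skt1.
    have HF i x' : `|F (s k.+1) i x' - F (s k) i x' - h * dF (s k) i x'| <= M * h ^+ 2.
      by rewrite sS; exact: F_expansion.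
    move=> /(_ (fun i => HF i x) (fun i => HF i x.+1) K1 K2 K1E K2E).
    rewrite -/(G j x); set L := dF (s k) j x + _ + _.
    have HL : `|L| <= A * expR (- (m * (t - s k))) by exact: F_generator.
    move=> H; have -> : G j x - F (s k) j x = h * L + (G j x - F (s k) j x - h * L) by ring.
    rewrite (le_trans (ler_normD _ _))// lerD//.
      by rewrite normrM (ger0_norm h_ge0) ler_wpM2l.
    apply: (le_trans H); rewrite ler_wpM2r ?mulr_ge0 ?addr_ge0 ?(ltW eps0)//.
    by rewrite K3E lerD2r lerD2l ler_wpM2r.
  have bG j x : `|G j x| <= h * (A * expR (- (m * (t - s k)))) + K3 * (h * (h + eps)) + M.
    have -> : G j x = (G j x - F (s k) j x) + F (s k) j x by ring.
    by rewrite (le_trans (ler_normD _ _))// lerD// F_bounded.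
  have IG : P.-integrable setT (EFin \o (fun w => G (J (s k) w) (X k w))).
    exact: (integrable_bounded P (mS k G kn1) (fun w => bG _ _)).
  have IF : P.-integrable setT (EFin \o (fun w => F (s k) (J (s k) w) (X k w))).
    exact: (integrable_bounded P (mS k (F (s k)) kn1) (fun w => F_bounded _ _ skt)).
  have S4 : `|\int[P]_w G (J (s k) w) (X k w) - EF k| <=
      h * (A * expR (- (m * (t - s k)))) + K3 * (h * (h + eps)).
    rewrite /EF -RintegralB//.
    apply: (norm_expectation_le P (mS k (fun j x => G j x - F (s k) j x) kn1)) => w.
    exact: S3.
  have -> : EF k.+1 - EF k = (\int[P]_w G (J (s k) w) (X k w) - EF k) +
     (EF k.+1 - \int[P]_w G (J (s k) w) (X k w)) by ring.
  by rewrite (le_trans (ler_normD _ _))// mulrDl addrA lerD.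
(* [exp (m h) >= 1 + m h] makes the main term of a step telescope. *)
have exp_step k : h * (A * expR (- (m * (t - s k)))) <=
    A / m * (expR (- (m * (t - s k.+1))) - expR (- (m * (t - s k)))).
  have -> : expR (- (m * (t - s k.+1))) = expR (- (m * (t - s k))) * expR (m * h).
    by rewrite -expRD sS; congr expR; ring.
  set E := expR (- (m * (t - s k))).
  have E0 : 0 <= E by exact: expR_ge0.
  have := expR_ge1Dx (m * h) => H.
  have -> : h * (A * E) = A / m * (E * (1 + m * h) - E) by field; rewrite gt_eqF.
  by rewrite ler_wpM2l ?divr_ge0 ?(ltW m0)// lerB// ler_wpM2l.
have tele k : (k <= n)%N -> `|EF k - EF 0%N| <=
   A / m * (expR (- (m * (t - s k))) - expR (- (m * (t - s 0%N))))
   + (K3 + K4) * (h + eps) * (k%:R * h).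
  elim: k => [_|k IH kn]; first by rewrite !subrr normr0 mulr0 mul0r mulr0 addr0.
  have -> : EF k.+1 - EF 0%N = (EF k - EF 0%N) + (EF k.+1 - EF k) by ring.
  apply: (le_trans (ler_normD _ _)); apply: (le_trans (lerD (IH (ltnW kn)) (step k kn))).
  have := exp_step k; rewrite -natr1; lra.
have := tele n (leqnn _); rewrite -sE sn.
have -> : EF n = \int[P]_w F t (J t w) (X n w) by rewrite /EF sn.
have -> : EF 0%N = \int[P]_w F 0 (J 0 w) 0%N.
  by rewrite /EF s0; apply: eq_Rintegral => w _; rewrite /X /present_jobs big_ord0.
move=> H; apply: (le_trans H); rewrite lerD//.
  rewrite -[leRHS]mulr1 ler_wpM2l ?divr_ge0 ?(ltW m0)//.
  rewrite subrr mulr0 oppr0 expR0 lerBlDr lerDl; exact: expR_ge0.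
have K0 : 0 <= K3 + K4 by rewrite addr_ge0.
have Ee : eps * (2 * (1 + (K3 + K4) * t)) <= e.
  by rewrite -ler_pdivlMr// /eps ge_min lexx orbT.
apply: (@le_trans _ _ ((K3 + K4) * (eps + eps) * t)).
  by rewrite ler_wpM2r// ler_wpM2l// lerD.
have := ltW eps0; move: Ee; lra.
Qed.

End dynkin_on_grid.

Lemma sum_consecutive_blocks (c : nat -> nat) (f : nat -> nat) (n : nat) :
  (forall l, (c l <= c l.+1)%N) ->
  (\sum_(l < n) \sum_(c l <= m < c l.+1) f m = \sum_(c 0%N <= m < c n) f m)%N.
Proof.
move=> cS; elim: n => [|n IH]; first by rewrite big_ord0 big_geq.
rewrite big_ord_recr/= IH -big_cat_nat//.
by elim: n {IH} => // n IH; exact: leq_trans (cS n).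
Qed.

Section grid_limit.
Variables (R : realType) (d : nat) (dO : measure_display) (Om : measurableType dO)
  (J : R -> Om -> 'I_d) (T : 'I_d -> nat -> Om -> \bar R) (S : 'I_d -> nat -> Om -> R).
Hypotheses (J_right : forall w (t : R), 0 <= t -> \forall s \near t^'+, J s w = J t w)
  (T_gt0 : forall i w n, (0 < T i n w)%E) (T_le : forall i w n, (T i n w <= T i n.+1 w)%E)
  (T_fin : forall i w (t : R), finite_set [set n | (T i n w <= t%:E)%E]).

Let job (t : R) (w : Om) (x : 'I_d * nat) : bool :=
  (J (fine (T x.1 x.2 w)) w == x.1) && (t%:E < T x.1 x.2 w + (S x.1 x.2 w)%:E)%E.

Lemma number_in_systemE t w : number_in_system J T S t w =
  (\sum_(i < d) \sum_(0 <= m < points_upto (T i) t w) job t w (i, m))%N.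
Proof.
pose C i := points_upto (T i) t w.
pose all := [seq (i, m) | i <- enum 'I_d, m <- iota 0 (C i)].
have u_all : uniq all.
  apply: allpairs_uniq_dep; rewrite ?enum_uniq//.
    by move=> i _; exact: iota_uniq.
  by move=> [i m] [j k] _ _ [-> ->].
have -> : number_in_system J T S t w = size [seq x <- all | job t w x].
  rewrite /number_in_system.
  have -> : jobs_present J T S t w = [set` [fset x in [seq x <- all | job t w x]]%fset].
    apply/seteqP; split => -[i m]; rewrite /jobs_present /= in_fset mem_filter /job /=.
      move=> [H1 H2 H3]; rewrite H2 eqxx H3/=; apply/allpairsPdep.
      exists i, m; split=> //; first by rewrite mem_enum.
      by rewrite mem_iota /= add0n /C ltn_points_upto.
    move=> /andP[/andP[/eqP H2 H3] /allpairsPdep[i' [m' [_ mi [E1 E2]]]]]; subst i' m'.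
    move: mi; rewrite mem_iota /= add0n /C ltn_points_upto//.
  rewrite set_fsetK card_fseq undup_id//; exact: filter_uniq.
rewrite size_filter -sum1_count big_mkcond/= /all big_allpairs_dep/= big_enum/=.
apply: eq_bigr => i _; rewrite /index_iota subn0; apply: eq_bigr => m _.
by case: (job _ _ _).
Qed.

(** The paths of [J] are only right-continuous, which is why the grid version reads
the state at the right end of each cell, but the residual service time at its
left end. *)
Lemma present_jobs_eventually (t : R) w : 0 <= t -> exists N0 : nat, forall n, (N0 <= n)%N ->
  present_jobs J T S t (fun k => k%:R * (t / n%:R)) n w = number_in_system J T S t w.
Proof.
move=> t0.
pose good i m (dl : R) :=
  (forall u, fine (T i m w) <= u < fine (T i m w) + dl -> J u w = J (fine (T i m w)) w) /\
  (forall u, fine (T i m w) - dl < u < fine (T i m w) ->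
     (t - u < S i m w) = (t%:E < T i m w + (S i m w)%:E)%E).
have fT i m : (m < points_upto (T i) t w)%N -> T i m w \is a fin_num.
  rewrite ltn_points_upto// => mt.
  by rewrite ge0_fin_numE; [exact: le_lt_trans mt (ltry _)|exact: ltW].
have near_good : forall i (m : 'I_(points_upto (T i) t w)), \forall dl \near (0 : R)^'+, good i m dl.
  move=> i m; have fTm := fT i m (ltn_ord m); set tau := fine (T i m w).
  have tau0 : 0 <= tau by rewrite fine_ge0// ltW.
  have [r /= r0 Hr] := J_right w tau0.
  pose b : R := if t < tau + S i m w then tau + S i m w - t else 1.
  have b0 : 0 < b by rewrite /b; case: ifP => // h; rewrite subr_gt0.
  near=> dl.
  have dlr : dl < r by near: dl; exact: nbhs_right_lt.
  have dlb : dl < b by near: dl; exact: nbhs_right_lt.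
  rewrite /good -/tau; split=> u /andP[h1 h2].
    move: h1; rewrite le_eqVlt => /predU1P[->//|tu].
    apply: Hr => //=; rewrite distrC ger0_norm ?subr_ge0 1?ltW//.
    by rewrite ltrBlDl (lt_trans h2)// ltrD2l.
  rewrite -(fineK fTm) -/tau -EFinD lte_fin.
  have [h|h] := ltP t (tau + S i m w).
    rewrite ltrBlDl -ltrBlDr; apply/idP; move: dlb; rewrite /b h; lra.
  by apply/negbTE; rewrite -leNgt; lra.
have [dl dl0 Hdl] : exists2 dl : R, 0 < dl & forall i m,
    (m < points_upto (T i) t w)%N -> good i m dl.
  have : \forall dl \near (0 : R)^'+, 0 < dl /\
      forall i (m : 'I_(points_upto (T i) t w)), good i m dl.
    near=> dl; split; first by near: dl; exact: nbhs_right_gt.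
    near: dl; apply: (@filter_forall R _ (fun i dl => forall m : 'I_(points_upto (T i) t w), good i m dl)) => i.
    exact: (@filter_forall R _ (fun (m : 'I_(points_upto (T i) t w)) dl => good i m dl)).
  move=> /filter_ex[dl [dl0 H]]; exists dl => // i m mt.
  exact: (H i (Ordinal mt)).
exists (Num.bound (t / dl)).+1 => n Nn.
have n0 : 0 < n%:R :> R by rewrite ltr0n (leq_trans _ Nn).
set h := t / n%:R.
have h0 : 0 <= h by rewrite divr_ge0// ltW.
have hdl : h < dl.
  rewrite /h ltr_pdivrMr// mulrC -ltr_pdivrMr//.
  rewrite (lt_le_trans (archi_boundP _))//; first by rewrite divr_ge0// ltW.
  by rewrite ler_nat ltnW.
pose s (k : nat) : R := k%:R * h.
have sS k : s k.+1 = s k + h by rewrite /s -natr1 mulrDl mul1r.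
have s_le k : s k <= s k.+1 by rewrite sS lerDl.
have sn : s n = t by rewrite /s /h mulrC divfK// gt_eqF.
rewrite number_in_systemE /present_jobs -/s.
transitivity (\sum_(i < d) \sum_(l < n) \sum_(points_upto (T i) (s l) w <= m < points_upto (T i) (s l.+1) w)
    job t w (i, m))%N; last first.
  apply: eq_bigr => i _.
  rewrite (sum_consecutive_blocks (c := fun l => points_upto (T i) (s l) w)); last first.
    by move=> l; exact: points_upto_le.
  by rewrite /s mul0r points_upto0// -/(s n) sn.
rewrite exchange_big/=; apply: eq_bigr => l _.
transitivity (\sum_(i < d) (J (s l.+1) w == i) * marked_arrivals T S t s i l w)%N.
  rewrite (bigD1 (J (s l.+1) w))//= eqxx mul1n big1 ?addn0// => i.
  by rewrite eq_sym => /negbTE ->.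
apply: eq_bigr => i _; rewrite /marked_arrivals big_distrr/=.
apply: eq_big_nat => m /andP[m1 m2].
have tm : (m < points_upto (T i) t w)%N.
  rewrite (leq_trans m2)// points_upto_le// -sn /s ler_wpM2r// ler_nat.
  exact: ltn_ord.
have fTm := fT _ _ tm; have [g1 g2] := Hdl _ _ tm.
move: m1 m2; rewrite leqNgt !ltn_points_upto// -(fineK fTm) !lee_fin -ltNge.
set tau := fine _ => m1 m2.
rewrite /job/= -/tau -(g1 (s l.+1)); last by rewrite m2/= sS ltrD.
rewrite -(g2 (s l)); last by rewrite m1 andbT ltrBlDr (le_lt_trans m2)// sS ltrD2l.
by case: (_ == _); case: (_ < _).
Unshelve. all: by end_near. Qed.

End grid_limit.

Section dynkin.
Variables (R : realType) (d : nat) (dO : measure_display) (Om : measurableType dO)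
  (P : probability Om R) (Q : 'M[R]_d) (lam mu : 'I_d -> R)
  (J : R -> Om -> 'I_d) (T : 'I_d -> nat -> Om -> \bar R) (S : 'I_d -> nat -> Om -> R).
Hypothesis model : is_modelII P Q lam mu J T S.
Hypothesis mu_gt0 : forall i, 0 < mu i.
Hypothesis lam_ge0 : forall i, 0 <= lam i.

Let grid (t : R) (n : nat) (k : nat) : R := k%:R * (t / n.+1%:R).

Let grid_eventually (t : R) w : 0 <= t -> \forall n \near \oo,
  present_jobs J T S t (grid t n) n.+1 w = number_in_system J T S t w.
Proof.
move=> t0; have [[_ Jr _] Tp _ _ _] := model.
have [i w' n|i w' n|i w' u|N0 HN] := @present_jobs_eventually R d _ Om J T S Jr _ _ _ t w t0.
- by have [] := Tp i.
- by have [] := Tp i.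
- by have [] := Tp i.
by exists N0 => // n /= Nn; apply: HN; exact: leqW.
Qed.

Let measurable_grid (t : R) n (f : 'I_d -> nat -> R) : 0 <= t ->
  measurable_fun setT (fun w => f (J t w) (present_jobs J T S t (grid t n) n.+1 w)).
Proof.
move=> t0; have h0 : 0 <= t / n.+1%:R by rewrite divr_ge0.
have sn : grid t n n.+1 = t by rewrite /grid mulrC divfK// pnatr_eq0.
have := @measurable_state_jobs _ _ _ _ P Q lam mu J T S model mu_gt0 t (grid t n) n.+2
  _ _ _ n.+1 f (ltnSn _); rewrite sn; apply.
- by rewrite /grid mul0r.
- by move=> k; rewrite /grid ler_wpM2r// ler_nat.
- by move=> k kn; rewrite -[leRHS]sn /grid ler_wpM2r// ler_nat.
Qed.

(** The number in the system is a pointwise limit of the grid versions. *)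
Lemma measurable_fun_state_number (t : R) (f : 'I_d -> nat -> R) : 0 <= t ->
  measurable_fun setT (fun w => f (J t w) (number_in_system J T S t w)).
Proof.
move=> t0.
apply: (@measurable_fun_cvg _ _ _ setT
  (fun n w => f (J t w) (present_jobs J T S t (grid t n) n.+1 w))).
  by move=> n; exact: measurable_grid.
move=> w _; apply: cvg_near_cst; have := grid_eventually w t0; apply: filterS => n.
by move=> /= ->.
Qed.

(** Dynkin's inequality for the Markov chain formed by the background process and
the number of jobs arrived so far that will still be present at time [t]; the
discretised version passes to the limit by bounded convergence. *)
Lemma dynkin_inequality (t : R) (F dF : R -> 'I_d -> nat -> R) (M A m : R) :
  0 <= t -> 0 <= M -> 0 <= A -> 0 < m ->
  (forall s j x, 0 <= s <= t -> `|F s j x| <= M) ->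
  (forall s j x, 0 <= s <= t -> `|dF s j x| <= M) ->
  (forall s h j x, 0 <= s -> 0 <= h -> s + h <= t ->
    `|F (s + h) j x - F s j x - h * dF s j x| <= M * h ^+ 2) ->
  (forall s j x, 0 <= s <= t ->
    `|dF s j x + \sum_k Q j k * F s k x +
      lam j * expR (- (mu j * (t - s))) * (F s j x.+1 - F s j x)|
    <= A * expR (- (m * (t - s)))) ->
  `|\int[P]_w F t (J t w) (number_in_system J T S t w) - \int[P]_w F 0 (J 0 w) 0%N| <= A / m.
Proof.
move=> t0 M0 A0 m0 HF HdF HE HL.
have tt : 0 <= t <= t by rewrite t0 lexx.
have cv : \int[P]_w F t (J t w) (present_jobs J T S t (grid t n) n.+1 w) @[n --> \oo] -->
    \int[P]_w F t (J t w) (number_in_system J T S t w).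
  apply: (@bounded_cvg_Rintegral _ _ _ _ _ _ _ M) => //.
  - by rewrite (le_lt_trans (probability_le1 _ _))// ltry.
  - by move=> n; exact: measurable_grid.
  - by move=> n w _; exact: HF.
  - move=> w _; apply: cvg_near_cst; have := grid_eventually w t0; apply: filterS => n.
    by move=> /= ->.
apply/ler_addgt0Pr => e e0.
have [N0 HN] := @dynkin_grid _ _ _ _ P Q lam mu J T S model mu_gt0 lam_ge0 t F dF M A m
  t0 M0 A0 m0 HF HdF HE HL e e0.
set c := \int[P]_w F 0 (J 0 w) 0%N.
have cv2 : `|\int[P]_w F t (J t w) (present_jobs J T S t (grid t n) n.+1 w) - c| @[n --> \oo] -->
    `|\int[P]_w F t (J t w) (number_in_system J T S t w) - c|.
  by apply: cvg_norm; apply: cvgB => //; exact: cvg_cst.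
rewrite -(cvg_lim _ cv2)//; apply: limr_le; first exact: cvgP cv2.
by exists N0 => // n /= Nn; apply: HN; exact: leqW.
Qed.

End dynkin.

(** * Functions of the remaining time *)

Section expandable.
Variable R : realType.

Lemma norm_sin_le1 (x : R) : `|sin x| <= 1.
Proof. by rewrite ler_norml sin_geN1 sin_le1. Qed.

Lemma norm_cos_le1 (x : R) : `|cos x| <= 1.
Proof. by rewrite ler_norml cos_geN1 cos_le1. Qed.

Lemma MVT_between (g dg : R -> R) (a b : R) : (forall x, is_derive x (1 : R) g (dg x)) ->
  exists c, [/\ Num.min a b <= c <= Num.max a b, `|c - a| <= `|b - a| &
    g b - g a = dg c * (b - a)].
Proof.
move=> H; have cg : continuous g.
  by move=> x; apply: differentiable_continuous; apply/derivable1_diffP; case: (H x).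
have [ab|/ltW ba] := leP a b.
  have [|c] := @MVT_segment R g dg a b ab (fun x _ => H x); first exact: continuous_subspaceT.
  rewrite in_itv/= => /andP[ac cb] E; exists c; split=> //; first by rewrite ac cb.
  by rewrite !ger0_norm ?subr_ge0// lerD2r.
have [|c] := @MVT_segment R g dg b a ba (fun x _ => H x); first exact: continuous_subspaceT.
rewrite in_itv/= => /andP[bc ca] E; exists c; split=> //; first by rewrite bc ca.
  by rewrite !ler0_norm ?subr_le0// lerN2 lerD2r.
by rewrite -opprB E -mulrN opprB.
Qed.

Lemma taylor_order1 (g dg ddg : R -> R) (a b C : R) :
  (forall x, is_derive x (1 : R) g (dg x)) -> (forall x, is_derive x (1 : R) dg (ddg x)) ->
  (forall x, Num.min a b <= x <= Num.max a b -> `|ddg x| <= C) ->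
  `|g b - g a - (b - a) * dg a| <= C * (b - a) ^+ 2.
Proof.
move=> Hg Hdg HC.
have [c [/andP[mc cM] ca E]] := MVT_between a b Hg.
have [e [/andP[me eM] _ E2]] := MVT_between a c Hdg.
have -> : g b - g a - (b - a) * dg a = (dg c - dg a) * (b - a) by rewrite E; ring.
rewrite E2 !normrM -(real_normK (num_real (b - a))) expr2 mulrA ler_wpM2r//.
apply: ler_pM => //; apply: HC; apply/andP; split.
  by apply: le_trans me; rewrite le_min mc ge_min lexx.
by apply: (le_trans eM); rewrite ge_max cM le_max lexx.
Qed.

(** Functions of the remaining time [u >= 0] with a bounded first-order expansion:
the regularity that [dynkin_inequality] asks of a test function. *)
Definition expandable (f df : R -> R) : Prop :=
  exists2 M : R, 0 <= M & forall u v, 0 <= u -> 0 <= v ->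
    [/\ `|f u| <= M, `|df u| <= M & `|f v - f u - (v - u) * df u| <= M * (v - u) ^+ 2].

(** The expansion gives the bound for small increments and boundedness for large ones. *)
Lemma expandable_lipschitz (f df : R -> R) (M : R) : 0 <= M ->
  (forall u v, 0 <= u -> 0 <= v ->
    [/\ `|f u| <= M, `|df u| <= M & `|f v - f u - (v - u) * df u| <= M * (v - u) ^+ 2]) ->
  forall u v, 0 <= u -> 0 <= v -> `|f v - f u| <= 2 * M * `|v - u|.
Proof.
move=> M0 H u v u0 v0; have [b1 b2 b3] := H u v u0 v0; have [b4 _ _] := H v u v0 u0.
have [le1|/ltW ge1] := leP `|v - u| 1.
  have -> : f v - f u = (f v - f u - (v - u) * df u) + (v - u) * df u by ring.
  have -> : 2 * M * `|v - u| = M * `|v - u| + M * `|v - u| by ring.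
  rewrite (le_trans (ler_normD _ _))// lerD//.
    rewrite (le_trans b3)// ler_wpM2l// -(real_normK (num_real (v - u))) expr2.
    by rewrite ler_piMl.
  by rewrite normrM mulrC ler_wpM2r.
rewrite (le_trans (ler_normB _ _))// (@le_trans _ _ (2 * M))//.
  by rewrite (_ : 2 * M = M + M) ?lerD//; ring.
by rewrite ler_peMr// mulr_ge0.
Qed.

Lemma eq_expandable (f g df dg : R -> R) : f =1 g -> df =1 dg ->
  expandable f df -> expandable g dg.
Proof. by move=> /funext <- /funext <-. Qed.

Lemma expandable_cst (c : R) : expandable (fun=> c) (fun=> 0).
Proof.
exists `|c| => // u v _ _; split; rewrite ?normr0//.
by rewrite subrr mulr0 subr0 normr0 mulr_ge0// sqr_ge0.
Qed.

Lemma expandableD (f g df dg : R -> R) : expandable f df -> expandable g dg ->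
  expandable (fun u => f u + g u) (fun u => df u + dg u).
Proof.
move=> [M M0 Hf] [N N0 Hg]; exists (M + N) => [|u v u0 v0]; first exact: addr_ge0.
have [f1 f2 f3] := Hf u v u0 v0; have [g1 g2 g3] := Hg u v u0 v0; split.
- by rewrite (le_trans (ler_normD _ _))// lerD.
- by rewrite (le_trans (ler_normD _ _))// lerD.
- have -> : f v + g v - (f u + g u) - (v - u) * (df u + dg u) =
    (f v - f u - (v - u) * df u) + (g v - g u - (v - u) * dg u) by ring.
  by apply: (le_trans (ler_normD _ _)); rewrite [leRHS]mulrDl lerD.
Qed.

(** The product of the two increments is quadratic by [expandable_lipschitz]. *)
Lemma expandableM (f g df dg : R -> R) : expandable f df -> expandable g dg ->
  expandable (fun u => f u * g u) (fun u => df u * g u + f u * dg u).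
Proof.
move=> [M M0 Hf] [N N0 Hg]; exists (6 * (M * N)) => [|u v u0 v0]; first by rewrite !mulr_ge0.
have MN0 : 0 <= M * N by exact: mulr_ge0.
have Lf := expandable_lipschitz M0 Hf u0 v0; have Lg := expandable_lipschitz N0 Hg u0 v0.
have [f1 f2 f3] := Hf u v u0 v0; have [g1 g2 g3] := Hg u v u0 v0; split.
- by rewrite normrM; apply: (@le_trans _ _ (M * N)); [exact: ler_pM|lra].
- apply: (le_trans (ler_normD _ _)); rewrite !normrM.
  apply: (@le_trans _ _ (M * N + M * N)); last by lra.
  by apply: lerD; exact: ler_pM.
- have -> : f v * g v - f u * g u - (v - u) * (df u * g u + f u * dg u) =
    (f v - f u) * (g v - g u) + (f v - f u - (v - u) * df u) * g u +
    f u * (g v - g u - (v - u) * dg u) by ring.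
  have -> : 6 * (M * N) * (v - u) ^+ 2 = 4 * (M * N) * (v - u) ^+ 2 + (M * (v - u) ^+ 2) * N +
     M * (N * (v - u) ^+ 2) by ring.
  apply: (le_trans (ler_normD _ _)); rewrite lerD//; last by rewrite normrM ler_pM.
  apply: (le_trans (ler_normD _ _)); rewrite lerD//; last by rewrite normrM ler_pM.
  rewrite normrM -(real_normK (num_real (v - u))).
  have -> : 4 * (M * N) * `|v - u| ^+ 2 = (2 * M * `|v - u|) * (2 * N * `|v - u|) by ring.
  by rewrite ler_pM.
Qed.

Lemma expandableZ (c : R) (f df : R -> R) : expandable f df ->
  expandable (fun u => c * f u) (fun u => c * df u).
Proof.
move=> H; apply: eq_expandable (expandableM (expandable_cst c) H) => u //.
by rewrite mul0r add0r.
Qed.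

Lemma expandable_sum (n : nat) (f df : 'I_n -> R -> R) :
  (forall i, expandable (f i) (df i)) ->
  expandable (fun u => \sum_i f i u) (fun u => \sum_i df i u).
Proof.
elim: n f df => [|n IH] f df H.
  by apply: eq_expandable (expandable_cst 0) => u; rewrite big_ord0.
apply: eq_expandable (expandableD (H ord0) (IH _ _ (fun i => H (lift ord0 i)))) => u;
  by rewrite big_ord_recl.
Qed.

Lemma expandable_comp (g dg ddg : R -> R) (f df : R -> R) :
  (forall x, is_derive x (1 : R) g (dg x)) -> (forall x, is_derive x (1 : R) dg (ddg x)) ->
  (forall B : R, exists2 C : R, 0 <= C & forall x, `|x| <= B ->
    [/\ `|g x| <= C, `|dg x| <= C & `|ddg x| <= C]) ->
  expandable f df -> expandable (fun u => g (f u)) (fun u => dg (f u) * df u).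
Proof.
move=> Hg Hdg bg [M M0 Hf]; have [C C0 HC] := bg M.
have CM0 : 0 <= C * M by exact: mulr_ge0.
have CM20 : 0 <= C * M ^+ 2 by rewrite mulr_ge0// sqr_ge0.
exists (C + C * M + 4 * (C * M ^+ 2)) => [|u v u0 v0]; first by rewrite !addr_ge0// mulr_ge0.
have Lf := expandable_lipschitz M0 Hf u0 v0.
have [f1 f2 f3] := Hf u v u0 v0; have [f4 _ _] := Hf v u v0 u0.
have [g1 g2 _] := HC _ f1; split.
- by rewrite (le_trans g1)//; lra.
- by rewrite normrM; apply: (@le_trans _ _ (C * M)); [exact: ler_pM|lra].
- have -> : g (f v) - g (f u) - (v - u) * (dg (f u) * df u) =
    (g (f v) - g (f u) - (f v - f u) * dg (f u)) + dg (f u) * (f v - f u - (v - u) * df u) by ring.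
  rewrite (le_trans (ler_normD _ _))//.
  have T : `|g (f v) - g (f u) - (f v - f u) * dg (f u)| <= C * (f v - f u) ^+ 2.
    apply: (taylor_order1 Hg Hdg) => x /andP[x1 x2].
    have [|_ _ //] := HC x; rewrite ler_norml; move: f1 f4; rewrite !ler_norml.
    move=> /andP[a1 a2] /andP[b1 b2]; apply/andP; split.
      by apply: le_trans x1; rewrite le_min a1 b1.
    by apply: (le_trans x2); rewrite ge_max a2 b2.
  have sq : (f v - f u) ^+ 2 <= 4 * M ^+ 2 * (v - u) ^+ 2.
    rewrite -(real_normK (num_real (f v - f u))) -(real_normK (num_real (v - u))).
    have -> : 4 * M ^+ 2 * `|v - u| ^+ 2 = (2 * M * `|v - u|) ^+ 2 by ring.
    by rewrite ler_pXn2r// ?nnegrE// !mulr_ge0.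
  have T2 : `|dg (f u) * (f v - f u - (v - u) * df u)| <= C * M * (v - u) ^+ 2.
    by rewrite normrM -mulrA ler_pM.
  have := ler_wpM2l C0 sq; have := sqr_ge0 (v - u) => q0 q1.
  have : 0 <= C * (v - u) ^+ 2 by exact: mulr_ge0.
  move: T T2; set a := `|_|; set b := `|_|; lra.
Qed.

Lemma expandable_cos (f df : R -> R) : expandable f df ->
  expandable (fun u => cos (f u)) (fun u => - sin (f u) * df u).
Proof.
apply: (@expandable_comp cos (fun x => - sin x) (fun x => - cos x)) => // B.
exists 1 => // x _; rewrite !normrN; split; rewrite ler_norml ?cos_geN1 ?cos_le1//;
  by rewrite sin_geN1 sin_le1.
Qed.

Lemma expandable_sin (f df : R -> R) : expandable f df ->
  expandable (fun u => sin (f u)) (fun u => cos (f u) * df u).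
Proof.
apply: (@expandable_comp sin cos (fun x => - sin x)) => // B.
exists 1 => // x _; rewrite normrN; split; rewrite ler_norml ?cos_geN1 ?cos_le1//;
  by rewrite sin_geN1 sin_le1.
Qed.

Lemma expandable_expR (f df : R -> R) : expandable f df ->
  expandable (fun u => expR (f u)) (fun u => expR (f u) * df u).
Proof.
apply: (@expandable_comp expR expR expR) => // B.
exists (expR B) => [|x xB]; first exact: expR_ge0.
have : `|expR x| <= expR B.
  by rewrite ger0_norm ?expR_ge0// ler_expR (le_trans (ler_norm _)).
by split.
Qed.

Lemma is_derive_expRM (c x : R) :
  is_derive x (1 : R) (fun u => expR (- (c * u))) (- c * expR (- (c * x))).
Proof.
rewrite (_ : (fun u => _) = (fun u => expR (- c * u))).
  by have := is_derive_expRZ (- c) x; rewrite (mulNr c x).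
by apply/funext => u; rewrite mulNr.
Qed.

Lemma expandable_decay (c : R) : 0 <= c ->
  expandable (fun u => expR (- (c * u))) (fun u => - c * expR (- (c * u))).
Proof.
move=> c0; exists (1 + c + c ^+ 2) => [|u v u0 v0]; first by rewrite !addr_ge0// sqr_ge0.
have e1 x : 0 <= x -> expR (- (c * x)) <= 1.
  by move=> x0; rewrite -expR0 ler_expR oppr_le0 mulr_ge0.
have c20 : 0 <= c ^+ 2 by exact: sqr_ge0.
split.
- by rewrite ger0_norm ?expR_ge0// (le_trans (e1 _ u0))//; lra.
- rewrite normrM normrN !ger0_norm ?expR_ge0//.
  by rewrite (@le_trans _ _ (c * 1))// ?ler_wpM2l ?e1//; lra.
- apply: (@le_trans _ _ (c ^+ 2 * (v - u) ^+ 2)); last first.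
    by rewrite ler_wpM2r ?sqr_ge0//; lra.
  apply: (@taylor_order1 (fun x => expR (- (c * x))) (fun x => - c * expR (- (c * x))) (fun x => c ^+ 2 * expR (- (c * x)))).
  + exact: is_derive_expRM.
  + move=> x; have := is_deriveZ (- c) (is_derive_expRM c x).
    by rewrite /GRing.scale/= mulrA mulrNN -expr2; exact.
  + move=> x /andP[x1 _]; have x0 : 0 <= x by rewrite (le_trans _ x1)// le_min u0.
    by rewrite normrM !ger0_norm ?expR_ge0// ler_piMr// e1.
Qed.

End expandable.

Section fading.
Variables (R : realType) (m : R).
Hypothesis m0 : 0 < m.

(** Expandable functions that, with their derivative, decay at rate [m]. *)
Definition fading (f df : R -> R) : Prop := expandable f df /\
  exists2 H : R, 0 <= H & forall u, 0 <= u ->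
    `|f u| <= H * expR (- (m * u)) /\ `|df u| <= H * expR (- (m * u)).

Let e_le1 u : 0 <= u -> expR (- (m * u)) <= 1.
Proof. by move=> u0; rewrite -expR0 ler_expR oppr_le0 mulr_ge0// ltW. Qed.

Lemma fadingD (f g df dg : R -> R) : fading f df -> fading g dg ->
  fading (fun u => f u + g u) (fun u => df u + dg u).
Proof.
move=> [Ef [H H0 Hf]] [Eg [G G0 Hg]]; split; first exact: expandableD.
exists (H + G) => [|u u0]; first exact: addr_ge0.
have [f1 f2] := Hf u u0; have [g1 g2] := Hg u u0; rewrite mulrDl.
by split; rewrite (le_trans (ler_normD _ _))// lerD.
Qed.

Lemma fadingZ (c : R) (f df : R -> R) : fading f df ->
  fading (fun u => c * f u) (fun u => c * df u).
Proof.
move=> [Ef [H H0 Hf]]; split; first exact: expandableZ.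
exists (`|c| * H) => [|u u0]; first exact: mulr_ge0.
by have [f1 f2] := Hf u u0; split; rewrite normrM -mulrA ler_wpM2l.
Qed.

Lemma fadingM (f g df dg : R -> R) : fading f df -> fading g dg ->
  fading (fun u => f u * g u) (fun u => df u * g u + f u * dg u).
Proof.
move=> [Ef [H H0 Hf]] [Eg [G G0 Hg]]; split; first exact: expandableM.
exists (H * G + H * G) => [|u u0]; first by rewrite addr_ge0// mulr_ge0.
have [f1 f2] := Hf u u0; have [g1 g2] := Hg u u0.
have e0 := expR_ge0 (- (m * u)); have e1 := e_le1 u0.
have HG0 : 0 <= H * G by exact: mulr_ge0.
have key (a b : R) : `|a| <= H * expR (- (m * u)) -> `|b| <= G * expR (- (m * u)) ->
    `|a * b| <= H * G * expR (- (m * u)).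
  move=> ha hb; rewrite normrM; apply: (le_trans (ler_pM _ _ ha hb)) => //.
  rewrite mulrACA ler_wpM2l// ler_piMl//.
split; first by rewrite (le_trans (key _ _ f1 g1))// ler_wpM2r// lerDl.
by rewrite mulrDl (le_trans (ler_normD _ _))// lerD ?key.
Qed.

Lemma fading_sum (n : nat) (f df : 'I_n -> R -> R) : (forall i, fading (f i) (df i)) ->
  fading (fun u => \sum_i f i u) (fun u => \sum_i df i u).
Proof.
move=> Hf; split; first by apply: expandable_sum => i; case: (Hf i).
have /choice[G HG] : forall i, exists G, 0 <= G /\ forall u, 0 <= u ->
    `|f i u| <= G * expR (- (m * u)) /\ `|df i u| <= G * expR (- (m * u)).
  by move=> i; have [_ [G G0 HG]] := Hf i; exists G.
exists (\sum_i G i) => [|u u0]; first by apply: sumr_ge0 => i _; case: (HG i).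
rewrite mulr_suml; split; rewrite (le_trans (ler_norm_sum _ _ _))//;
  by apply: ler_sum => i _; have [_ /(_ u u0)[]] := HG i.
Qed.

Lemma fading_expR (c : R) : m <= c ->
  fading (fun u => expR (- (c * u))) (fun u => - c * expR (- (c * u))).
Proof.
move=> mc; have c0 : 0 <= c by rewrite (le_trans _ mc)// ltW.
split; first exact: expandable_decay.
exists (1 + c) => [|u u0]; first exact: addr_ge0.
have e0 := expR_ge0 (- (m * u)).
have ce : expR (- (c * u)) <= expR (- (m * u)) by rewrite ler_expR lerN2 ler_wpM2r.
rewrite normrM normrN (ger0_norm c0) ger0_norm ?expR_ge0//; split.
  by rewrite (le_trans ce)// ler_peMl// lerDl.
by rewrite (le_trans (ler_wpM2l c0 ce))// ler_wpM2r// lerDr.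
Qed.

End fading.

(** * Correctors and variance *)

Section correctors.
Variables (R : realType) (d : nat) (Q : 'M[R]_d) (p lam mu : 'I_d -> R).
Hypotheses (Qrate : is_rate_matrix Q) (Qirr : irreducible_rates Q)
  (pstat : is_stationary_distribution Q p).
Hypothesis mu_gt0 : forall i, 0 < mu i.

Local Notation D := (deviation_matrix Q p).

(** [rate j u] is the intensity of arrivals, in state [j], of jobs that survive a
further time [u]; [rate_corrector] and [flux_corrector] solve Poisson equations
whose right-hand sides are [rate] and [flux] minus their stationary means. *)
Definition rate j (u : R) : R := lam j * expR (- (mu j * u)).
Definition mean_rate (u : R) : R := \sum_k p k * rate k u.
Definition rate_corrector j (u : R) : R := \sum_i D j i * rate i u.
Definition flux j (u : R) : R := (rate j u - mean_rate u) * rate_corrector j u.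
Definition mean_flux (u : R) : R := \sum_j p j * flux j u.
Definition flux_corrector j (u : R) : R := - \sum_i D j i * flux i u.

Lemma poisson_rate_corrector j u :
  \sum_k Q j k * rate_corrector k u = mean_rate u - rate j u.
Proof.
under eq_bigr do rewrite /rate_corrector mulr_sumr.
rewrite exchange_big/=.
transitivity (\sum_i (p i - (j == i)%:R) * rate i u).
  apply: eq_bigr => i _; rewrite -(deviation_poisson Qrate Qirr pstat j i) mulr_suml.
  by apply: eq_bigr => k _; rewrite mulrA.
under eq_bigr do rewrite mulrBl; rewrite sumrB; congr (_ - _).
rewrite (bigD1 j)//= eqxx mul1r big1 ?addr0// => i ij.
by rewrite eq_sym (negbTE ij) mul0r.
Qed.

Lemma poisson_flux_corrector j u :
  \sum_k Q j k * flux_corrector k u = flux j u - mean_flux u.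
Proof.
under eq_bigr do rewrite /flux_corrector mulrN mulr_sumr.
rewrite sumrN exchange_big/= -[RHS]opprB; congr (- _).
transitivity (\sum_i (p i - (j == i)%:R) * flux i u).
  apply: eq_bigr => i _; rewrite -(deviation_poisson Qrate Qirr pstat j i) mulr_suml.
  by apply: eq_bigr => k _; rewrite mulrA.
under eq_bigr do rewrite mulrBl; rewrite sumrB; congr (_ - _).
rewrite (bigD1 j)//= eqxx mul1r big1 ?addr0// => i ij.
by rewrite eq_sym (negbTE ij) mul0r.
Qed.

Lemma mean_rate_corrector u : \sum_j p j * rate_corrector j u = 0.
Proof.
under eq_bigr do rewrite /rate_corrector mulr_sumr.
rewrite exchange_big/= big1// => i _.
under eq_bigr do rewrite mulrA.
by rewrite -mulr_suml (stationary_deviation Qrate Qirr pstat) mul0r.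
Qed.

(** The symmetrised deviation matrix pairs each rate with its corrector; centring the rate
changes nothing, because the corrector has mean zero. *)
Lemma sum_Dbar_rate u :
  \sum_j \sum_k rate j u * rate k u * Dbar Q p j k = 2 * mean_flux u.
Proof.
have E : \sum_j p j * rate j u * rate_corrector j u = mean_flux u.
  transitivity (mean_flux u + mean_rate u * \sum_j p j * rate_corrector j u).
    rewrite /mean_flux mulr_sumr -big_split/=; apply: eq_bigr => j _.
    by rewrite /flux; ring.
  by rewrite mean_rate_corrector mulr0 addr0.
rewrite -E mulr_natl mulr2n.
transitivity (\sum_j \sum_k p j * rate j u * (D j k * rate k u) +
   \sum_j \sum_k p k * rate k u * (D k j * rate j u)).
  rewrite -big_split; apply: eq_bigr => j _ /=; rewrite -big_split/=.
  by apply: eq_bigr => k _; rewrite [Dbar _ _ _ _]mxE; ring.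
rewrite [X in _ + X]exchange_big/=.
by congr (_ + _); apply: eq_bigr => j _; rewrite /rate_corrector mulr_sumr.
Qed.

Lemma expandable_rho_at : expandable (rho_at p lam mu) mean_rate.
Proof.
apply: (@eq_expandable _ (fun u => \sum_k (p k * (lam k / mu k) +
    - (p k * (lam k / mu k)) * expR (- (mu k * u)))) _
  (fun u => \sum_k (0 + - (p k * (lam k / mu k)) * (- mu k * expR (- (mu k * u)))))).
- by move=> u; apply: eq_bigr => k _; ring.
- by move=> u; apply: eq_bigr => k _; rewrite /rate; field; rewrite gt_eqF.
- apply: expandable_sum => k; apply: expandableD; first exact: expandable_cst.
  by apply: expandableZ; apply: expandable_decay; exact: ltW.
Qed.

(** Differentiate the exponentials and apply [sum_Dbar_rate]. *)
Lemma expandable_V_at : expandable (fun u => \sum_j \sum_k V_at Q p lam mu u j k)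
  (fun u => 2 * mean_flux u).
Proof.
pose c j k := lam j * lam k * Dbar Q p j k / (mu j + mu k).
apply: (@eq_expandable _ (fun u => \sum_j \sum_k (c j k +
    - c j k * expR (- ((mu j + mu k) * u)))) _
  (fun u => \sum_j \sum_k (0 + - c j k * (- (mu j + mu k) * expR (- ((mu j + mu k) * u)))))).
- move=> u; apply: eq_bigr => j _; apply: eq_bigr => k _.
  by rewrite [V_at _ _ _ _ _ _ _]mxE -/(c j k); ring.
- move=> u; rewrite -sum_Dbar_rate; apply: eq_bigr => j _; apply: eq_bigr => k _.
  have -> : expR (- ((mu j + mu k) * u)) = expR (- (mu j * u)) * expR (- (mu k * u)).
    by rewrite -expRD; congr expR; ring.
  by rewrite /rate /c; field; rewrite gt_eqF// addr_gt0.
- apply: expandable_sum => j; apply: expandable_sum => k.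
  apply: expandableD; first exact: expandable_cst.
  by apply: expandableZ; apply: expandable_decay; rewrite addr_ge0// ltW.
Qed.

Variable m : R.
Hypotheses (m0 : 0 < m) (m_mu : forall i, m <= mu i).

Definition drate j (u : R) : R := lam j * (- mu j * expR (- (mu j * u))).

Lemma fading_rate j : fading m (rate j) (drate j).
Proof. by apply: fadingZ; exact: fading_expR. Qed.

Lemma fading_mean_rate : fading m mean_rate (fun u => \sum_k p k * drate k u).
Proof. by apply: fading_sum => k; apply: fadingZ; exact: fading_rate. Qed.

Lemma fading_rate_corrector j :
  fading m (rate_corrector j) (fun u => \sum_i D j i * drate i u).
Proof. by apply: fading_sum => k; apply: fadingZ; exact: fading_rate. Qed.

Definition dflux j u : R := (drate j u + -1 * \sum_k p k * drate k u) * rate_corrector j u +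
  (rate j u + -1 * mean_rate u) * \sum_i D j i * drate i u.

Lemma fading_flux j : fading m (flux j) (dflux j).
Proof.
have := fadingM m0 (fadingD (fading_rate j) (fadingZ (-1) fading_mean_rate)) (fading_rate_corrector j).
rewrite (_ : (fun u => _) = flux j)//; apply/funext => u.
by rewrite /flux mulN1r.
Qed.

Lemma fading_mean_flux : fading m mean_flux (fun u => \sum_k p k * dflux k u).
Proof. by apply: fading_sum => k; apply: fadingZ; exact: fading_flux. Qed.

Definition dflux_corrector j u : R := -1 * \sum_i D j i * dflux i u.

Lemma fading_flux_corrector j : fading m (flux_corrector j) (dflux_corrector j).
Proof.
have := @fadingZ _ m (-1) _ _ (fading_sum (fun i => fadingZ (D j i) (fading_flux i))).
rewrite (_ : (fun u => -1 * \sum_i D j i * flux i u) = flux_corrector j)//.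
by apply/funext => u; rewrite mulN1r.
Qed.

End correctors.

(** * The perturbed exponential and the Fourier estimate *)

Section trigonometric_bounds.
Variable R : realType.
Implicit Types x : R.

Lemma norm_sin_le x : `|sin x| <= `|x|.
Proof.
have [c [_ _]] := MVT_between 0 x (@is_derive_sin R).
by rewrite sin0 !subr0 => ->; rewrite normrM ler_piMl// norm_cos_le1.
Qed.

Lemma norm_cos_sub1_le x : `|cos x - 1| <= `|x| ^+ 2.
Proof.
have [c [_]] := MVT_between 0 x (@is_derive_cos R).
rewrite cos0 !subr0 => cx ->; rewrite normrM normrN expr2 ler_wpM2r//.
exact: le_trans (norm_sin_le c) cx.
Qed.

Lemma norm_sub_sin_le x : `|x - sin x| <= `|x| ^+ 3.
Proof.
have H y : is_derive y (1 : R) (fun y => y - sin y) (1 - cos y) by exact: is_deriveB.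
have [c [_]] := MVT_between 0 x H.
rewrite sin0 !subr0 => cx ->; rewrite normrM exprSr ler_wpM2r// -normrN opprB.
by rewrite (le_trans (norm_cos_sub1_le c))// ler_pXn2r// nnegrE.
Qed.

Lemma norm_cos_taylor2_le x : `|x ^+ 2 / 2 + cos x - 1| <= `|x| ^+ 4.
Proof.
have H y : is_derive y (1 : R) (fun y => y ^+ 2 / 2 + cos y) (y - sin y).
  by apply: is_derive_eq; rewrite /GRing.scale/= mulr0; lra.
have [c [_]] := MVT_between 0 x H.
rewrite expr0n mul0r add0r cos0 !subr0 => cx ->; rewrite normrM exprSr ler_wpM2r//.
by rewrite (le_trans (norm_sub_sin_le c))// ler_pXn2r// nnegrE.
Qed.

End trigonometric_bounds.

(** The generator applied to the corrected exponential
[E ((1 + K) cos w - A h sin w)], [w] being [kappa x + phi]: the Poisson equations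
cancel every term of order [n de] and [c1], the decay of [E] cancels the
Gaussian drift, and what is left is small. Here [a], [b] stand for
[cos (kappa x)], [sin (kappa x)], and [C0], [S0] for [cos phi], [sin phi]. *)
Lemma generator_identity (R : realType) (th de n r E a b C0 S0 c s g gb h dh k1 dk1 mf : R) :
  r != 0 ->
  let kap := th * de in let A := kap * n / r in
  let c1 := n ^+ 2 * de ^+ 2 / r in let c2 := n * de ^+ 2 in
  let k := th ^+ 2 * (c1 * k1 - c2 / 2 * h) in
  let dk := th ^+ 2 * (c1 * dk1 - c2 / 2 * dh) in
  let K := k / r in let dK := dk / r in
  let dphi := kap * n * gb in
  let e := th ^+ 2 / 2 * (c1 * (2 * mf) + c2 * gb) in
  let dE := - (E * e) in
  let P1 := E * ((1 + K) * C0 - A * (h * S0)) in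
  let P2 := E * (- (1 + K) * S0 - A * (h * C0)) in
  let dP1 := dE * ((1 + K) * C0 - A * (h * S0)) +
    E * (dK * C0 - (1 + K) * (S0 * dphi) - A * (dh * S0 + h * (C0 * dphi))) in
  let dP2 := dE * (- (1 + K) * S0 - A * (h * C0)) +
    E * (- dK * S0 - (1 + K) * (C0 * dphi) - A * (dh * C0 - h * (S0 * dphi))) in
  let cw := a * C0 - b * S0 in let sw := b * C0 + a * S0 in
  let QF := E * (th ^+ 2 / r * (c1 * ((g - gb) * h - mf) - c2 / 2 * (gb - g)) * cw
     - A * (gb - g) * sw) in
  - (dP1 * a + dP2 * b) + r * QF
   + n * g * ((P1 * (a * c - b * s) + P2 * (b * c + a * s)) - (P1 * a + P2 * b)) =
  E * (sw * (n * (kap - s) * g + A * dh + (n * kap / r) * k * gb - A * (n * (c - 1)) * h * g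
             - (n * s / r) * k * g - e * A * h)
     + cw * (e * k * r^-1 - dk * r^-1 + A * (n * (kap - s)) * h * g
             + (n * (c - 1)) * k * g * r^-1 + (n * (kap ^+ 2 / 2 + c - 1)) * g)).
Proof.
move=> r0; cbv zeta; field; exact: r0.
Qed.

(** Each of the eleven monomials carries one small factor [p1], [dl] or [ir] and one factor
decaying like [ev]; the other factors are bounded by powers of [Z]. *)
Lemma remainder_bound (R : realType) (Z ev dl p1 ir x1 A x2 x3 x4 x5 sw cw e k dk g gb h dh : R) :
  1 <= Z -> 0 <= ev <= 1 -> 0 <= dl <= 1 -> 0 <= p1 -> 0 <= ir ->
  `|sw| <= 1 -> `|cw| <= 1 ->
  `|x1| <= Z * dl -> `|A| <= Z * p1 -> `|x2| <= Z * p1 -> `|x3| <= Z -> `|x4| <= Z * p1 ->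
  `|x5| <= Z * dl -> `|e| <= Z -> `|k| <= Z * ev -> `|dk| <= Z * ev ->
  `|g| <= Z * ev -> `|gb| <= Z * ev -> `|h| <= Z * ev -> `|dh| <= Z * ev ->
  `|sw * (x1 * g + A * dh + x2 * k * gb - A * x3 * h * g - x4 * k * g - e * A * h)
     + cw * (e * k * ir - dk * ir + A * x1 * h * g + x3 * k * g * ir + x5 * g)|
  <= 11 * Z ^+ 4 * (p1 + dl + ir) * ev.
Proof.
move=> Z1 /andP[ev0 ev1] /andP[dl0 dl1] p10 ir0 hsw hcw hx1 hA hx2 hx3 hx4 hx5 he hk hdk hg hgb hh hdh.
have Z0 : 0 <= Z by rewrite (le_trans _ Z1).
have weak (y z : R) : `|y| <= Z * z -> 0 <= z <= 1 -> `|y| <= Z.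
  by move=> H /andP[z0 z1]; rewrite (le_trans H)// ler_piMr.
have ev01 : 0 <= ev <= 1 by rewrite ev0.
have dl01 : 0 <= dl <= 1 by rewrite dl0.
have hk' := weak _ _ hk ev01; have hg' := weak _ _ hg ev01.
have hh' := weak _ _ hh ev01; have hx1' := weak _ _ hx1 dl01.
have M2 (y z B C : R) : `|y| <= B -> `|z| <= C -> `|y * z| <= B * C.
  by move=> hy hz; rewrite normrM ler_pM.
pose B := Z ^+ 4; have B1 : Z ^+ 2 <= B by rewrite /B ler_weXn2l.
have B2 : Z ^+ 3 <= B by rewrite /B ler_weXn2l.
have B3 : Z <= B by rewrite /B -{1}(expr1 Z) ler_weXn2l.
have B0 : 0 <= B by rewrite exprn_ge0.
have fin (y C x : R) : `|y| <= C * (x * ev) -> 0 <= x -> C <= B -> `|y| <= B * (x * ev).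
  by move=> H x0 CB; rewrite (le_trans H)// ler_wpM2r// mulr_ge0.
have t1 : `|x1 * g| <= B * (dl * ev).
  apply: (fin _ (Z ^+ 2)) => //; apply: (le_trans (M2 _ _ _ _ hx1 hg)).
  by rewrite le_eqVlt; apply/predU1P; left; ring.
have t2 : `|A * dh| <= B * (p1 * ev).
  apply: (fin _ (Z ^+ 2)) => //; apply: (le_trans (M2 _ _ _ _ hA hdh)).
  by rewrite le_eqVlt; apply/predU1P; left; ring.
have t3 : `|x2 * k * gb| <= B * (p1 * ev).
  apply: (fin _ (Z ^+ 3)) => //; apply: (le_trans (M2 _ _ _ _ (M2 _ _ _ _ hx2 hk') hgb)).
  by rewrite le_eqVlt; apply/predU1P; left; ring.
have t4 : `|A * x3 * h * g| <= B * (p1 * ev).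
  apply: (fin _ (Z ^+ 4)) => //.
  apply: (le_trans (M2 _ _ _ _ (M2 _ _ _ _ (M2 _ _ _ _ hA hx3) hh') hg)).
  by rewrite le_eqVlt; apply/predU1P; left; ring.
have t5 : `|x4 * k * g| <= B * (p1 * ev).
  apply: (fin _ (Z ^+ 3)) => //; apply: (le_trans (M2 _ _ _ _ (M2 _ _ _ _ hx4 hk') hg)).
  by rewrite le_eqVlt; apply/predU1P; left; ring.
have t6 : `|e * A * h| <= B * (p1 * ev).
  apply: (fin _ (Z ^+ 3)) => //; apply: (le_trans (M2 _ _ _ _ (M2 _ _ _ _ he hA) hh)).
  by rewrite le_eqVlt; apply/predU1P; left; ring.
have nir : `|ir| <= ir by rewrite ger0_norm.
have t7 : `|e * k * ir| <= B * (ir * ev).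
  apply: (fin _ (Z ^+ 2)) => //; apply: (le_trans (M2 _ _ _ _ (M2 _ _ _ _ he hk) nir)).
  by rewrite le_eqVlt; apply/predU1P; left; ring.
have t8 : `|dk * ir| <= B * (ir * ev).
  apply: (fin _ Z) => //; apply: (le_trans (M2 _ _ _ _ hdk nir)).
  by rewrite le_eqVlt; apply/predU1P; left; ring.
have t9 : `|A * x1 * h * g| <= B * (p1 * ev).
  apply: (fin _ (Z ^+ 4)) => //.
  apply: (le_trans (M2 _ _ _ _ (M2 _ _ _ _ (M2 _ _ _ _ hA hx1') hh') hg)).
  by rewrite le_eqVlt; apply/predU1P; left; ring.
have t10 : `|x3 * k * g * ir| <= B * (ir * ev).
  apply: (fin _ (Z ^+ 3)) => //.
  apply: (le_trans (M2 _ _ _ _ (M2 _ _ _ _ (M2 _ _ _ _ hx3 hk') hg) nir)).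
  by rewrite le_eqVlt; apply/predU1P; left; ring.
have t11 : `|x5 * g| <= B * (dl * ev).
  apply: (fin _ (Z ^+ 2)) => //; apply: (le_trans (M2 _ _ _ _ hx5 hg)).
  by rewrite le_eqVlt; apply/predU1P; left; ring.
have nD (y z C D : R) : `|y| <= C -> `|z| <= D -> `|y + z| <= C + D.
  by move=> ? ?; rewrite (le_trans (ler_normD _ _))// lerD.
have nB (y z C D : R) : `|y| <= C -> `|z| <= D -> `|y - z| <= C + D.
  by move=> ? ?; rewrite (le_trans (ler_normB _ _))// lerD.
have s1 := nB _ _ _ _ (nB _ _ _ _ (nB _ _ _ _ (nD _ _ _ _ (nD _ _ _ _ t1 t2) t3) t4) t5) t6.
have s2 := nD _ _ _ _ (nD _ _ _ _ (nD _ _ _ _ (nB _ _ _ _ t7 t8) t9) t10) t11.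
have := nD _ _ _ _ (M2 _ _ _ _ hsw s1) (M2 _ _ _ _ hcw s2).
move=> /le_trans; apply; rewrite -/B.
have q1 : 0 <= B * (p1 * ev) by rewrite !mulr_ge0.
have q2 : 0 <= B * (dl * ev) by rewrite !mulr_ge0.
have q3 : 0 <= B * (ir * ev) by rewrite !mulr_ge0.
move: q1 q2 q3; rewrite !mulrDr !mulrDl.
clearbody B; lra.
Qed.

Lemma finite_lower_bound (R : realType) (d : nat) (f : 'I_d -> R) : (forall i, 0 < f i) ->
  exists2 m : R, 0 < m & forall i, m <= f i.
Proof.
elim: d f => [|d IH] f f0; first by exists 1 => // -[].
have [m m0 Hm] := IH (fun i => f (lift ord0 i)) (fun i => f0 _).
exists (Num.min (f ord0) m); first by rewrite lt_min f0 m0.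
move=> i; case: (unliftP ord0 i) => [j ->|->]; first by rewrite ge_min Hm orbT.
by rewrite ge_min lexx.
Qed.

Lemma finite_upper_bound (R : realType) (d : nat) (Pr : 'I_d -> R -> Prop) :
  (forall i x y, x <= y -> Pr i x -> Pr i y) -> (forall i, exists2 x, 0 <= x & Pr i x) ->
  exists2 x : R, 0 <= x & forall i, Pr i x.
Proof.
move=> mono; elim: d Pr mono => [|d IH] Pr mono ex; first by exists 0 => // -[].
have [x x0 Hx] := IH (fun i => Pr (lift ord0 i)) (fun i => mono _) (fun i => ex _).
have [y y0 Hy] := ex ord0.
exists (x + y); first exact: addr_ge0.
move=> i; case: (unliftP ord0 i) => [j ->|->]; first by apply: mono (Hx j); rewrite lerDl.
by apply: mono Hy; rewrite lerDr.
Qed.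

Section charfun_estimate.
Variables (R : realType) (d : nat) (Q : 'M[R]_d) (p lam mu : 'I_d -> R).
Hypotheses (Qrate : is_rate_matrix Q) (Qirr : irreducible_rates Q)
  (pstat : is_stationary_distribution Q p).
Hypotheses (lam_ge0 : forall i, 0 <= lam i) (mu_gt0 : forall i, 0 < mu i).

Local Notation rate := (rate lam mu).
Local Notation mean_rate := (mean_rate p lam mu).
Local Notation rate_corrector := (rate_corrector Q p lam mu).
Local Notation mean_flux := (mean_flux Q p lam mu).
Local Notation flux_corrector := (flux_corrector Q p lam mu).
Local Notation dflux_corrector := (dflux_corrector Q p lam mu).
Local Notation drate := (drate lam mu).
Local Notation drate_corrector := (fun j u => \sum_i deviation_matrix Q p j i * drate i u).
Local Notation rho_at := (rho_at p lam mu).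
Let Vsum u := \sum_j \sum_k V_at Q p lam mu u j k.

Let correctors_bounded (m : R) : 0 < m -> (forall i, m <= mu i) ->
  exists2 H : R, 0 <= H & forall j u, 0 <= u -> let ev := expR (- (m * u)) in
  [/\ `|rate j u| <= H * ev, `|mean_rate u| <= H * ev, `|mean_flux u| <= H * ev &
   [/\ `|rate_corrector j u| <= H * ev, `|drate_corrector j u| <= H * ev,
       `|flux_corrector j u| <= H * ev & `|dflux_corrector j u| <= H * ev]].
Proof.
move=> m0 m_mu; apply: finite_upper_bound => [j x y xy H u u0 ev|j].
  have := H u u0; rewrite -/ev => -[h1 h2 h3 [h4 h5 h6 h7]].
  have w z : `|z| <= x * ev -> `|z| <= y * ev.
    by move=> Hz; rewrite (le_trans Hz)// ler_wpM2r// expR_ge0.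
  by split; [exact: w|exact: w|exact: w|split; exact: w].
have [_ [H1 H10 B1]] := fading_rate lam m0 m_mu j.
have [_ [H2 H20 B2]] := fading_mean_rate p lam m0 m_mu.
have [_ [H3 H30 B3]] := fading_mean_flux Q p lam m0 m_mu.
have [_ [H4 H40 B4]] := fading_rate_corrector Q p lam m0 m_mu j.
have [_ [H5 H50 B5]] := fading_flux_corrector Q p lam m0 m_mu j.
exists (H1 + H2 + H3 + H4 + H5) => [|u u0 ev]; first by rewrite !addr_ge0.
have e0 : 0 <= ev by exact: expR_ge0.
have [a1 _] := B1 u u0; have [a2 _] := B2 u u0; have [a3 _] := B3 u u0.
have [a4 a4'] := B4 u u0; have [a5 a5'] := B5 u u0.
have w x z : x <= H1 + H2 + H3 + H4 + H5 -> `|z| <= x * ev ->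
    `|z| <= (H1 + H2 + H3 + H4 + H5) * ev.
  by move=> xH Hz; rewrite (le_trans Hz)// ler_wpM2r.
have w1 : H1 <= H1 + H2 + H3 + H4 + H5 by lra.
have w2 : H2 <= H1 + H2 + H3 + H4 + H5 by lra.
have w3 : H3 <= H1 + H2 + H3 + H4 + H5 by lra.
have w4 : H4 <= H1 + H2 + H3 + H4 + H5 by lra.
have w5 : H5 <= H1 + H2 + H3 + H4 + H5 by lra.
split; [exact: w a1|exact: w a2|exact: w a3|].
by split; [exact: w a4|exact: w a4'|exact: w a5|exact: w a5'].
Qed.

Let Vsum_ub : exists2 B : R, 0 <= B & forall u, 0 <= u -> `|Vsum u| <= B /\ `|rho_at u| <= B.
Proof.
have [M1 M10 H1] := @expandable_V_at R d Q p lam mu Qrate Qirr pstat mu_gt0.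
have [M2 M20 H2] := @expandable_rho_at R d p lam mu mu_gt0.
exists (M1 + M2) => [|u u0]; first exact: addr_ge0.
have [a1 _ _] := H1 u u u0 u0; have [a2 _ _] := H2 u u u0 u0.
by split; [rewrite (le_trans a1)// lerDl|rewrite (le_trans a2)// lerDr].
Qed.

Section test_function.
Variables (th de n r c0 t : R).
Hypotheses (r0 : 0 < r).

Let kap := th * de.
Let A := kap * n / r.
Let c1 := n ^+ 2 * de ^+ 2 / r.
Let c2 := n * de ^+ 2.
Let E u := expR (- (th ^+ 2 / 2 * (c1 * Vsum u + c2 * rho_at u))).
Let k j u := th ^+ 2 * (c1 * flux_corrector j u - c2 / 2 * rate_corrector j u).
Let dk j u := th ^+ 2 * (c1 * dflux_corrector j u - c2 / 2 * drate_corrector j u).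
Let phi u := c0 - kap * n * (rho_at t - rho_at u).
Let dphi u := kap * n * mean_rate u.
Let e u := th ^+ 2 / 2 * (c1 * (2 * mean_flux u) + c2 * mean_rate u).
Let P1 j u := E u * ((1 + k j u / r) * cos (phi u) - A * (rate_corrector j u * sin (phi u))).
Let P2 j u := E u * (- (1 + k j u / r) * sin (phi u) - A * (rate_corrector j u * cos (phi u))).
Let dP1 j u := - (E u * e u) * ((1 + k j u / r) * cos (phi u) - A * (rate_corrector j u * sin (phi u))) +
  E u * (dk j u / r * cos (phi u) - (1 + k j u / r) * (sin (phi u) * dphi u)
    - A * (drate_corrector j u * sin (phi u) + rate_corrector j u * (cos (phi u) * dphi u))).
Let dP2 j u := - (E u * e u) * (- (1 + k j u / r) * sin (phi u) - A * (rate_corrector j u * cos (phi u))) +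
  E u * (- (dk j u / r) * sin (phi u) - (1 + k j u / r) * (cos (phi u) * dphi u)
    - A * (drate_corrector j u * cos (phi u) - rate_corrector j u * (sin (phi u) * dphi u))).

(** The perturbed exponential
[E(u) ((1 + k_j(u) / r) cos w - A h_j(u) sin w)], with [u = t - s] and
[w = kap (x - n (rho_at t - rho_at u)) + c0], split along [cos (kap x)] and
[sin (kap x)]. *)
Definition test_function (s : R) (j : 'I_d) (x : nat) : R :=
  P1 j (t - s) * cos (kap * x%:R) + P2 j (t - s) * sin (kap * x%:R).
Definition dtest_function (s : R) (j : 'I_d) (x : nat) : R :=
  - (dP1 j (t - s) * cos (kap * x%:R) + dP2 j (t - s) * sin (kap * x%:R)).

Let test_functionE s j x : let w := kap * x%:R + phi (t - s) in
  test_function s j x =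
  E (t - s) * ((1 + k j (t - s) / r) * cos w - A * rate_corrector j (t - s) * sin w).
Proof.
rewrite /test_function /P1 /P2 /= (cosD (kap * x%:R) (phi (t - s))) (sinD (kap * x%:R) (phi (t - s))).
ring.
Qed.

Let expandable_E : expandable E (fun u => - (E u * e u)).
Proof.
have H := expandable_expR (expandableZ (- (th ^+ 2 / 2)) (expandableD
  (expandableZ c1 (@expandable_V_at R d Q p lam mu Qrate Qirr pstat mu_gt0))
  (expandableZ c2 (@expandable_rho_at R d p lam mu mu_gt0)))).
apply: eq_expandable H => u; first by rewrite /E mulNr.
by rewrite /E /e mulNr; ring.
Qed.

Let expandable_phi : expandable phi dphi.
Proof.
have H := expandableD (expandable_cst (c0 - kap * n * rho_at t))
  (expandableZ (kap * n) (@expandable_rho_at R d p lam mu mu_gt0)).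
by apply: eq_expandable H => u; rewrite /phi /dphi; ring.
Qed.

Let expandable_P (m : R) : 0 < m -> (forall i, m <= mu i) -> forall j,
  expandable (P1 j) (dP1 j) /\ expandable (P2 j) (dP2 j).
Proof.
move=> m0 m_mu j.
have Hh := (fading_rate_corrector Q p lam m0 m_mu j).1.
have Hk1 := (fading_flux_corrector Q p lam m0 m_mu j).1.
have Hk : expandable (fun u => 1 + k j u / r) (fun u => dk j u / r).
  have H := expandableD (expandable_cst 1) (expandableZ (th ^+ 2 / r)
    (expandableD (expandableZ c1 Hk1) (expandableZ (- (c2 / 2)) Hh))).
  by apply: eq_expandable H => u; rewrite /k /dk; ring.
have Hc := expandable_cos expandable_phi; have Hs := expandable_sin expandable_phi.
split.
  have H := expandableM expandable_E (expandableD (expandableM Hk Hc)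
    (expandableZ (- A) (expandableM Hh Hs))).
  by apply: eq_expandable H => u; rewrite /P1 /dP1; ring.
have H := expandableM expandable_E (expandableD (expandableZ (-1) (expandableM Hk Hs))
  (expandableZ (- A) (expandableM Hh Hc))).
by apply: eq_expandable H => u; rewrite /P2 /dP2; ring.
Qed.

Lemma test_function_expansion : exists2 M : R, 0 <= M &
  [/\ forall s j x, 0 <= s <= t -> `|test_function s j x| <= M,
      forall s j x, 0 <= s <= t -> `|dtest_function s j x| <= M &
      forall s h j x, 0 <= s -> 0 <= h -> s + h <= t ->
       `|test_function (s + h) j x - test_function s j x - h * dtest_function s j x|
         <= M * h ^+ 2].
Proof.
have [m m0 m_mu] := finite_lower_bound mu_gt0.
have [||M M0 HM] := @finite_upper_bound R d (fun j M => forall u v, 0 <= u -> 0 <= v ->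
   [/\ `|P1 j u| <= M, `|dP1 j u| <= M, `|P1 j v - P1 j u - (v - u) * dP1 j u| <= M * (v - u) ^+ 2 &
   [/\ `|P2 j u| <= M, `|dP2 j u| <= M & `|P2 j v - P2 j u - (v - u) * dP2 j u| <= M * (v - u) ^+ 2]]).
- move=> j x y xy H u v u0 v0; have [a1 a2 a3 [a4 a5 a6]] := H u v u0 v0.
  have w z : `|z| <= x * (v - u) ^+ 2 -> `|z| <= y * (v - u) ^+ 2.
    by move=> Hz; rewrite (le_trans Hz)// ler_wpM2r// sqr_ge0.
  split; [exact: le_trans xy|exact: le_trans xy|exact: w|].
  by split; [exact: le_trans xy|exact: le_trans xy|exact: w].
- move=> j; have [[M1 M10 H1] [M2 M20 H2]] := expandable_P m0 m_mu j.
  exists (M1 + M2) => [|u v u0 v0]; first exact: addr_ge0.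
  have [a1 a2 a3] := H1 u v u0 v0; have [b1 b2 b3] := H2 u v u0 v0.
  have M12 : M1 <= M1 + M2 by rewrite lerDl.
  have M21 : M2 <= M1 + M2 by rewrite lerDr.
  split; [exact: le_trans M12|exact: le_trans M12| |].
    by rewrite (le_trans a3)// ler_wpM2r// sqr_ge0.
  split; [exact: le_trans M21|exact: le_trans M21|].
  by rewrite (le_trans b3)// ler_wpM2r// sqr_ge0.
have two (a b B x : R) : `|a| <= B -> `|b| <= B -> `|a * cos x + b * sin x| <= 2 * B.
  move=> ha hb; rewrite (le_trans (ler_normD _ _))// !normrM (_ : 2 * B = B * 1 + B * 1); last by ring.
  by rewrite lerD// ler_pM// ?norm_cos_le1 ?norm_sin_le1.
exists (2 * M); first exact: mulr_ge0.
split=> [s j x /andP[s0 st]|s j x /andP[s0 st]|s h j x s0 h0 sht].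
- have u0 : 0 <= t - s by rewrite subr_ge0.
  by have [a1 _ _ [a2 _ _]] := HM j _ _ u0 u0; apply: two.
- have u0 : 0 <= t - s by rewrite subr_ge0.
  by have [_ a1 _ [_ a2 _]] := HM j _ _ u0 u0; rewrite normrN; apply: two.
- have u0 : 0 <= t - s by rewrite subr_ge0 (le_trans _ sht)// lerDl.
  have v0 : 0 <= t - (s + h) by rewrite subr_ge0.
  have [_ _ a1 [_ _ a2]] := HM j _ _ u0 v0.
  have E1 : t - (s + h) - (t - s) = - h by ring.
  rewrite E1 sqrrN in a1 a2.
  rewrite -mulrA; apply: le_trans (two _ _ _ (kap * x%:R) a1 a2).
  by rewrite le_eqVlt; apply/predU1P; left; congr `|_|;
    rewrite /test_function /dtest_function; ring.
Qed.

Variables (m H B : R).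
Hypotheses (m0 : 0 < m) (H0 : 0 <= H) (B0 : 0 <= B).
Hypothesis bound_correctors : forall j u, 0 <= u -> let ev := expR (- (m * u)) in
  [/\ `|rate j u| <= H * ev, `|mean_rate u| <= H * ev, `|mean_flux u| <= H * ev &
   [/\ `|rate_corrector j u| <= H * ev, `|drate_corrector j u| <= H * ev,
       `|flux_corrector j u| <= H * ev & `|dflux_corrector j u| <= H * ev]].
Hypothesis bound_variance : forall u, 0 <= u -> `|Vsum u| <= B /\ `|rho_at u| <= B.
Hypotheses (n0 : 0 < n) (de0 : 0 < de) (de1 : de <= 1) (c11 : c1 <= 1) (c21 : c2 <= 1).

Let T := 1 + `|th|.
Let Z := T ^+ 4 * (1 + 2 * H).
Let p1 := n * de / r.

Let T1 : 1 <= T. Proof. by rewrite lerDl. Qed.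
Let T0 : 0 <= T. Proof. exact: le_trans T1. Qed.
Let thT : `|th| <= T. Proof. by rewrite lerDr. Qed.
Let c10 : 0 <= c1.
Proof. by apply: divr_ge0; [apply: mulr_ge0; exact: sqr_ge0|exact: ltW]. Qed.
Let c20 : 0 <= c2. Proof. by apply: mulr_ge0; [exact: ltW|exact: sqr_ge0]. Qed.
Let p10 : 0 <= p1.
Proof. by apply: divr_ge0; [apply: mulr_ge0; exact: ltW|exact: ltW]. Qed.

Let T4Z : T ^+ 4 <= Z.
Proof. by rewrite /Z ler_peMr ?exprn_ge0// lerDl mulr_ge0. Qed.
Let Z1 : 1 <= Z. Proof. by apply: le_trans T4Z; exact: exprn_ege1. Qed.
Let Z0 : 0 <= Z. Proof. exact: le_trans Z1. Qed.
Let TZ a : (a <= 4)%N -> T ^+ a <= Z.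
Proof. by move=> a4; apply: le_trans T4Z; rewrite ler_weXn2l. Qed.
Let HZ : H <= Z.
Proof.
rewrite /Z; apply: (@le_trans _ _ (1 * (1 + 2 * H))); first by (have := H0; lra).
by rewrite ler_wpM2r ?exprn_ege1// addr_ge0// mulr_ge0.
Qed.
Let T2HZ : T ^+ 2 * (2 * H) <= Z.
Proof.
rewrite /Z; apply: ler_pM; rewrite ?exprn_ge0 ?mulr_ge0// ?ler_weXn2l//.
by rewrite lerDr.
Qed.

Let th2T : `|th ^+ 2| <= T ^+ 2.
Proof. by rewrite normrX ler_pXn2r// nnegrE. Qed.

Let bM (a b X Y : R) : `|a| <= X -> `|b| <= Y -> `|a * b| <= X * Y.
Proof. by move=> ? ?; rewrite normrM ler_pM. Qed.
Let nc1 : `|c1| <= 1. Proof. by rewrite ger0_norm. Qed.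
Let nc2 : `|c2| <= 1. Proof. by rewrite ger0_norm. Qed.
Let nhalf : `|2^-1 : R| <= 2^-1. Proof. by rewrite ger0_norm. Qed.

Let E_le u : 0 <= u -> `|E u| <= expR (T ^+ 2 * B).
Proof.
move=> u0; have [b1 b2] := bound_variance u0.
rewrite ger0_norm ?expR_ge0// ler_expR; apply: (le_trans (ler_norm _)).
rewrite normrN (_ : T ^+ 2 * B = T ^+ 2 * 2^-1 * (1 * B + 1 * B)); last by field.
apply: bM; first exact: bM.
by apply: (le_trans (ler_normD _ _)); apply: lerD; exact: bM.
Qed.

Let ev_le1 u : 0 <= u -> 0 <= expR (- (m * u)) <= 1.
Proof. by move=> u0; rewrite expR_ge0 -expR0 ler_expR oppr_le0 mulr_ge0// ltW. Qed.

Let k_le j u : 0 <= u -> `|k j u| <= Z * expR (- (m * u)).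
Proof.
move=> u0; have [_ _ _ [b1 _ b2 _]] := bound_correctors j u0.
have /andP[ev0 _] := ev_le1 u0; set ev := expR _ in b1 b2 ev0 *.
apply: (@le_trans _ _ (T ^+ 2 * (2 * H) * ev)); last by rewrite ler_wpM2r.
rewrite -mulrA; apply: bM => //; rewrite (_ : 2 * H * ev = 1 * (H * ev) + 1 * (H * ev)); last by ring.
apply: (le_trans (ler_normB _ _)); apply: lerD; apply: bM => //.
by rewrite normrM (le_trans (ler_pM _ _ nc2 nhalf))//; lra.
Qed.

Let dk_le j u : 0 <= u -> `|dk j u| <= Z * expR (- (m * u)).
Proof.
move=> u0; have [_ _ _ [_ b1 _ b2]] := bound_correctors j u0.
have /andP[ev0 _] := ev_le1 u0; set ev := expR _ in b1 b2 ev0 *.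
apply: (@le_trans _ _ (T ^+ 2 * (2 * H) * ev)); last by rewrite ler_wpM2r.
rewrite -mulrA; apply: bM => //; rewrite (_ : 2 * H * ev = 1 * (H * ev) + 1 * (H * ev)); last by ring.
apply: (le_trans (ler_normB _ _)); apply: lerD; apply: bM => //.
by rewrite normrM (le_trans (ler_pM _ _ nc2 nhalf))//; lra.
Qed.

Let e_le (j : 'I_d) (u : R) : 0 <= u -> `|e u| <= Z.
Proof.
move=> u0; have [_ b1 b2 _] := bound_correctors j u0.
have /andP[ev0 ev1] := ev_le1 u0; set ev := expR _ in b1 b2 ev0 ev1.
have Hev : H * ev <= H by rewrite ler_piMr.
have b1' := le_trans b1 Hev; have b2' := le_trans b2 Hev.
apply: le_trans T2HZ.
apply: (@le_trans _ _ (T ^+ 2 * 2^-1 * (1 * (2 * H) + 1 * H))).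
  apply: bM; first exact: bM.
  apply: (le_trans (ler_normD _ _)); apply: lerD; apply: bM => //.
  by apply: bM => //; rewrite ger0_norm.
rewrite -mulrA ler_wpM2l ?exprn_ge0//; have := H0; lra.
Qed.

Let kapE : `|kap| = `|th| * de. Proof. by rewrite normrM (gtr0_norm de0). Qed.

Let A_le : `|A| <= Z * p1.
Proof.
rewrite /A /p1 /kap (_ : th * de * n / r = th * (n * de / r)); last by ring.
rewrite normrM (ger0_norm p10) ler_wpM2r//.
by apply: le_trans (TZ (isT : (1 <= 4)%N)); rewrite expr1.
Qed.

Let n_kap_le : `|n * kap / r| <= Z * p1.
Proof. by rewrite (_ : n * kap / r = A); [exact: A_le|rewrite /A; ring]. Qed.

Let n_sub_sin_le : `|n * (kap - sin kap)| <= Z * de.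
Proof.
rewrite normrM (gtr0_norm n0).
apply: (le_trans (ler_wpM2l (ltW n0) (norm_sub_sin_le kap))).
rewrite kapE (_ : n * (`|th| * de) ^+ 3 = `|th| ^+ 3 * (c2 * de)); last by rewrite /c2; ring.
apply: ler_pM; rewrite ?exprn_ge0//.
- by rewrite mulr_ge0// ltW.
- by apply: le_trans (TZ (isT : (3 <= 4)%N)); rewrite ler_pXn2r// nnegrE.
- by rewrite ler_piMl// ltW.
Qed.

Let n_cos_sub1_le : `|n * (cos kap - 1)| <= Z.
Proof.
rewrite normrM (gtr0_norm n0).
apply: (le_trans (ler_wpM2l (ltW n0) (norm_cos_sub1_le kap))).
rewrite kapE (_ : n * (`|th| * de) ^+ 2 = `|th| ^+ 2 * c2); last by rewrite /c2; ring.
apply: (@le_trans _ _ (`|th| ^+ 2)); first by rewrite ler_piMr// exprn_ge0.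
by apply: le_trans (TZ (isT : (2 <= 4)%N)); rewrite ler_pXn2r// nnegrE.
Qed.

Let n_cos_taylor2_le : `|n * (kap ^+ 2 / 2 + cos kap - 1)| <= Z * de.
Proof.
rewrite normrM (gtr0_norm n0).
apply: (le_trans (ler_wpM2l (ltW n0) (norm_cos_taylor2_le kap))).
rewrite kapE (_ : n * (`|th| * de) ^+ 4 = `|th| ^+ 4 * (c2 * de * de)); last by rewrite /c2; ring.
apply: ler_pM; rewrite ?exprn_ge0//.
- by rewrite !mulr_ge0// ltW.
- by apply: le_trans T4Z; rewrite ler_pXn2r// nnegrE.
- rewrite ler_piMl ?(ltW de0)//; apply: (@le_trans _ _ (1 * 1)); last by rewrite mulr1.
  by apply: ler_pM => //; exact: ltW.
Qed.

Let n_sin_le : `|n * sin kap / r| <= Z * p1.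
Proof.
apply: le_trans n_kap_le.
rewrite (normrM (n * sin kap)) (normrM (n * kap)) (normrM n (sin kap)) (normrM n kap).
by rewrite ler_wpM2r// ler_wpM2l// norm_sin_le.
Qed.

(** The Poisson equations bring the action of [r Q] into the form of
[generator_identity], whose remainder is then estimated. *)
Lemma test_function_generator s j x : 0 <= s <= t ->
  `|dtest_function s j x + \sum_l (r *: Q) j l * test_function s l x +
    n * lam j * expR (- (mu j * (t - s))) * (test_function s j x.+1 - test_function s j x)|
  <= expR (T ^+ 2 * B) * (11 * Z ^+ 4 * (p1 + de + r^-1)) * expR (- (m * (t - s))).
Proof.
move=> /andP[s0 st]; set u := t - s; have u0 : 0 <= u by rewrite subr_ge0.
have Qrow : \sum_l Q j l = 0 by case: Qrate.
have QF : \sum_l (r *: Q) j l * test_function s l x =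
   r * (E u * (th ^+ 2 / r * (c1 * ((rate j u - mean_rate u) * rate_corrector j u - mean_flux u)
      - c2 / 2 * (mean_rate u - rate j u)) * (cos (kap * x%:R) * cos (phi u) - sin (kap * x%:R) * sin (phi u))
     - A * (mean_rate u - rate j u) * (sin (kap * x%:R) * cos (phi u) + cos (kap * x%:R) * sin (phi u)))).
  rewrite -cosD -sinD; set cw := cos (_ + _); set sw := sin (_ + _).
  rewrite -(@poisson_rate_corrector R d Q p lam mu Qrate Qirr pstat j u).
  have := @poisson_flux_corrector R d Q p lam mu Qrate Qirr pstat j u; rewrite /flux => <-.
  transitivity (\sum_l (r * E u * cw * Q j l
     + E u * cw * th ^+ 2 * c1 * (Q j l * flux_corrector l u)
     - E u * cw * th ^+ 2 * c2 / 2 * (Q j l * rate_corrector l u)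
     - r * E u * A * sw * (Q j l * rate_corrector l u))).
    apply: eq_bigr => l _; rewrite mxE test_functionE -/u -/cw -/sw /k; field.
    exact: lt0r_neq0.
  rewrite 2!sumrB big_split/= -!mulr_sumr Qrow; field.
  exact: lt0r_neq0.
rewrite QF /dtest_function /test_function -/u.
have -> : kap * x.+1%:R = kap * x%:R + kap by rewrite -natr1 mulrDr mulr1.
rewrite (cosD (kap * x%:R) kap) (sinD (kap * x%:R) kap).
set a := cos (kap * x%:R); set b := sin (kap * x%:R).
have -> : n * lam j * expR (- (mu j * u)) = n * rate j u by rewrite /rate mulrA.
have := @generator_identity R th de n r (E u) a b (cos (phi u)) (sin (phi u)) (cos kap) (sin kap)
  (rate j u) (mean_rate u) (rate_corrector j u) (drate_corrector j u) (flux_corrector j u)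
  (dflux_corrector j u) (mean_flux u) (lt0r_neq0 r0).
cbv zeta => G.
rewrite [X in `|X|](_ : _ = E u * (sin (kap * x%:R + phi u) * (n * (kap - sin kap) * rate j u + A * drate_corrector j u
    + (n * kap / r) * k j u * mean_rate u - A * (n * (cos kap - 1)) * rate_corrector j u * rate j u
    - (n * sin kap / r) * k j u * rate j u - e u * A * rate_corrector j u)
   + cos (kap * x%:R + phi u) * (e u * k j u * r^-1 - dk j u * r^-1
    + A * (n * (kap - sin kap)) * rate_corrector j u * rate j u
    + (n * (cos kap - 1)) * k j u * rate j u * r^-1 + (n * (kap ^+ 2 / 2 + cos kap - 1)) * rate j u))); last first.
  by rewrite (sinD _ (phi u)) (cosD _ (phi u)); exact: G.
have [b1 b2 b3 [b4 b5 b6 b7]] := bound_correctors j u0.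
have evp := ev_le1 u0; have /andP[ev0 ev1] := evp.
rewrite -[leRHS]mulrA; apply: bM; first exact: E_le.
have w z : `|z| <= H * expR (- (m * u)) -> `|z| <= Z * expR (- (m * u)).
  by move=> Hz; rewrite (le_trans Hz)// ler_wpM2r.
apply: remainder_bound => //; try exact: w.
- by rewrite (ltW de0).
- by rewrite invr_ge0 ltW.
- exact: norm_sin_le1.
- exact: norm_cos_le1.
- exact: e_le j _ u0.
- exact: k_le.
- exact: dk_le.
Qed.

(** Both correctors are small, so expectations of the test function are expectations of
its leading term up to the error. *)
Lemma test_function_near s j x : 0 <= s <= t ->
  `|test_function s j x - E (t - s) * cos (kap * x%:R + phi (t - s))|
  <= expR (T ^+ 2 * B) * (Z * (1 + H) * (p1 + de + r^-1)).
Proof.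
move=> /andP[s0 st]; set u := t - s; have u0 : 0 <= u by rewrite subr_ge0.
have [_ _ _ [b4 _ _ _]] := bound_correctors j u0.
have /andP[ev0 ev1] := ev_le1 u0.
have ir0 : 0 <= r^-1 by rewrite invr_ge0 ltW.
rewrite test_functionE -/u; set w := kap * x%:R + phi u.
rewrite (_ : _ - _ = E u * (k j u * r^-1 * cos w - A * rate_corrector j u * sin w)); last by ring.
apply: bM; first exact: E_le.
have kb : `|k j u| <= Z by rewrite (le_trans (k_le j u0))// ler_piMr.
have hb : `|rate_corrector j u| <= H by rewrite (le_trans b4)// ler_piMr.
apply: (le_trans (ler_normB _ _)).
have t1 : `|k j u * r^-1 * cos w| <= Z * r^-1 * 1.
  by apply: bM; [apply: bM => //; rewrite ger0_norm|exact: norm_cos_le1].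
have t2 : `|A * rate_corrector j u * sin w| <= Z * p1 * H * 1.
  by apply: bM; [exact: bM A_le hb|exact: norm_sin_le1].
apply: (le_trans (lerD t1 t2)).
have q1 : 0 <= Z * r^-1 by exact: mulr_ge0.
have q2 : 0 <= Z * p1 by exact: mulr_ge0.
have q3 : 0 <= Z * de by apply: mulr_ge0 => //; exact: ltW.
have := mulr_ge0 H0 q1; have := mulr_ge0 H0 q2; have := mulr_ge0 H0 q3.
move: q1 q2 q3; lra.
Qed.

End test_function.

(** The estimate behind the theorem, uniform in [t], in the initial law, and in the
three scales [n] (arrivals), [r] (background) and [de] (space). *)
Lemma charfun_estimate (th : R) : exists2 K : R, 0 <= K & forall n r de : R,
  0 < n -> 0 < r -> 0 < de -> de <= 1 ->
  n ^+ 2 * de ^+ 2 / r <= 1 -> n * de ^+ 2 <= 1 ->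
  forall (dO : measure_display) (Om : measurableType dO) (P : probability Om R)
    (J : R -> Om -> 'I_d) (T : 'I_d -> nat -> Om -> \bar R) (S : 'I_d -> nat -> Om -> R),
  is_modelII P (r *: Q) (fun i => n * lam i) mu J T S ->
  forall t c0, 0 <= t ->
  `|\int[P]_w cos (th * de * ((number_in_system J T S t w)%:R - n * rho_at t) + c0) -
    cos c0 * expR (- (th ^+ 2 / 2 * (n ^+ 2 * de ^+ 2 / r * Vsum t + n * de ^+ 2 * rho_at t)))|
  <= K * (n * de / r + de + r^-1).
Proof.
have [m m0 m_mu] := finite_lower_bound mu_gt0.
have [H H0 HH] := correctors_bounded m0 m_mu.
have [B B0 HB] := Vsum_ub.
set Z := (1 + `|th|) ^+ 4 * (1 + 2 * H); set Em := expR ((1 + `|th|) ^+ 2 * B).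
have Em0 : 0 <= Em by exact: expR_ge0.
have Z0 : 0 <= Z by rewrite mulr_ge0 ?exprn_ge0// addr_ge0// mulr_ge0.
pose K1 := Em * (11 * Z ^+ 4) / m; pose K2 := Em * (Z * (1 + H)).
have K10 : 0 <= K1 by rewrite divr_ge0 ?(ltW m0)// mulr_ge0// mulr_ge0// exprn_ge0.
have K20 : 0 <= K2 by rewrite mulr_ge0// mulr_ge0// addr_ge0.
exists (K1 + K2 + K2) => [|n r de n0 r0 de0 de1 c11 c21 dO Om P J T S model t c0 t0].
  by rewrite !addr_ge0.
set err := n * de / r + de + r^-1.
have err0 : 0 <= err.
  by rewrite /err !addr_ge0 ?divr_ge0 ?invr_ge0 ?mulr_ge0 ?(ltW n0) ?(ltW de0) ?(ltW r0).
have tt : 0 <= t <= t by rewrite t0 lexx.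
have ot : 0 <= (0 : R) <= t by rewrite lexx.
pose F := test_function th de n r c0 t; pose dF := dtest_function th de n r c0 t.
have [M M0 [bF bdF eF]] := test_function_expansion th de n r c0 t.
have gF := @test_function_generator th de n r c0 t r0 m H B m0 H0 HH HB n0 de0 de1 c11 c21.
have nl0 i : 0 <= n * lam i by rewrite mulr_ge0// ltW.
have A0 : 0 <= Em * (11 * Z ^+ 4 * err).
  by rewrite mulr_ge0// mulr_ge0// mulr_ge0// exprn_ge0.
have D := @dynkin_inequality _ _ _ _ P (r *: Q) (fun i => n * lam i) mu J T S model mu_gt0 nl0
  t F dF M (Em * (11 * Z ^+ 4 * err)) m t0 M0 A0 m0 bF bdF eF (fun s j x st => gF _ j x st).
have {}D : `|\int[P]_w F t (J t w) (number_in_system J T S t w) - \int[P]_w F 0 (J 0 w) 0%N|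
    <= K1 * err.
  by apply: (le_trans D); rewrite le_eqVlt; apply/predU1P; left; rewrite /K1;
    field; rewrite gt_eqF.
have nearF := @test_function_near th de n r c0 t r0 m H B m0 H0 HH HB n0 de0 c11 c21.
set Et := expR (- (th ^+ 2 / 2 * _)).
set g := fun w : Om => cos (th * de * ((number_in_system J T S t w)%:R - n * rho_at t) + c0).
have mX (f : 'I_d -> nat -> R) := measurable_fun_state_number model mu_gt0 f t0.
have mg : measurable_fun setT g.
  exact: (mX (fun _ x => cos (th * de * (x%:R - n * rho_at t) + c0))).
have Ig : P.-integrable setT (EFin \o g).
  by apply: (integrable_bounded P mg (M := 1)) => w; exact: norm_cos_le1.
have IFt : P.-integrable setT (EFin \o (fun w => F t (J t w) (number_in_system J T S t w))).
  exact: (integrable_bounded P (mX (F t)) (fun w => bF _ _ _ tt)).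
have V0 : Vsum 0 = 0.
  rewrite /Vsum big1// => j _; rewrite big1// => k _.
  by rewrite mxE mulr0 oppr0 expR0 subrr mulr0.
have rho0 : rho_at 0 = 0.
  by rewrite /Defs.rho_at big1// => k _; rewrite mulr0 oppr0 expR0 subrr mulr0.
(* At [s = t] the leading term is [cos (th de (M(t) - n rho(t)) + c0)], and at [s = 0] it is
   the deterministic [cos c0 E(t)]. *)
have N1 : `|\int[P]_w g w - \int[P]_w F t (J t w) (number_in_system J T S t w)| <= K2 * err.
  rewrite -RintegralB//; apply: norm_expectation_le.
    by apply: measurable_funB => //; exact: mX.
  move=> w; rewrite distrC /K2 -mulrA.
  have := nearF t (J t w) (number_in_system J T S t w) tt.
  rewrite subrr -/(Vsum 0) V0 rho0 !mulr0 addr0 mulr0 oppr0 expR0 mul1r.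
  apply: le_trans; rewrite le_eqVlt; apply/orP; left; apply/eqP.
  by congr `|_ - _|; rewrite /g; congr cos; ring.
have mJ0 (f : 'I_d -> R) : measurable_fun setT (fun w => f (J 0 w)).
  exact: (measurable_fun_state_number model mu_gt0 (fun j _ => f j) (lexx 0)).
have IF0 : P.-integrable setT (EFin \o (fun w => F 0 (J 0 w) 0%N)).
  exact: (integrable_bounded P (mJ0 (fun j => F 0 j 0%N)) (fun w => bF _ _ _ ot)).
have N2 : `|\int[P]_w F 0 (J 0 w) 0%N - cos c0 * Et| <= K2 * err.
  have -> : cos c0 * Et = \int[P]_w (cos c0 * Et).
    by rewrite Rintegral_cst// [X in fine X]probability_setT mulr1.
  rewrite -RintegralB//; last first.
    by apply: (integrable_bounded P (M := `|cos c0 * Et|)).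
  apply: norm_expectation_le.
    by apply: measurable_funB => //; exact: (mJ0 (fun j => F 0 j 0%N)).
  move=> w; rewrite /K2 -mulrA.
  have := nearF 0 (J 0 w) 0%N ot.
  rewrite subr0 -/(Vsum t) subrr !mulr0 subr0 add0r mulrC; exact.
rewrite (_ : _ - _ = (\int[P]_w g w - \int[P]_w F t (J t w) (number_in_system J T S t w)) +
  (\int[P]_w F t (J t w) (number_in_system J T S t w) - \int[P]_w F 0 (J 0 w) 0%N) +
  (\int[P]_w F 0 (J 0 w) 0%N - cos c0 * Et)); last by ring.
apply: (le_trans (ler_normD _ _)); rewrite (mulrDl _ K2) (addrC K1) (mulrDl K2).
by apply: lerD => //; apply: (le_trans (ler_normD _ _)); apply: lerD.
Qed.

End charfun_estimate.

(** * Fourier transform of the normal law *)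

Section gaussian_fourier.
Variable R : realType.
Local Notation leb := (@lebesgue_measure R).

Lemma Rintegral_derive_eq0 (F f : R -> R) : continuous f ->
  (forall y, is_derive y (1 : R) F (f y)) -> leb.-integrable setT (EFin \o f) ->
  F n%:R @[n --> \oo] --> (0 : R) -> F (- n%:R) @[n --> \oo] --> (0 : R) ->
  \int[leb]_y f y = 0.
Proof.
move=> cf dF If F0 F0'.
pose D (n : nat) : set R := `[- n%:R, n%:R]%classic.
have mf : measurable_fun setT f by exact: continuous_measurable_fun.
have [|||||_ _ cvgI] := @dominated_convergence _ _ _ leb setT measurableT
  (fun n => EFin \o (f \_ (D n))) (EFin \o f) (fun y => (`|f y|)%:E).
- move=> n; apply/measurable_EFinP; apply/(measurable_restrictT _ _).1; first exact: measurable_itv.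
  exact: measurable_funTS.
- exact/measurable_EFinP.
- apply: aeW => y _; apply: cvg_EFin; first by near=> n.
  apply: cvg_near_cst; near=> n => /=.
  rewrite patchE ifT//; rewrite inE /D/= in_itv/= -ler_norml.
  by near: n; exact: nbhs_infty_ger.
- have /integrableP[_ Ifoo] := If; apply/integrableP; split.
    by apply/measurable_EFinP; exact: measurableT_comp.
  by under eq_integral do rewrite abse_EFin normr_id.
- by apply: aeW => y n _ /=; rewrite lee_fin patchE; case: ifP => // _; rewrite normr0.
have cF : continuous F.
  move=> y; apply: differentiable_continuous; apply/derivable1_diffP; by case: (dF y).
have E n : (\int[leb]_y (EFin \o (f \_ (D n.+1))) y = (F n.+1%:R - F (- n.+1%:R))%:E)%E.
  rewrite -restrict_EFin -integral_mkcond EFinB.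
  apply: continuous_FTC2 => //.
  - by rewrite (@lt_trans _ _ 0)// ?oppr_lt0 ltr0n.
  - exact: continuous_subspaceT.
  - split; first by move=> y _; case: (dF y).
    + exact: cvg_at_right_filter (cF _).
    + exact: cvg_at_left_filter (cF _).
  - by move=> y _; rewrite derive1E; apply: derive_val.
have : (fun n => (F n.+1%:R - F (- n.+1%:R))%:E) @ \oo --> (\int[leb]_y (EFin \o f) y)%E.
  rewrite (_ : (fun n => _) = (fun n => \int[leb]_y (EFin \o (f \_ (D n.+1))) y)%E); last first.
    by apply/funext => n; rewrite E.
  by rewrite (cvg_shiftS (fun n => \int[leb]_y (EFin \o (f \_ (D n))) y)%E).
have H : (fun n => (F n.+1%:R - F (- n.+1%:R))%:E) @ \oo --> 0%:E.
  by apply: cvg_EFin; [near=> n|rewrite -[X in _ --> X](subrr (0:R)); apply: cvgB; [rewrite (cvg_shiftS (fun n => F n%:R))|rewrite (cvg_shiftS (fun n => F (- n%:R)))]].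
by move/(cvg_unique _ H); rewrite /Rintegral => /(_ _) <-.
Unshelve. all: by end_near. Qed.

Variable s : R.
Hypothesis s_gt0 : 0 < s.

Let s_neq0 : s != 0. Proof. by rewrite gt_eqF. Qed.

Lemma Rintegral_normal_prob (m : R) (f : R -> R) (M : R) : measurable_fun setT f ->
  (forall y, `|f y| <= M) ->
  \int[normal_prob m s]_y f y = \int[leb]_y (f y * normal_pdf m s y).
Proof.
move=> mf fM; have If := @integrable_bounded R _ _ (normal_prob m s) f M mf fM.
have dom := normal_prob_dominates m s.
rewrite /Rintegral; congr fine.
rewrite -(Radon_Nikodym_change_of_variables dom measurableT If).
have Ip := @integrable_normal_pdf R m s.
have IRN : leb.-integrable setT
    (Radon_Nikodym (charge_of_finite_measure (normal_prob m s)) leb).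
  exact: Radon_Nikodym_integrable.
apply: ae_eq_integral => //.
- apply: emeasurable_funM; first exact/measurable_EFinP.
  exact: measurable_int IRN.
- under eq_fun do rewrite EFinM; apply: emeasurable_funM; first exact/measurable_EFinP.
  exact: measurable_int Ip.
under [X in ae_eq _ _ _ X]eq_fun do rewrite EFinM.
apply: ae_eqe_mul2l.
apply: integral_ae_eq => //; first exact: measurable_int Ip.
by move=> E _ mE; rewrite -Radon_Nikodym_integral.
Qed.

Local Notation pdf := (normal_pdf 0 s).

Let pdfE y : pdf y = normal_peak s * expR (- (y ^+ 2 / (s ^+ 2 *+ 2))).
Proof. by rewrite normal_pdfE// /normal_fun subr0 mulNr. Qed.

Lemma is_derive_normal_pdf y : is_derive y (1 : R) pdf (- (y / s ^+ 2) * pdf y).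
Proof.
have -> : pdf = (fun y => normal_peak s * expR (- (y ^+ 2 / (s ^+ 2 *+ 2)))).
  by apply/funext => x; rewrite pdfE.
have H : is_derive y (1 : R) (fun y => - (y ^+ 2 / (s ^+ 2 *+ 2))) (- (y / s ^+ 2)).
  rewrite (_ : (fun y => _) = (fun y => (- (s ^+ 2 *+ 2)^-1) *: (y ^+ 2 : R))); last first.
    by apply/funext => x; rewrite /GRing.scale/= mulNr mulrC.
  apply: is_derive_eq; rewrite /GRing.scale/= ?mulr1; field.
  by rewrite s_neq0.
have := @is_derive1_comp _ expR (fun y => - (y ^+ 2 / (s ^+ 2 *+ 2))) y _ _ (is_derive_expR _) H.
move/(is_deriveZ (normal_peak s)) => H2; apply: (@is_derive_eq _ _ _ _ _ _ _ _ H2).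
by rewrite /GRing.scale/=; ring.
Qed.

Let normal_pdf_decay y : `|y| * pdf y <= s * normal_peak s.
Proof.
rewrite pdfE mulrCA mulrC ler_wpM2r ?normal_peak_ge0//.
rewrite expRN ler_pdivrMr ?expR_gt0//.
have h : 1 + y ^+ 2 / (s ^+ 2 *+ 2) <= expR (y ^+ 2 / (s ^+ 2 *+ 2)) by exact: expR_ge1Dx.
apply: (@le_trans _ _ (s * (1 + y ^+ 2 / (s ^+ 2 *+ 2)))); last by rewrite ler_wpM2l// ltW.
have -> : s * (1 + y ^+ 2 / (s ^+ 2 *+ 2)) = `|y| + ((s - `|y|) ^+ 2 + s ^+ 2) / (2 * s).
  by rewrite -(real_normK (num_real y)); field.
by rewrite lerDl divr_ge0 ?addr_ge0 ?sqr_ge0// mulr_ge0// ltW.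
Qed.

(** Linear growth is absorbed by doubling the standard deviation. This serves both to
differentiate under the integral and to estimate tails. *)
Lemma normal_pdf_decay_wide y :
  `|y| * pdf y <= s * normal_peak s / normal_peak (2 * s) * normal_pdf 0 (2 * s) y.
Proof.
have s20 : 2 * s != 0 by rewrite mulf_neq0.
have p0 := normal_peak_gt0 s20.
rewrite [in leRHS]normal_pdfE// /normal_fun subr0 pdfE.
rewrite [leRHS]mulrA divfK ?gt_eqF// mulrCA mulrC [leRHS]mulrAC ler_wpM2r ?normal_peak_ge0//.
set a := y ^+ 2 / (s ^+ 2 *+ 2).
have -> : - y ^+ 2 / ((2 * s) ^+ 2 *+ 2) = 3 / 4 * a - a by rewrite /a; field.
rewrite expRD mulrA ler_wpM2r ?expR_ge0//.
have h : 1 + 3 / 4 * a <= expR (3 / 4 * a) by exact: expR_ge1Dx.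
apply: (@le_trans _ _ (s * (1 + 3 / 4 * a))); last by rewrite ler_wpM2l// ltW.
have -> : s * (1 + 3 / 4 * a) = `|y| + ((2 * s - `|y|) ^+ 2 + `|y| ^+ 2 / 2) / (4 * s).
  by rewrite /a -(real_normK (num_real y)); field.
have h1 : 0 <= `|y| ^+ 2 / 2 by rewrite divr_ge0 ?sqr_ge0.
by rewrite lerDl divr_ge0 ?addr_ge0 ?sqr_ge0// mulr_ge0// ltW.
Qed.

Let integrable_decay (f : R -> R) (A B : R) : measurable_fun setT f ->
  (forall y, `|f y| <= A * pdf y + B * (`|y| * pdf y)) -> 0 <= B ->
  leb.-integrable setT (EFin \o f).
Proof.
move=> mf fle B0; set K := s * normal_peak s / normal_peak (2 * s).
apply: (@le_integrable _ _ _ leb setT measurableT _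
  (EFin \o (fun y => A * pdf y + B * (K * normal_pdf 0 (2 * s) y)))).
- exact/measurable_EFinP.
- move=> y _; rewrite /= lee_fin (le_trans (fle y))// (le_trans _ (ler_norm _))// lerD2l.
  by rewrite ler_wpM2l//; exact: normal_pdf_decay_wide.
- rewrite (_ : _ \o _ = (fun y => (A * pdf y)%:E + (B * (K * normal_pdf 0 (2 * s) y))%:E)%E)//.
  apply: integrableD => //; apply: integrable_mulr => //; first exact: integrable_normal_pdf.
  by apply: integrable_mulr => //; exact: integrable_normal_pdf.
Qed.

Let continuous_pdf : continuous pdf.
Proof. exact: continuous_normal_pdf. Qed.

Let continuous_affine (th c : R) : continuous (fun y : R => th * y + c).
Proof. by move=> y; apply: cvgD; [apply: cvgMr; exact: cvg_id|exact: cvg_cst]. Qed.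

Let is_derive_affine (th c y : R) : is_derive y (1 : R) (fun y => th * y + c) th.
Proof.
rewrite (_ : (fun y => _) = (fun y => th *: (y : R) + c)); last by [].
by apply: is_derive_eq; rewrite addr0 /GRing.scale/= mulr1.
Qed.

(** Integrating the derivative of [sin (th * y + c) * pdf y], which vanishes at
infinity. *)
Let normal_parts (th c : R) :
  \int[leb]_y (y * sin (th * y + c) * pdf y) =
  s ^+ 2 * th * \int[leb]_y (cos (th * y + c) * pdf y).
Proof.
have cc : continuous (fun y => cos (th * y + c)).
  by move=> y; apply: continuous_comp; [exact: continuous_affine|exact: continuous_cos].
have cs : continuous (fun y => sin (th * y + c)).
  by move=> y; apply: continuous_comp; [exact: continuous_affine|exact: continuous_sin].
have c1 : continuous (fun y => cos (th * y + c) * pdf y).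
  by move=> y; apply: cvgM; [exact: cc|exact: continuous_pdf].
have c2 : continuous (fun y : R => y * sin (th * y + c) * pdf y).
  by move=> y; apply: cvgM; [apply: cvgM; [exact: cvg_id|exact: cs]|exact: continuous_pdf].
have pdf0 y : 0 <= pdf y by exact: normal_pdf_ge0.
have I1 : leb.-integrable setT (EFin \o (fun y => cos (th * y + c) * pdf y)).
  apply: (@integrable_decay _ 1 0) => //; first exact: continuous_measurable_fun.
  move=> y; rewrite mul0r addr0 normrM (ger0_norm (pdf0 _)) ler_wpM2r//.
  exact: norm_cos_le1.
have I2 : leb.-integrable setT (EFin \o (fun y : R => y * sin (th * y + c) * pdf y)).
  apply: (@integrable_decay _ 0 1) => //; first exact: continuous_measurable_fun.
  move=> y; rewrite mul0r add0r mul1r !normrM (ger0_norm (pdf0 _)) ler_wpM2r//.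
  by rewrite -[leRHS]mulr1 ler_wpM2l// ler_norml sin_geN1 sin_le1.
pose F y := sin (th * y + c) * pdf y.
have Fn (f : nat -> R) : (forall n, `|f n| = n%:R) -> F (f n) @[n --> \oo] --> (0 : R).
  move=> fn; apply: norm_cvg0; rewrite -cvg_shiftS.
  have H : s * normal_peak s * n.+1%:R^-1 @[n --> \oo] --> (0 : R).
    by rewrite -(mulr0 (s * normal_peak s)); apply: cvgMr; exact: cvg_harmonic.
  apply: (@squeeze_cvgr _ _ _ _ (cst 0) _ _ _ _ _ H); last exact: cvg_cst.
  apply: nearW => n; rewrite normr_ge0/= /F normrM (ger0_norm (pdf0 _)).
  apply: (@le_trans _ _ (pdf (f n.+1))).
    by rewrite ler_piMl// ler_norml sin_geN1 sin_le1.
  rewrite ler_pdivlMr ?ltr0n// mulrC -fn; exact: normal_pdf_decay.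
have := @Rintegral_derive_eq0 F (fun y => th * (cos (th * y + c) * pdf y) -
  (s ^+ 2)^-1 * (y * sin (th * y + c) * pdf y)).
rewrite RintegralB//; [|exact: integrable_mulr|exact: integrable_mulr].
rewrite !RintegralZl// => H.
have {}H : th * \int[leb]_y (cos (th * y + c) * pdf y) -
  (s ^+ 2)^-1 * \int[leb]_y (y * sin (th * y + c) * pdf y) = 0.
  apply: H.
  - by move=> y; apply: cvgB; apply: cvgMr; [exact: c1|exact: c2].
  - move=> y.
    have D1 : is_derive y (1 : R) (fun y => sin (th * y + c)) (th * cos (th * y + c)).
      rewrite mulrC.
      exact: (@is_derive1_comp _ sin (fun y => th * y + c) y _ _ (is_derive_sin _) (is_derive_affine _ _ _)).
    have := is_deriveM D1 (is_derive_normal_pdf y).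
    move=> D2; apply: (@is_derive_eq _ _ _ _ _ _ _ _ D2).
    by rewrite /GRing.scale/=; field.
  - rewrite (_ : _ \o _ = (fun y => (th * (cos (th * y + c) * pdf y))%:E -
      ((s ^+ 2)^-1 * (y * sin (th * y + c) * pdf y))%:E)%E)//.
    by apply: integrableB => //; exact: integrable_mulr.
  - by apply: Fn => n; rewrite ger0_norm.
  - by apply: Fn => n; rewrite normrN ger0_norm.
move/eqP : H; rewrite subr_eq0 => /eqP H; rewrite -mulrA H mulrA mulfV ?mul1r//.
by rewrite expf_neq0.
Qed.

Let measurable_cos (th c : R) : measurable_fun setT (fun y : R => cos (th * y + c)).
Proof.
apply: continuous_measurable_fun => y.
by apply: continuous_comp; [exact: continuous_affine|exact: continuous_cos].
Qed.

Let derive_normal_fourier (c th : R) :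
  is_derive th (1 : R) (fun th => \int[leb]_y (cos (th * y + c) * pdf y))
    (- (s ^+ 2 * th * \int[leb]_y (cos (th * y + c) * pdf y))).
Proof.
have pdf0 y : 0 <= pdf y by exact: normal_pdf_ge0.
pose f (a y : R) := cos (a * y + c) * pdf y.
have df a y : is_derive a (1 : R) (f ^~ y) (- (y * sin (a * y + c) * pdf y)).
  have H : is_derive a (1 : R) (fun a => a * y + c) y.
    rewrite (_ : (fun a => _) = (fun a => y * a + c)); first exact: is_derive_affine.
    by apply/funext => b; rewrite mulrC.
  have H2 := @is_derive1_comp _ cos (fun a => a * y + c) a _ _ (is_derive_cos _) H.
  rewrite (_ : f ^~ y = (fun a => pdf y *: (cos \o (fun a => a * y + c)) a)); last first.
    by apply/funext => b; rewrite /GRing.scale/= mulrC.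
  apply: (@is_derive_eq _ _ _ _ _ _ _ _ (is_deriveZ (pdf y) H2)); rewrite /GRing.scale/=; ring.
have d1f a y : partial1of2 f a y = - (y * sin (a * y + c) * pdf y).
  by rewrite partial1of2E; apply: derive_val.
have If a : leb.-integrable setT (EFin \o f a).
  apply: (@integrable_decay _ 1 0) => //.
  - by apply: measurable_funM => //; exact: measurable_normal_pdf.
  - move=> y; rewrite mul0r addr0 normrM (ger0_norm (pdf0 _)) ler_wpM2r//.
    exact: norm_cos_le1.
have IG : leb.-integrable setT (EFin \o (fun y : R => `|y| * pdf y)).
  apply: (@integrable_decay _ 0 1) => //.
  - apply: measurable_funM; last exact: measurable_normal_pdf.
    exact: normr_measurable.
  - by move=> y; rewrite mul0r add0r mul1r normrM normr_id (ger0_norm (pdf0 _)).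
have thI : `]th - 1, th + 1[%classic th by rewrite /= in_itv/=; apply/andP; split; lra.
have G0 y : 0 <= `|y| * pdf y by rewrite mulr_ge0.
have dfI a y : `]th - 1, th + 1[%classic a -> setT y -> derivable (f ^~ y) a 1.
  by move=> _ _; case: (df a y).
have GI a y : `]th - 1, th + 1[%classic a -> setT y -> `|partial1of2 f a y| <= `|y| * pdf y.
  move=> _ _; rewrite d1f normrN !normrM (ger0_norm (pdf0 _)) ler_wpM2r//.
  by rewrite -[leRHS]mulr1 ler_wpM2l// ler_norml sin_geN1 sin_le1.
have := @derivable_under_integral _ _ _ leb f setT measurableT th (th - 1) (th + 1) thI
  (fun a _ => If a) dfI _ G0 IG GI.
have := @differentiation_under_integral _ _ _ leb f setT measurableT th (th - 1) (th + 1) thI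
  (fun a _ => If a) dfI _ G0 IG GI.
move=> E dI; apply: DeriveDef => //; rewrite -derive1E E.
under eq_Rintegral do rewrite /= d1f -mulN1r.
rewrite RintegralZl// ?mulN1r ?normal_parts//.
apply: le_integrable IG => //.
  apply/measurable_EFinP; apply: measurable_funM; last exact: measurable_normal_pdf.
  apply: measurable_funM => //; apply: continuous_measurable_fun => y.
  by apply: continuous_comp; [exact: continuous_affine|exact: continuous_sin].
move=> y _; rewrite /= lee_fin !normrM normr_id ler_wpM2r//.
by rewrite -[leRHS]mulr1 ler_wpM2l// ler_norml sin_geN1 sin_le1.
Qed.

(** As a function of [th] the transform [I] solves [I' = - s ^ 2 th I], by differentiation
under the integral and integration by parts. *)
Lemma gaussian_fourier (th c : R) :
  \int[normal_prob 0 s]_y cos (th * y + c) = cos c * expR (- (th ^+ 2 / 2 * s ^+ 2)).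
Proof.
rewrite (@Rintegral_normal_prob _ _ 1)//; last first.
  by move=> y; exact: norm_cos_le1.
pose I th := \int[leb]_y (cos (th * y + c) * pdf y).
pose e th : R := expR (th ^+ 2 / 2 * s ^+ 2).
have de a : is_derive a (1 : R) e (s ^+ 2 * a * e a).
  have H : is_derive a (1 : R) (fun a => a ^+ 2 / 2 * s ^+ 2) (s ^+ 2 * a).
    rewrite (_ : (fun a => _) = (fun a => (s ^+ 2 / 2) *: (a ^+ 2 : R))); last first.
      by apply/funext => b; rewrite /GRing.scale/=; ring.
    by apply: is_derive_eq; rewrite /GRing.scale/= ?mulr1; field.
  have := @is_derive1_comp _ expR (fun a => a ^+ 2 / 2 * s ^+ 2) a _ _ (is_derive_expR _) H.
  by move=> H2; apply: (@is_derive_eq _ _ _ _ _ _ _ _ H2); rewrite mulrC.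
have dIe a : is_derive a (1 : R) (fun a => I a * e a) 0.
  have := is_deriveM (derive_normal_fourier c a) (de a).
  by move=> H2; apply: (@is_derive_eq _ _ _ _ _ _ _ _ H2); rewrite /GRing.scale/= -/(I a); ring.
have := is_derive_0_is_cst th 0 dIe.
rewrite /I /e expr0n/= !mul0r expR0 mulr1 => H.
rewrite expRN -[LHS](mulfK (lt0r_neq0 (expR_gt0 (th ^+ 2 / 2 * s ^+ 2)))) H.
congr (_ / _); under eq_Rintegral do rewrite mul0r add0r.
rewrite RintegralZl//; last exact: integrable_normal_pdf.
by rewrite /Rintegral integral_normal_pdf mulr1.
Qed.

End gaussian_fourier.

(** * Levy's continuity theorem *)

Section averaging.
Variable R : realType.

Lemma Rintegral_swap (d1 d2 : measure_display) (T1 : measurableType d1)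
    (T2 : measurableType d2) (m1 : probability T1 R) (m2 : probability T2 R)
    (f : T1 * T2 -> R) (M : R) :
  measurable_fun setT f -> (forall z, `|f z| <= M) ->
  measurable_fun setT (fun x => \int[m2]_y f (x, y)) /\
  \int[m1]_x (\int[m2]_y f (x, y)) = \int[m2]_y (\int[m1]_x f (x, y)).
Proof.
move=> mf fM.
have mf1 x : measurable_fun setT (fun y => f (x, y)).
  exact: measurable_fun_pair2.
have mf2 y : measurable_fun setT (fun x => f (x, y)).
  exact: measurable_fun_pair1.
have If : (m1 \x m2)%E.-integrable setT (EFin \o f).
  exact: (@integrable_bounded _ _ _ (m1 \x m2)%E f M).
have E1 x : (\int[m2]_y (EFin \o f) (x, y) = (\int[m2]_y f (x, y))%:E)%E.
  rewrite /Rintegral fineK//; apply: integrable_fin_num => //.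
  exact: (@integrable_bounded _ _ _ m2 (fun y => f (x, y)) M).
have E2 y : (\int[m1]_x (EFin \o f) (x, y) = (\int[m1]_x f (x, y))%:E)%E.
  rewrite /Rintegral fineK//; apply: integrable_fin_num => //.
  exact: (@integrable_bounded _ _ _ m1 (fun x => f (x, y)) M).
split.
  have := measurable_fubini_F If; rewrite /fubini_F => H.
  by apply/measurable_EFinP; apply: eq_measurable_fun H => x _; rewrite E1.
have H := Fubini If; rewrite [LHS]/Rintegral [RHS]/Rintegral.
congr fine; transitivity (\int[m1]_x \int[m2]_y (EFin \o f) (x, y))%E.
  by apply: eq_integral => x _; rewrite E1.
by rewrite H; apply: eq_integral => y _; rewrite E2.
Qed.

(** Fubini and bounded convergence: if the expectations of each [f (z, .)] converge, so do
those of their average over [z]. *)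
Lemma expectation_cvg_average (dO : nat -> measure_display)
    (Om : forall n, measurableType (dO n)) (P : forall n, probability (Om n) R)
    (X : forall n, Om n -> R) (nu : probability (measurableTypeR R) R)
    (dZ : measure_display) (Z : measurableType dZ) (m : probability Z R)
    (f : Z * R -> R) (M : R) :
  (forall n, measurable_fun setT (X n)) ->
  measurable_fun setT f -> (forall z, `|f z| <= M) ->
  (forall z, \int[P n]_w f (z, X n w) @[n --> \oo] --> \int[nu]_y f (z, y)) ->
  \int[P n]_w (\int[m]_z f (z, X n w)) @[n --> \oo] --> \int[nu]_y (\int[m]_z f (z, y)).
Proof.
move=> mX mf fM cvgf.
have mfX n : measurable_fun setT (fun q : Z * Om n => f (q.1, X n q.2)).
  apply: (measurableT_comp mf); apply: measurable_fun_pair => //=.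
  exact: measurableT_comp.
have S n := @Rintegral_swap _ _ _ _ m (P n) (fun q => f (q.1, X n q.2)) M (mfX n)
  (fun _ => fM _).
have [mF <-] := @Rintegral_swap _ _ _ _ m nu f M mf fM.
rewrite (_ : (fun n => _) = (fun n => \int[m]_z \int[P n]_w f (z, X n w))); last first.
  by apply/funext => n; rewrite -(proj2 (S n)).
apply: (@bounded_cvg_Rintegral _ _ _ _ _ _ _ M) => //.
- by rewrite (le_lt_trans (probability_le1 _ _))// ltry.
- by move=> n; exact: (proj1 (S n)).
- move=> n z _; apply: (@norm_expectation_le _ _ _ (P n) (fun w => f (z, X n w)) M) => //.
  exact: (measurableT_comp (measurable_fun_pair2 z mf) (mX n)).
Qed.

End averaging.

Section smoothing.
Variables (R : realType) (s : R).
Hypothesis s_gt0 : 0 < s.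

Let normal_pdf_center y x : normal_pdf y s x = normal_pdf 0 s (x - y).
Proof. by rewrite !normal_pdfE ?gt_eqF// /normal_fun subr0. Qed.

(** The tail of the normal law, obtained by comparing its density with that of the
normal law of twice the standard deviation. *)
Lemma normal_prob_tail (eta y : R) (D : set R) : 0 < eta -> measurable D ->
  (forall x, D x -> eta <= `|x - y|) -> fine (normal_prob y s D) <= 2 * s / eta.
Proof.
move=> eta0 mD Deta.
have s20 : 2 * s != 0 by rewrite mulf_neq0// gt_eqF.
have pk : s * normal_peak s / normal_peak (2 * s) = 2 * s.
  have -> : normal_peak s = 2 * normal_peak (2 * s).
    rewrite /normal_peak (_ : (2 * s) ^+ 2 * pi *+ 2 = 2 ^+ 2 * (s ^+ 2 * pi *+ 2)); last by ring.
    by rewrite sqrtrM ?sqr_ge0// sqrtr_sqr ger0_norm// invfM mulrA mulfV ?mul1r.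
  by rewrite mulrA mulfK ?gt_eqF ?normal_peak_gt0// mulrC.
have I2 : lebesgue_measure.-integrable setT
    (EFin \o (fun x => 2 * s / eta * normal_pdf y (2 * s) x)).
  by apply: integrable_mulr => //; exact: integrable_normal_pdf.
have -> : 2 * s / eta = \int[lebesgue_measure]_x (2 * s / eta * normal_pdf y (2 * s) x).
  rewrite RintegralZl//; last exact: integrable_normal_pdf.
  by rewrite /Rintegral integral_normal_pdf mulr1.
rewrite -[leLHS]/(\int[lebesgue_measure]_(x in D) normal_pdf y s x) Rintegral_mkcond.
apply: le_Rintegral => //.
  rewrite -restrict_EFin; apply/integrable_restrict => //; rewrite setTI.
  by apply: (integrableS measurableT) => //; exact: integrable_normal_pdf.
move=> x _; rewrite patchE; case: ifPn => [/set_mem Dx|_]; last first.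
  by rewrite mulr_ge0 ?normal_pdf_ge0// divr_ge0 ?mulr_ge0// ltW.
rewrite mulrAC ler_pdivlMr// mulrC.
have -> : normal_pdf y (2 * s) x = normal_pdf 0 (2 * s) (x - y).
  by rewrite !normal_pdfE// /normal_fun subr0.
have := normal_pdf_decay_wide s_gt0 (x - y); rewrite pk (normal_pdf_center y x).
move=> H; apply: (le_trans _ H); by rewrite ler_wpM2r ?normal_pdf_ge0// Deta.
Qed.

Lemma measurable_cosR : measurable_fun setT (@cos R).
Proof. by apply: continuous_measurable_fun; exact: continuous_cos. Qed.

(** The normal density is, up to scaling, its own Fourier transform; so Gaussian kernels
are averages of the functions [cos (th y + c)]. *)
Lemma gaussian_kernel x y :
  \int[normal_prob 0 s^-1]_z cos (- z * y + z * x) = expR (- (x - y) ^+ 2 / (s ^+ 2 *+ 2)).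
Proof.
rewrite (_ : (fun z => _) = (fun z => cos ((x - y) * z + 0))); last first.
  by apply/funext => z; congr cos; ring.
rewrite gaussian_fourier ?invr_gt0// cos0 mul1r; congr expR.
by field; rewrite gt_eqF.
Qed.

(** Averaging the kernel over its centre turns it into a smoothed indicator of [`[a, b]]. *)
Lemma uniform_gaussian_kernel (a b : R) (ab : a < b) y :
  (b - a) * normal_peak s * \int[uniform_prob ab]_x expR (- (x - y) ^+ 2 / (s ^+ 2 *+ 2)) =
  fine (normal_prob y s `[a, b]).
Proof.
rewrite /Rintegral integral_uniform; last 2 first.
- by apply/measurable_EFinP; exact: measurable_normal_fun.
- by move=> x; rewrite lee_fin expR_ge0.
have Ik : lebesgue_measure.-integrable `[a, b]
    (EFin \o (fun x => expR (- (x - y) ^+ 2 / (s ^+ 2 *+ 2)))).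
  rewrite (_ : _ \o _ = EFin \o (fun x => (normal_peak s)^-1 * normal_pdf y s x)); last first.
    apply/funext => x /=; rewrite normal_pdfE ?gt_eqF//= /normal_fun mulrA mulVf ?mul1r//.
    by rewrite gt_eqF// normal_peak_gt0// gt_eqF.
  apply: (integrableS measurableT) => //.
  by apply: integrable_mulr => //; exact: integrable_normal_pdf.
rewrite fineM//; last exact: integrable_fin_num Ik.
have e z : (b - a) * normal_peak s * ((b - a)^-1 * z) = normal_peak s * z.
  by field; rewrite subr_eq0 gt_eqF.
rewrite /= e -[X in _ * X]/(\int[lebesgue_measure]_(x in `[a, b]) _) -RintegralZl//.
apply: eq_Rintegral => x _; by rewrite normal_pdfE ?gt_eqF.
Qed.

End smoothing.

Section levy.
Variables (R : realType) (dO : nat -> measure_display)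
    (Om : forall n, measurableType (dO n)) (P : forall n, probability (Om n) R)
    (X : forall n, Om n -> R) (nu : probability (measurableTypeR R) R).
Arguments X : clear implicits.
Hypothesis mX : forall n, measurable_fun setT (X n).
Hypothesis cvg_cos : forall th c : R,
  \int[P n]_w cos (th * X n w + c) @[n --> \oo] --> \int[nu]_y cos (th * y + c).

(** The smoothed indicator is an average of averages of functions [cos (th y + c)]. *)
Let cvg_smoothing (s : R) (s_gt0 : 0 < s) (a b : R) : a < b ->
  \int[P n]_w fine (normal_prob (X n w) s `[a, b]) @[n --> \oo] -->
  \int[nu]_y fine (normal_prob y s `[a, b]) /\
  measurable_fun setT (fun y => fine (normal_prob y s `[a, b])).
Proof.
move=> ab; pose k (q : R * R) := expR (- (q.1 - q.2) ^+ 2 / (s ^+ 2 *+ 2)).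
have mk : measurable_fun setT k.
  apply: measurableT_comp => //; apply: measurable_funM => //; apply: measurableT_comp => //.
  by apply: measurable_funX; apply: measurable_funB.
have kM q : `|k q| <= 1.
  rewrite ger0_norm ?expR_ge0// -expR0 ler_expR mulNr oppr_le0 divr_ge0 ?sqr_ge0//.
  by rewrite mulrn_wge0// sqr_ge0.
have c1 x : \int[P n]_w k (x, X n w) @[n --> \oo] --> \int[nu]_y k (x, y).
  pose f (q : R * R) := cos (- q.1 * q.2 + q.1 * x).
  have E y : k (x, y) = \int[normal_prob 0 s^-1]_z f (z, y) by rewrite gaussian_kernel.
  rewrite (_ : (fun n => _) = (fun n => \int[P n]_w \int[normal_prob 0 s^-1]_z f (z, X n w))).
    rewrite (_ : (fun y => _) = (fun y => \int[normal_prob 0 s^-1]_z f (z, y))); last first.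
      by apply/funext => y; rewrite E.
    have mf : measurable_fun setT f.
      have ml : measurable_fun setT (fun q : R * R => - q.1 * q.2 + q.1 * x).
        apply: measurable_funD; last exact: measurable_funM.
        by apply: measurable_funM => //; exact: measurableT_comp.
      exact: (measurableT_comp (@measurable_cosR R) ml).
    have fM z : `|f z| <= 1 by exact: norm_cos_le1.
    have cf z : \int[P n]_w f (z, X n w) @[n --> \oo] --> \int[nu]_y f (z, y).
      by have := @cvg_cos (- z) (z * x); rewrite /f /=.
    exact: (@expectation_cvg_average _ _ _ _ _ nu _ _ (normal_prob 0 s^-1) f 1 mX mf fM cf).
  by apply/funext => n; apply: eq_Rintegral => w _; rewrite E.
have c2 := @expectation_cvg_average _ _ _ _ _ nu _ _ (uniform_prob ab) k 1 mX mk kM c1.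
have [mK _] : measurable_fun setT (fun y => \int[uniform_prob ab]_x k (x, y)) /\
    \int[nu]_y (\int[uniform_prob ab]_x k (x, y)) = \int[uniform_prob ab]_x (\int[nu]_y k (x, y)).
  apply: (@Rintegral_swap _ _ _ _ _ nu (uniform_prob ab) (fun q => k (q.2, q.1)) 1) => //.
  by apply: (measurableT_comp mk); apply: measurable_fun_pair.
have KM y : `|\int[uniform_prob ab]_x k (x, y)| <= 1.
  by apply: norm_expectation_le => //; exact: measurable_fun_pair1.
have E y : fine (normal_prob y s `[a, b]) =
    (b - a) * normal_peak s * \int[uniform_prob ab]_x k (x, y).
  by rewrite -uniform_gaussian_kernel.
have En y : (fun y => fine (normal_prob y s `[a, b])) y =
    (b - a) * normal_peak s * \int[uniform_prob ab]_x k (x, y) by exact: E.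
split; last first.
  rewrite (_ : (fun y => _) = (fun y => (b - a) * normal_peak s * \int[uniform_prob ab]_x k (x, y))).
    by apply: measurable_funM.
  by apply/funext.
under eq_Rintegral do rewrite E.
rewrite RintegralZl//; last exact: (@integrable_bounded _ _ _ nu _ 1).
rewrite (_ : (fun n => _) = (fun n => (b - a) * normal_peak s *
    \int[P n]_w \int[uniform_prob ab]_x k (x, X n w))); first exact: cvgMr.
apply/funext => n; under eq_Rintegral do rewrite E.
rewrite RintegralZl//.
apply: (@integrable_bounded _ _ _ (P n) _ 1) => //; exact: (measurableT_comp mK).
Qed.

Let Rintegral_indic (d : measure_display) (T : measurableType d) (m : probability T R)
  (A : set T) : measurable A -> \int[m]_w \1_A w = fine (m A).
Proof. by move=> mA; rewrite /Rintegral integral_indic// setIT. Qed.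

Let integrable_indic_cst (d : measure_display) (T : measurableType d) (m : probability T R)
  (A : set T) (c : R) : measurable A -> m.-integrable setT (EFin \o (fun w => \1_A w + c)).
Proof.
move=> mA; apply: (@integrable_bounded _ _ _ m _ (1 + `|c|)) => //.
  exact: measurable_funD.
move=> w; rewrite (le_trans (ler_normD _ _))// lerD2r indicE.
by case: (_ \in _); rewrite ?normr1 ?normr0.
Qed.

Let Rintegral_indic_cst (d : measure_display) (T : measurableType d) (m : probability T R)
  (A : set T) (c : R) : measurable A -> \int[m]_w (\1_A w + c) = fine (m A) + c.
Proof.
move=> mA; rewrite RintegralD//.
- by rewrite Rintegral_indic// Rintegral_cst//; congr (_ + _); rewrite [X in fine X]probability_setT mulr1.
- have := @integrable_indic_cst _ _ m A 0 mA.
  by under [_ \o _]eq_fun do rewrite addr0.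
- have := @integrable_indic_cst _ _ m set0 c measurable0.
  by under [_ \o _]eq_fun do rewrite indicE in_set0 add0r.
Qed.

(** The smoothed indicator is below the indicator of a wider interval and above that
of a narrower one, up to the normal tail. *)
Let liminf_interval (a b eta e : R) : a <= b -> 0 < eta -> 0 < e ->
  \forall n \near \oo, fine (nu `[a, b]%classic) - e <=
    fine (P n (X n @^-1` `[a - 2 * eta, b + 2 * eta])).
Proof.
move=> ab eta0 e0; (* For this [s] the tail bound [2 * s / eta] is [e / 4]. *)
pose s := e / 8 * eta.
have s0 : 0 < s by rewrite mulr_gt0// divr_gt0.
have ab' : a - eta < b + eta by lra.
have [cvgS mG] := cvg_smoothing s0 ab'.
pose G y := fine (normal_prob y s `[a - eta, b + eta]).
have tau (y : R) (D : set R) : measurable D -> (forall x, D x -> eta <= `|x - y|) ->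
    fine (normal_prob y s D) <= e / 4.
  move=> mD HD; rewrite (le_trans (normal_prob_tail s0 eta0 mD HD))//.
  by rewrite /s mulrA mulfK ?gt_eqF//; lra.
have G0 y : 0 <= G y <= 1.
  rewrite fine_ge0//= -lee_fin fineK ?fin_num_measure//; exact: probability_le1.
have Gup y : G y <= \1_(`[a - 2 * eta, b + 2 * eta]) y + e / 4.
  rewrite indicE; case: (boolP (y \in _)) => [_|].
    by have /andP[_ h] := G0 y; rewrite (le_trans h)// lerDl divr_ge0// ltW.
  rewrite notin_setE/= in_itv/= => /negP; rewrite negb_and -!ltNge add0r => yout.
  apply: tau => // x; rewrite /= in_itv/= => /andP[ax xb].
  by rewrite ler_normr; case/orP: yout => h; apply/orP; [left|right]; lra.
have Glow y : \1_(`[a, b]) y + - (e / 4) <= G y.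
  rewrite indicE; have [yab|_] := boolP (y \in `[a, b]%classic); last first.
    by have /andP[h _] := G0 y; rewrite add0r (le_trans _ h)// oppr_le0 divr_ge0// ltW.
  move/set_mem : yab; rewrite /= in_itv/= => /andP[ay yb].
  have : fine (normal_prob y s (~` `[a - eta, b + eta])) <= e / 4.
    apply: tau; first exact: measurableC.
    move=> x /=; rewrite in_itv/= => /negP; rewrite negb_and -!ltNge => xout.
    by rewrite ler_normr; case/orP: xout => h; apply/orP; [right|left]; lra.
  rewrite probability_setC// fineB ?fin_num_measure//= -/(G y); lra.
have IG (dT : measure_display) (T : measurableType dT) (m : probability T R) (f : T -> R) :
    measurable_fun setT f -> m.-integrable setT (EFin \o (fun w => G (f w))).
  move=> mf; apply: (@integrable_bounded _ _ _ m _ 1); first exact: (measurableT_comp mG).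
  by move=> w; have /andP[h1 h2] := G0 (f w); rewrite ger0_norm.
have low : fine (nu `[a, b]%classic) + - (e / 4) <= \int[nu]_y G y.
  rewrite -Rintegral_indic_cst//; apply: le_Rintegral => //; first exact: integrable_indic_cst.
  exact: (IG _ _ nu id).
have up n : \int[P n]_w G (X n w) <=
    fine (P n (X n @^-1` `[a - 2 * eta, b + 2 * eta])) + e / 4.
  have mA : measurable (X n @^-1` `[a - 2 * eta, b + 2 * eta]).
    by rewrite -[X in measurable X]setTI; exact: mX.
  rewrite -Rintegral_indic_cst//; apply: le_Rintegral => //; first exact: IG.
  exact: integrable_indic_cst.
have e4 : 0 < e / 4 by rewrite divr_gt0.
move/cvgrPdist_le : cvgS => /(_ _ e4); apply: filterS => n.
rewrite -/G ler_norml => /andP[h1 h2]; have := up n; rewrite -/(G _); lra.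
Qed.

Let liminf_ray (F : nat -> R * R) (D : set R) (e eta : R) :
  (forall k, (F k).1 <= (F k).2) ->
  nondecreasing_seq (fun k => `[(F k).1, (F k).2]%classic) ->
  \bigcup_k `[(F k).1, (F k).2]%classic = D -> 0 < eta -> 0 < e ->
  forall D', measurable D' -> (forall k, `[(F k).1 - eta, (F k).2 + eta] `<=` D') ->
  \forall n \near \oo, fine (nu D) - e <= fine (P n (X n @^-1` D')).
Proof.
move=> F12 ndF FD eta0 e0 D' mD' FD'.
have e2 : 0 < e / 2 by rewrite divr_gt0.
have mD : measurable D by rewrite -FD; exact: bigcup_measurable.
have cv : (nu (`[(F k).1, (F k).2]%classic) @[k --> \oo] --> (fine (nu D))%:E)%E.
  rewrite fineK ?fin_num_measure// -FD; apply: nondecreasing_cvg_mu => //.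
  by rewrite FD.
have [_] := (fine_cvgP _ _).1 cv.
move/cvgrPdist_le => /(_ _ e2) [k _ /(_ k (leqnn _))] /=.
rewrite ler_norml => /andP[_ hk].
have eta2 : 0 < eta / 2 by rewrite divr_gt0.
apply: filterS (liminf_interval (F12 k) eta2 e2) => n.
rewrite mulrCA mulfV ?mulr1// => h.
have mp (A : set R) : measurable A -> measurable (X n @^-1` A).
  by move=> mA; rewrite -[X in measurable X]setTI; exact: mX.
have : fine (P n (X n @^-1` `[(F k).1 - eta, (F k).2 + eta])) <= fine (P n (X n @^-1` D')).
  rewrite fine_le ?fin_num_measure// ?le_measure ?inE//; try exact: mp.
  by move=> w; exact: FD'.
lra.
Qed.

(** Levy's continuity theorem for a given limit [nu] of mass one: no mass escapes,
because the lower bounds on complementary half-lines add up to one. *)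
Theorem levy_continuity : cvg_in_distribution P X nu.
Proof.
move=> x cx.
have cx' : (fun y => fine (nu [set z | z <= y])) y @[y --> x] --> fine (nu [set z | z <= x]).
  apply: fine_cvg; rewrite fineK; first exact: cx.
  by rewrite fin_num_measure// -set_itvNyc.
pose Fn y := fine (nu [set z | z <= y]).
have mle (y : R) : measurable [set z | z <= y] by rewrite -set_itvNyc.
have mge (y : R) : measurable [set z | y <= z] by rewrite -set_itvcy.
have mX' n (A : set R) : measurable A -> measurable (X n @^-1` A).
  by move=> mA; rewrite -[X in measurable X]setTI; exact: mX.
have left_ray b eta e : 0 < eta -> 0 < e ->
    \forall n \near \oo, Fn b - e <= fine (P n [set w | X n w <= b + eta]).
  move=> eta0 e0.
  apply: (@liminf_ray (fun k => (b - k%:R, b)) _ e eta _ _ _ eta0 e0 [set z | z <= b + eta]) => //.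
  - by move=> k /=; rewrite lerBlDr lerDl.
  - move=> k l kl; apply/subsetPset => y /=; rewrite !in_itv/= => /andP[ky ->]; rewrite andbT.
    by rewrite (le_trans _ ky)// lerD2l lerN2 ler_nat.
  - apply/seteqP; split => [y [k _] /=|y /= yb]; first by rewrite in_itv/= => /andP[].
    exists (Num.bound (b - y)) => //=; rewrite in_itv/= yb andbT lerBlDr -lerBlDl.
    by rewrite ltW// archi_boundP// subr_ge0.
  - by move=> k y /=; rewrite in_itv/= => /andP[].
have right_ray a eta e : 0 < eta -> 0 < e ->
    \forall n \near \oo, fine (nu [set z | a <= z]) - e <= fine (P n [set w | a - eta <= X n w]).
  move=> eta0 e0.
  apply: (@liminf_ray (fun k => (a, a + k%:R)) _ e eta _ _ _ eta0 e0 [set z | a - eta <= z]) => //.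
  - by move=> k /=; rewrite lerDl.
  - move=> k l kl; apply/subsetPset => y /=; rewrite !in_itv/= => /andP[-> ky] /=.
    by rewrite (le_trans ky)// lerD2l ler_nat.
  - apply/seteqP; split => [y [k _] /=|y /= yb]; first by rewrite in_itv/= => /andP[].
    exists (Num.bound (y - a)) => //=; rewrite in_itv/= yb/= -lerBlDl.
    by rewrite ltW// archi_boundP// subr_ge0.
  - by move=> k y /=; rewrite in_itv/= => /andP[].
rewrite -(fineK (fin_num_measure nu _ (mle x))).
apply/fine_cvgP; split.
  by apply: nearW => n; rewrite fin_num_measure//; exact: (mX' n _ (mle x)).
apply/cvgrPdist_le => e e0; have e2 : 0 < e / 2 by rewrite divr_gt0.
move/cvgrPdist_le : cx' => /(_ _ e2) /nbhs_ballP[r /= r0 Hr].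
have r4 : 0 < r / 4 by rewrite divr_gt0.
have Hr' y : `|x - y| < r -> `|Fn x - Fn y| <= e / 2 by move=> h; exact: Hr.
have F1 : `|Fn x - Fn (x - r / 4)| <= e / 2 by apply: Hr'; rewrite ltr_norml; lra.
have F2 : `|Fn x - Fn (x + r / 2)| <= e / 2 by apply: Hr'; rewrite ltr_norml; lra.
near=> n.
have h1 : Fn (x - r / 4) - e / 2 <= fine (P n [set w | X n w <= x]).
  have {2}-> : x = x - r / 4 + r / 4 by lra.
  by near: n; exact: left_ray.
have h2 : fine (nu [set z | x + r / 2 <= z]) - e / 2 <=
    fine (P n [set w | x + r / 4 <= X n w]).
  have -> : x + r / 4 = x + r / 2 - r / 4 by lra.
  by near: n; exact: right_ray.
have h3 : fine (P n [set w | x + r / 4 <= X n w]) <= 1 - fine (P n [set w | X n w <= x]).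
  have m1 := mX' n _ (mle x); have m2 := mX' n _ (mge (x + r / 4)).
  have -> : 1 - fine (P n [set w | X n w <= x]) = fine (P n (~` [set w | X n w <= x])).
    by rewrite probability_setC// fineB ?fin_num_measure.
  rewrite fine_le ?fin_num_measure// ?le_measure ?inE//; try exact: measurableC.
  by move=> w /=; lra.
have h4 : 1 - Fn (x + r / 2) <= fine (nu [set z | x + r / 2 <= z]).
  have -> : 1 - Fn (x + r / 2) = fine (nu (~` [set z | z <= x + r / 2])).
    by rewrite (probability_setC nu (mle (x + r / 2))) fineB ?fin_num_measure//; exact: mle.
  apply: fine_le; rewrite ?fin_num_measure//; [exact: measurableC (mle _)|exact: mge|].
  apply: le_measure; rewrite ?inE; [exact: measurableC (mle _)|exact: mge|].
  by move=> w /=; lra.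
move: F1 F2; rewrite !ler_norml -/(Fn x) => /andP[F1 F1'] /andP[F2 F2'].
rewrite -/(Fn x); apply/andP; split; lra.
Unshelve. all: by end_near. Qed.

End levy.

(** * Steady state *)

Section truncated_expectation.
Variables (R : realType) (dO : measure_display) (Om : measurableType dO) (P : probability Om R)
  (Y : Om -> nat).
Hypothesis mY : forall n, measurable [set w | Y w = n].

Let measurable_nat_comp (f : nat -> R) : measurable_fun setT (fun w => f (Y w)).
Proof.
have H n : measurable (setT `&` Y @^-1` [set n]) by rewrite setTI; exact: mY.
exact: (measurable_fun_nat f H).
Qed.

Let cut (K : nat) (f : nat -> R) (n : nat) : R := if (n < K)%N then f n else 0.

Let expectation_cut (f : nat -> R) K :
  \int[P]_w cut K f (Y w) = \sum_(n < K) f n * fine (P [set w | Y w = n]).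
Proof.
transitivity (\int[P]_w (\sum_(n < K) f n * \1_[set w | Y w = n] w)).
  apply: eq_Rintegral => w _; rewrite /cut; case: ifPn => YK.
    rewrite (bigD1 (Ordinal YK))//= indicE mem_set//= mulr1 big1 ?addr0// => n nY.
    rewrite indicE memNset ?mulr0//= => E.
    by move/eqP : nY; apply; apply: val_inj.
  rewrite big1// => n _; rewrite indicE memNset ?mulr0//= => E.
  by move/negP : YK; apply; rewrite E.
have I1 n : P.-integrable setT (EFin \o \1_[set w | Y w = n]).
  apply: (@integrable_bounded _ _ _ P _ 1); first exact: measurable_indic.
  by move=> w; rewrite indicE; case: (_ \in _); rewrite ?normr1 ?normr0.
rewrite Rintegral_sum//; last by move=> n; exact: integrable_mulr.
apply: eq_bigr => n _; rewrite RintegralZl//; congr (_ * _).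
by rewrite /Rintegral integral_indic// setIT.
Qed.

(** The tail of the series is controlled by the missing mass. *)
Lemma expectation_truncated (f : nat -> R) (B : R) K : (forall n, `|f n| <= B) ->
  `|\int[P]_w f (Y w) - \sum_(n < K) f n * fine (P [set w | Y w = n])| <=
    B * (1 - \sum_(n < K) fine (P [set w | Y w = n])).
Proof.
move=> fB; have B0 : 0 <= B by rewrite (le_trans _ (fB 0%N)).
have Ib (g : nat -> R) (M : R) : (forall n, `|g n| <= M) ->
    P.-integrable setT (EFin \o (fun w => g (Y w))).
  by move=> gM; apply: (@integrable_bounded _ _ _ P _ M) => //; exact: measurable_nat_comp.
have cM (g : nat -> R) (M : R) : (forall n, `|g n| <= M) -> forall n, `|cut K g n| <= M.
  by move=> gM n; rewrite /cut; case: ifP => // _; rewrite normr0 (le_trans _ (gM n)).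
have If := Ib _ _ fB; have Icf := Ib _ _ (cM _ _ fB).
have one n : `|(fun=> 1 : R) (n : nat)| <= 1 by rewrite normr1.
have Ic1 := Ib _ _ (cM _ _ one); have I1 := Ib _ _ one.
rewrite -expectation_cut -RintegralB//.
have -> : 1 - \sum_(n < K) fine (P [set w | Y w = n]) = \int[P]_w (1 - cut K (fun=> 1) (Y w)).
  rewrite RintegralB// Rintegral_cst// [X in fine X]probability_setT mulr1 expectation_cut.
  by congr (_ - _); apply: eq_bigr => n _; rewrite mul1r.
have I2 : P.-integrable setT (EFin \o (fun w => 1 - cut K (fun=> 1) (Y w))).
  apply: (Ib (fun n => 1 - cut K (fun=> 1) n) 1) => n.
  by rewrite /cut; case: ifP => _; rewrite ?subrr ?normr0 ?subr0 ?normr1.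
have I3 : P.-integrable setT (EFin \o (fun w => f (Y w) - cut K f (Y w))).
  apply: (Ib (fun n => f n - cut K f n) B) => n.
  by rewrite /cut; case: ifP => _; rewrite ?subrr ?normr0 ?subr0.
rewrite -RintegralZl// (le_trans (le_normr_Rintegral _ _))//; apply: le_Rintegral => //.
- have := I3; rewrite (_ : (fun w => _) = (fun w => (fun n => f n - cut K f n) (Y w)))// => _.
  apply: (Ib (fun n => `|f n - cut K f n|) B) => n; rewrite normr_id.
  by rewrite /cut; case: ifP => _; rewrite ?subrr ?normr0 ?subr0.
- exact: integrable_mulr.
- move=> w _; rewrite /cut; case: ifP => _; first by rewrite !subrr normr0 mulr0.
  by rewrite !subr0 mulr1.
Qed.

Lemma truncated_mass_cvg :
  \sum_(n < K) fine (P [set w | Y w = n]) @[K --> \oo] --> (1 : R).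
Proof.
have -> : (1 : R) = \int[P]_w 1.
  by rewrite Rintegral_cst// [X in fine X]probability_setT mulr1.
rewrite (_ : (fun K => _) = (fun K => \int[P]_w cut K (fun=> 1) (Y w))); last first.
  by apply/funext => K; rewrite expectation_cut; apply: eq_bigr => n _; rewrite mul1r.
apply: (@bounded_cvg_Rintegral _ _ _ P setT (fun K w => cut K (fun=> 1) (Y w)) _ 1) => //.
- by rewrite (le_lt_trans (probability_le1 _ _))// ltry.
- by move=> K w _; rewrite /cut; case: ifP => _; rewrite ?normr1 ?normr0.
- move=> w _; apply: cvg_near_cst; exists (Y w).+1 => // K /= YK; by rewrite /cut YK.
Qed.

End truncated_expectation.

(** Pointwise convergence of the weights of integer-valued laws to a law of mass one
forces convergence of bounded expectations. *)
Lemma steady_state_expectation (R : realType) (dO dO' : measure_display)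
    (Om : measurableType dO) (Om' : measurableType dO') (P : probability Om R)
    (P' : probability Om' R) (M : R -> Om -> nat) (Y : Om' -> nat) (f : nat -> R) (B : R) :
  (forall t n, 0 <= t -> measurable [set w | M t w = n]) ->
  has_steady_state_law P M P' Y -> (forall n, `|f n| <= B) ->
  \int[P]_w f (M t w) @[t --> +oo] --> \int[P']_w f (Y w).
Proof.
move=> mM [mY lawY] fB; have B0 : 0 <= B by rewrite (le_trans _ (fB 0%N)).
have mY' n : measurable [set w | Y w = n].
  by rewrite -[X in measurable X]setTI; exact: (mY measurableT [set n]).
apply/cvgrPdist_le => e e0.
pose e' := e / (4 * (B + 1)).
have B1 : 0 < B + 1 by rewrite ltr_wpDl.
have e'0 : 0 < e' by rewrite divr_gt0// mulr_gt0.
have Be' : 4 * (B * e') <= e.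
  rewrite /e' mulrA mulrA ler_pdivrMr ?mulr_gt0//; have := e0; have := B0; nra.
have /cvgrPdist_le/(_ _ e'0)[K _ /(_ K (leqnn K)) /= hK] := truncated_mass_cvg P' mY'.
have cvgp n : fine (P [set w | M t w = n]) @[t --> +oo] --> fine (P' [set w | Y w = n]).
  by apply: fine_cvg; rewrite fineK ?fin_num_measure//; exact: lawY.
have cS : \sum_(n < K) fine (P [set w | M t w = n]) @[t --> +oo] -->
    \sum_(n < K) fine (P' [set w | Y w = n]).
  by apply: cvg_sumr => n _; exact: cvgp.
have cA : \sum_(n < K) f n * fine (P [set w | M t w = n]) @[t --> +oo] -->
    \sum_(n < K) f n * fine (P' [set w | Y w = n]).
  by apply: cvg_sumr => n _; apply: cvgMr; exact: cvgp.
have e4 : 0 < e / 4 by rewrite divr_gt0.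
move/cvgrPdist_le : cS => /(_ _ e'0) cS; move/cvgrPdist_le : cA => /(_ _ e4) cA.
near=> t.
have t0 : 0 <= t by near: t; exact: nbhs_pinfty_ge.
have h1 := expectation_truncated P' mY' K fB.
have h2 := expectation_truncated P (fun n => mM t n t0) K fB.
have h3 : `|\sum_(n < K) fine (P' [set w | Y w = n]) -
   \sum_(n < K) fine (P [set w | M t w = n])| <= e' by near: t.
have h4 : `|\sum_(n < K) f n * fine (P' [set w | Y w = n]) -
   \sum_(n < K) f n * fine (P [set w | M t w = n])| <= e / 4 by near: t.
move: h1 h2 h3 h4 hK.
set S' := \sum_(n < K) fine (P' _); set S := \sum_(n < K) fine (P _).
set A' := \sum_(n < K) f n * fine (P' _); set A := \sum_(n < K) f n * fine (P _).
move=> h1 h2; rewrite !ler_norml => /andP[h3 h3'] /andP[h4 h4'] /andP[h5 h5'].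
have b1 : B * (1 - S') <= B * e' by rewrite ler_wpM2l.
have b2 : B * (1 - S) <= B * (e' + e') by rewrite ler_wpM2l//; lra.
move: h1 h2; rewrite !ler_norml => /andP[h1 h1'] /andP[h2 h2'].
by apply/andP; split; lra.
Unshelve. all: by end_near. Qed.

(** * Central limit theorems *)

Lemma normal_law_fourier (R : realType) (v : R) : 0 <= v ->
  exists nu : probability (measurableTypeR R) R, (forall A, nu A = normal_law 0 v A) /\
    forall th c, \int[nu]_y cos (th * y + c) = cos c * expR (- (th ^+ 2 / 2 * v)).
Proof.
rewrite le_eqVlt => /predU1P[<-|v0].
  exists (@dirac _ (measurableTypeR R) 0 R); split; first by rewrite /normal_law eqxx.
  move=> th c; rewrite mulr0 oppr0 expR0 mulr1 /Rintegral integral_dirac//.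
    by rewrite diracT mul1e/= mulr0 add0r.
  apply/measurable_EFinP; apply: continuous_measurable_fun => y.
  apply: continuous_comp; last exact: continuous_cos.
  by apply: cvgD; [apply: cvgMr; exact: cvg_id|exact: cvg_cst].
exists (normal_prob 0 (Num.sqrt v)); split; first by rewrite /normal_law gt_eqF.
by move=> th c; rewrite gaussian_fourier ?sqrtr_gt0// sqr_sqrtr// ltW.
Qed.

(** The variance is nonnegative because the limit is bounded by one. *)
Lemma cvg_to_centered_normal_of_fourier (R : realType) (dO : nat -> measure_display)
    (Om : forall N, measurableType (dO N)) (P : forall N, probability (Om N) R)
    (X : forall N, Om N -> R) (v : R) :
  (forall N, (0 < N)%N -> measurable_fun setT (X N)) ->
  (forall th c, \int[P N]_w cos (th * X N w + c) @[N --> \oo] -->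
     cos c * expR (- (th ^+ 2 / 2 * v))) ->
  cvg_to_centered_normal P X v.
Proof.
move=> mX cvgX.
have v0 : 0 <= v.
  have cvg1 := cvgX 1 0.
  have : cos 0 * expR (- (1 ^+ 2 / 2 * v)) <= 1.
    rewrite -(cvg_lim (@Rhausdorff R) cvg1); apply: limr_le; first exact: cvgP cvg1.
    near=> N; have N0 : (0 < N)%N by near: N; exact: nbhs_infty_gt.
    apply: (le_trans (ler_norm _)).
    apply: (@norm_expectation_le _ _ _ (P N) (fun w => cos (1 * X N w + 0)) 1).
      apply: (measurableT_comp (@measurable_cosR R)); apply: measurable_funD => //.
      by apply: measurable_funM => //; exact: mX.
    by move=> w; exact: norm_cos_le1.
  by rewrite cos0 mul1r expr1n -[leRHS]expR0 ler_expR oppr_le0 pmulr_rge0.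
split=> //; have [nu [nuE nuF]] := normal_law_fourier v0.
have L := @levy_continuity R (fun n => dO n.+1) (fun n => Om n.+1) (fun n => P n.+1)
  (fun n => X n.+1) nu (fun n => mX _ (ltn0Sn n)).
have {}L : cvg_in_distribution (fun n => P n.+1) (fun n => X n.+1) nu.
  apply: L => th c; rewrite nuF.
  by have := cvgX th c; rewrite -cvg_shiftS.
have -> : normal_law 0 v = nu :> (set R -> \bar R) by apply/funext => A; rewrite nuE.
move=> x /(L x) Lx.
by rewrite -(cvg_shiftS (fun N => P N [set w | X N w <= x])).
Unshelve. all: by end_near. Qed.

Section scaling.
Variable R : realType.

Lemma cvg_powR_neg (e : R) : e < 0 -> N%:R `^ e @[N --> \oo] --> (0 : R).
Proof.
move=> e0; rewrite -cvg_shiftS.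
have e1 : 0 < - e by rewrite oppr_gt0.
have /cvg_at_rightP/(_ (fun N => N.+1%:R^-1)) H := powR_cvg0 e1.
rewrite (_ : (fun N => _) = (fun N => N.+1%:R^-1 `^ (- e))).
  by apply: H; split; [move=> n; rewrite invr_gt0 ltr0n|exact: cvg_harmonic].
by apply/funext => N; rewrite -powR_inv1 ?ler0n// -powRrM mulN1r opprK.
Qed.

Lemma powR_nat_le1 (e : R) N : (0 < N)%N -> e <= 0 -> N%:R `^ e <= 1.
Proof.
move=> N0 e0; rewrite -[leRHS](powRr0 N%:R) ler_powR//.
by rewrite ler1n.
Qed.

(** Powers of [N] with a nonpositive exponent detect whether the exponent vanishes. *)
Lemma cvg_powR_nonpos (e : R) : e <= 0 ->
  N%:R `^ e @[N --> \oo] --> ((e == 0)%:R : R).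
Proof.
rewrite le_eqVlt => /predU1P[->|e0]; last by rewrite lt_eqF//; exact: cvg_powR_neg.
by rewrite eqxx; under eq_cvg do rewrite powRr0; exact: cvg_cst.
Qed.

End scaling.

Section central_limit.
Variables (R : realType) (d : nat) (Q : 'M[R]_d) (p lam mu : 'I_d -> R) (alpha : R).
Hypotheses (Qrate : is_rate_matrix Q) (Qirr : irreducible_rates Q)
  (pstat : is_stationary_distribution Q p) (lam_ge0 : forall i, 0 <= lam i)
  (mu_gt0 : forall i, 0 < mu i) (alpha_gt0 : 0 < alpha).

Let Vsum u := \sum_j \sum_k V_at Q p lam mu u j k.
Let gamma := Num.max (1 - alpha / 2) (1 / 2).

Let gammaE : (alpha <= 1 /\ gamma = 1 - alpha / 2) \/ (1 <= alpha /\ gamma = 1 / 2).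
Proof.
have [a1|a1] := leP alpha 1.
  by left; split=> //; apply/max_idPl; lra.
by right; split; [exact: ltW|apply/max_idPr; lra].
Qed.

Let de (N : nat) : R := (N%:R `^ gamma)^-1.
Let r (N : nat) : R := N%:R `^ alpha.
Let err (N : nat) : R := N%:R * de N / r N + de N + (r N)^-1.

Let nat_gt0 N : (0 < N)%N -> (0 : R) < N%:R. Proof. by rewrite ltr0n. Qed.

Let errE N : (0 < N)%N ->
  [/\ de N = N%:R `^ (- gamma), (r N)^-1 = N%:R `^ (- alpha),
      N%:R * de N / r N = N%:R `^ (1 - gamma - alpha),
      N%:R ^+ 2 * de N ^+ 2 / r N = N%:R `^ (2 - 2 * gamma - alpha) &
      N%:R * de N ^+ 2 = N%:R `^ (1 - 2 * gamma)].
Proof.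
move=> /nat_gt0 N0; have Nn : N%:R != 0 :> R by rewrite gt_eqF.
have D (x y : R) : N%:R `^ (x + y) = N%:R `^ x * N%:R `^ y by rewrite powRD// Nn implybT.
have d1 : de N = N%:R `^ (- gamma) by rewrite powRN.
have r1 : (r N)^-1 = N%:R `^ (- alpha) by rewrite powRN.
have n1 : N%:R = N%:R `^ 1 :> R by rewrite powRr1// ltW.
have d2 : de N ^+ 2 = N%:R `^ (- gamma + - gamma) by rewrite D -d1 expr2.
have n2 : N%:R ^+ 2 = N%:R `^ 2 :> R by rewrite powR_mulrn// ltW.
split=> //.
- by rewrite r1 d1 {1}n1 -!D.
- by rewrite r1 d2 n2 -!D; congr (_ `^ _); ring.
- by rewrite d2 {1}n1 -D; congr (_ `^ _); ring.
Qed.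

Let cvg_err : err N @[N --> \oo] --> (0 : R).
Proof.
rewrite -[X in _ --> X]addr0 -[X in _ --> X + _]addr0.
have E : \forall N \near \oo,
    N%:R `^ (1 - gamma - alpha) + N%:R `^ (- gamma) + N%:R `^ (- alpha) = err N.
  exists 1%N => // N /= N0; have [e1 e2 e3 _ _] := errE N0.
  by rewrite /err e3 e2 {1}e1.
apply: cvg_trans (near_eq_cvg E) _.
by apply: cvgD; [apply: cvgD|]; apply: cvg_powR_neg; case: gammaE => -[a1 a2]; rewrite ?a2;
  have := alpha_gt0; lra.
Qed.

Let cvg_c1 : N%:R ^+ 2 * de N ^+ 2 / r N @[N --> \oo] --> ((alpha <= 1)%R%:R : R).
Proof.
have E : \forall N \near \oo,
    N%:R `^ (2 - 2 * gamma - alpha) = N%:R ^+ 2 * de N ^+ 2 / r N.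
  by exists 1%N => // N /= N0; have [_ _ _ -> _] := errE N0.
apply: cvg_trans (near_eq_cvg E) _.
have -> : (alpha <= 1) = (2 - 2 * gamma - alpha == 0).
  case: gammaE => -[a1 ->]; first by rewrite a1; apply/esym/eqP; lra.
  by apply/idP/eqP; lra.
by apply: cvg_powR_nonpos; case: gammaE => -[a1 ->]; lra.
Qed.

Let cvg_c2 : N%:R * de N ^+ 2 @[N --> \oo] --> ((1 <= alpha)%R%:R : R).
Proof.
have E : \forall N \near \oo, N%:R `^ (1 - 2 * gamma) = N%:R * de N ^+ 2.
  by exists 1%N => // N /= N0; have [_ _ _ _ ->] := errE N0.
apply: cvg_trans (near_eq_cvg E) _.
have -> : (1 <= alpha) = (1 - 2 * gamma == 0).
  case: gammaE => -[a1 ->]; last by rewrite a1; apply/esym/eqP; lra.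
  by apply/idP/eqP; lra.
by apply: cvg_powR_nonpos; case: gammaE => -[a1 ->]; lra.
Qed.

Let small N : (0 < N)%N -> [/\ 0 < de N, de N <= 1,
  N%:R ^+ 2 * de N ^+ 2 / r N <= 1 & N%:R * de N ^+ 2 <= 1].
Proof.
move=> N0; have [e1 _ _ -> ->] := errE N0.
have de0 : 0 < de N by rewrite invr_gt0 powR_gt0// nat_gt0.
by split=> //; rewrite ?e1; apply: powR_nat_le1 => //; case: gammaE => -[a1 a2]; rewrite a2; lra.
Qed.

Let r_gt0 N : (0 < N)%N -> 0 < r N.
Proof. by move=> N0; rewrite powR_gt0// nat_gt0. Qed.

Let measurable_number (dO : measure_display) (Om : measurableType dO) (P : probability Om R)
    (J : R -> Om -> 'I_d) (T : 'I_d -> nat -> Om -> \bar R) (S : 'I_d -> nat -> Om -> R) N t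
    (f : nat -> R) : is_modelII P (r N *: Q) (fun i => N%:R * lam i) mu J T S -> 0 <= t ->
  measurable_fun setT (fun w => f (number_in_system J T S t w)).
Proof. by move=> model t0; exact: (measurable_fun_state_number model mu_gt0 (fun=> f) t0). Qed.

(** The coefficients of the two variances tend to indicators while the error vanishes. *)
Let cvg_fourier (E : nat -> R) (K th c vs vr : R) :
  (forall N, (0 < N)%N -> `|E N - cos c * expR (- (th ^+ 2 / 2 *
    (N%:R ^+ 2 * de N ^+ 2 / r N * vs + N%:R * de N ^+ 2 * vr)))| <= K * err N) ->
  E N @[N --> \oo] --> cos c * expR (- (th ^+ 2 / 2 *
    (vs * (alpha <= 1)%R%:R + vr * (1 <= alpha)%R%:R))).
Proof.
move=> HE.
pose b N := cos c * expR (- (th ^+ 2 / 2 *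
    (N%:R ^+ 2 * de N ^+ 2 / r N * vs + N%:R * de N ^+ 2 * vr))).
have cb : b N @[N --> \oo] --> cos c * expR (- (th ^+ 2 / 2 *
    (vs * (alpha <= 1)%R%:R + vr * (1 <= alpha)%R%:R))).
  apply: cvgMr; apply: continuous_cvg; first exact: continuous_expR.
  apply: cvgN; apply: cvgMr; rewrite [vs * _]mulrC [vr * _]mulrC.
  by apply: cvgD; apply: cvgMl; [exact: cvg_c1|exact: cvg_c2].
have cd : E N - b N @[N --> \oo] --> (0 : R).
  apply: norm_cvg0.
  have ck : K * err N @[N --> \oo] --> (0 : R) by rewrite -(mulr0 K); exact: cvgMr.
  apply: (@squeeze_cvgr _ _ _ _ (cst 0) _ _ _ _ _ ck); last exact: cvg_cst.
  by exists 1%N => // N /= N0; rewrite normr_ge0 HE.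
have -> : E = (fun N => (E N - b N) + b N) by apply/funext => N; rewrite subrK.
by rewrite -[X in _ --> X]add0r; exact: cvgD.
Qed.

Let decay_cvg (c x : R) : 0 < c -> x * (1 - expR (- (c * t))) @[t --> +oo] --> x.
Proof.
move=> c0; rewrite -[X in _ --> X]mulr1; apply: cvgMr.
rewrite -[X in _ --> X]subr0; apply: cvgB; first exact: cvg_cst.
by under eq_cvg do rewrite -mulNr; exact: cvg_expR_decay.
Qed.

Let cvg_rho : rho_at p lam mu t @[t --> +oo] --> rho p lam mu.
Proof. by apply: cvg_sumr => k _; exact: decay_cvg. Qed.

Let cvg_Vsum : Vsum t @[t --> +oo] --> \sum_j \sum_k V Q p lam mu j k.
Proof.
apply: cvg_sumr => j _; apply: cvg_sumr => k _; rewrite mxE.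
by under eq_cvg do rewrite mxE; apply: decay_cvg; rewrite addr_gt0.
Qed.

Variables (dO : nat -> measure_display) (Om : forall N, measurableType (dO N))
    (P : forall N, probability (Om N) R)
    (J : forall N, R -> Om N -> 'I_d)
    (T : forall N, 'I_d -> nat -> Om N -> \bar R)
    (S : forall N, 'I_d -> nat -> Om N -> R).
Hypothesis model : forall N : nat, (0 < N)%N ->
  is_modelII (P N) (N%:R `^ alpha *: Q) (fun i => N%:R * lam i) mu (@J N) (@T N) (@S N).

Let scaledE (th c x y : R) N : th * ((x - y) / N%:R `^ gamma) + c = th * de N * (x - y) + c.
Proof. by rewrite /de; ring. Qed.

Lemma transient_central_limit t : 0 <= t ->
  cvg_to_centered_normal P
    (fun N w => ((number_in_system (@J N) (@T N) (@S N) t w)%:R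
                 - N%:R * rho_at p lam mu t) / N%:R `^ gamma)
    (\sum_j \sum_k V_at Q p lam mu t j k * (alpha <= 1)%R%:R
     + rho_at p lam mu t * (1 <= alpha)%R%:R).
Proof.
move=> t0; apply: cvg_to_centered_normal_of_fourier.
  move=> N N0.
  exact: (measurable_number (fun x => (x%:R - N%:R * rho_at p lam mu t) / N%:R `^ gamma) (model N0) t0).
move=> th c.
have -> : \sum_j \sum_k V_at Q p lam mu t j k * (alpha <= 1)%R%:R = Vsum t * (alpha <= 1)%R%:R.
  by rewrite mulr_suml; apply: eq_bigr => j _; rewrite mulr_suml.
have [K K0 HK] := charfun_estimate Qrate Qirr pstat lam_ge0 mu_gt0 th.
apply: (@cvg_fourier _ K) => N N0; have [d0 d1 c1 c2] := small N0.
under eq_Rintegral do rewrite scaledE.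
exact: (HK _ _ _ (nat_gt0 N0) (r_gt0 N0) d0 d1 c1 c2 _ _ _ _ _ _ (model N0)).
Qed.

Variables (dO' : nat -> measure_display) (Om' : forall N, measurableType (dO' N))
    (P' : forall N, probability (Om' N) R) (Minf : forall N, Om' N -> nat).
Hypothesis steady : forall N : nat, (0 < N)%N ->
  has_steady_state_law (P N) (number_in_system (@J N) (@T N) (@S N)) (P' N) (@Minf N).

Lemma steady_state_central_limit :
  cvg_to_centered_normal P'
    (fun N w => ((Minf w)%:R - N%:R * rho p lam mu) / N%:R `^ gamma)
    (\sum_j \sum_k V Q p lam mu j k * (alpha <= 1)%R%:R
     + rho p lam mu * (1 <= alpha)%R%:R).
Proof.
apply: cvg_to_centered_normal_of_fourier.
  move=> N N0; have [mM _] := steady N0.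
  have H n : measurable (setT `&` @Minf N @^-1` [set n]) by exact: mM.
  exact: (measurable_fun_nat (fun x => (x%:R - N%:R * rho p lam mu) / N%:R `^ gamma) H).
move=> th c.
set Vinf := \sum_j \sum_k V Q p lam mu j k.
have -> : \sum_j \sum_k V Q p lam mu j k * (alpha <= 1)%R%:R = Vinf * (alpha <= 1)%R%:R.
  by rewrite mulr_suml; apply: eq_bigr => j _; rewrite mulr_suml.
have [K K0 HK] := charfun_estimate Qrate Qirr pstat lam_ge0 mu_gt0 th.
apply: (@cvg_fourier _ K) => N N0; have [d0 d1 c1 c2] := small N0.
under eq_Rintegral do rewrite scaledE.
set ro := rho p lam mu.
(* The phase [cc t] trades the centring at [rho_at t] for the centring at [rho]; the
   estimate holds for every phase. *)
pose cc t := c + th * de N * N%:R * (rho_at p lam mu t - ro).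
pose b t := cos (cc t) * expR (- (th ^+ 2 / 2 *
  (N%:R ^+ 2 * de N ^+ 2 / r N * Vsum t + N%:R * de N ^+ 2 * rho_at p lam mu t))).
pose f (x : nat) := cos (th * de N * (x%:R - N%:R * ro) + c).
have est t : 0 <= t ->
    `|\int[P N]_w f (number_in_system (@J N) (@T N) (@S N) t w) - b t| <= K * err N.
  move=> t0.
  have := HK _ _ _ (nat_gt0 N0) (r_gt0 N0) d0 d1 c1 c2 _ _ _ _ _ _ (model N0) t (cc t) t0.
  rewrite (_ : (fun w => cos _) = (fun w => f (number_in_system (@J N) (@T N) (@S N) t w)))//.
  by apply/funext => w; rewrite /f /cc; congr cos; ring.
have cE : \int[P N]_w f (number_in_system (@J N) (@T N) (@S N) t w) @[t --> +oo] -->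
    \int[P' N]_w f (Minf w).
  apply: (steady_state_expectation (B := 1) _ (steady N0)).
    move=> t n t0; have := measurable_number (fun x => (x == n)%:R) (model N0) t0.
    move=> /(_ measurableT [set 1] (measurable_set1 _)); rewrite setTI.
    congr measurable; apply/seteqP; split => w /=; last by move=> ->; rewrite eqxx.
    by case: eqP => // _ /eqP; rewrite eq_sym oner_eq0.
  by move=> n; exact: norm_cos_le1.
have cb : b t @[t --> +oo] --> cos c * expR (- (th ^+ 2 / 2 *
  (N%:R ^+ 2 * de N ^+ 2 / r N * Vinf + N%:R * de N ^+ 2 * ro))).
  apply: cvgM.
    apply: continuous_cvg; first exact: continuous_cos.
    rewrite -[X in _ --> X]addr0; apply: cvgD; first exact: cvg_cst.
    rewrite -(mulr0 (th * de N * N%:R)) -(subrr ro); apply: cvgMr.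
    by apply: cvgB; [exact: cvg_rho|exact: cvg_cst].
  apply: continuous_cvg; first exact: continuous_expR.
  apply: cvgN; apply: cvgMr; apply: cvgD; apply: cvgMr; [exact: cvg_Vsum|exact: cvg_rho].
move: cE cb; set limE := \int[P' N]_w f _; set limb := cos c * _ => cE cb.
have cn : `|\int[P N]_w f (number_in_system (@J N) (@T N) (@S N) t w) - b t| @[t --> +oo] -->
    `|limE - limb| by apply: cvg_norm; exact: cvgB.
rewrite -(cvg_lim (@Rhausdorff R) cn); apply: limr_le; first exact: cvgP cn.
by near=> t; apply: est; near: t; exact: nbhs_pinfty_ge.
Unshelve. all: by end_near. Qed.

End central_limit.

Theorem corollary2 (R : realType) (d : nat)
    (Q : 'M[R]_d) (p lam mu : 'I_d -> R) (alpha : R)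
    (Qrate : is_rate_matrix Q) (Qirr : irreducible_rates Q)
    (pstat : is_stationary_distribution Q p)
    (lam_ge0 : forall i, 0 <= lam i) (mu_gt0 : forall i, 0 < mu i)
    (alpha_gt0 : 0 < alpha)
    (dO : nat -> measure_display) (Om : forall N, measurableType (dO N))
    (P : forall N, probability (Om N) R)
    (J : forall N, R -> Om N -> 'I_d)
    (T : forall N, 'I_d -> nat -> Om N -> \bar R)
    (S : forall N, 'I_d -> nat -> Om N -> R)
    (model : forall N : nat, (0 < N)%N ->
       is_modelII (P N) (N%:R `^ alpha *: Q) (fun i => N%:R * lam i) mu
         (J N) (T N) (S N))
    (dO' : nat -> measure_display) (Om' : forall N, measurableType (dO' N))
    (P' : forall N, probability (Om' N) R)
    (Minf : forall N, Om' N -> nat)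
    (steady : forall N : nat, (0 < N)%N ->
       has_steady_state_law (P N) (number_in_system (J N) (T N) (S N))
         (P' N) (Minf N)) :
  let gamma := Num.max (1 - alpha / 2) (1 / 2) in
  cvg_to_centered_normal P'
    (fun N w => ((Minf N w)%:R - N%:R * rho p lam mu) / N%:R `^ gamma)
    (\sum_j \sum_k V Q p lam mu j k * (alpha <= 1)%R%:R
     + rho p lam mu * (1 <= alpha)%R%:R)
  /\
  forall t : R, 0 <= t ->
    cvg_to_centered_normal P
      (fun N w => ((number_in_system (J N) (T N) (S N) t w)%:R
                   - N%:R * rho_at p lam mu t) / N%:R `^ gamma)
      (\sum_j \sum_k V_at Q p lam mu t j k * (alpha <= 1)%R%:R
       + rho_at p lam mu t * (1 <= alpha)%R%:R).
Proof.
split; first exact: (steady_state_central_limit Qrate Qirr pstat lam_ge0 mu_gt0 alpha_gt0 model steady).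
by move=> t; exact: transient_central_limit.
Qed.
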